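(* Let $N\in\mathbb{N}$ and let $b=(b_1,\ldots,b_N)\in\mathbb{R}^N$, $m=(m_1,\ldots,m_N)\in\mathbb{R}^N$, $\sigma=(\sigma_1,\ldots,\sigma_N)\in(0,\infty)^N$ be given, and assume that $b$ is nonincreasing, i.e. $b_1\ge b_2\ge\cdots\ge b_N$. Then pathwise uniqueness and strong existence hold for each of the four systems (SDE), (SDER), (SDI) and (SDIR) with data $(b,m,\sigma)$, as defined in the context.
   Context: Write $[N]=\{1,\ldots,N\}$, $\mathbb{R}_+=[0,\infty)$. $C(\mathbb{R}_+,X)$ denotes continuous paths in $X$, and $C_0^\uparrow(\mathbb{R}_+,\mathbb{R}_+)$ the set of continuous nondecreasing functions $\mathbb{R}_+\to\mathbb{R}_+$ vanishing at zero. Rank function: for $i\in[N]$, $x\in\mathbb{R}^N$, $\mathrm{rank}(i;x)=\#\{j\in[N]:x_j<x_i\}+\#\{j\le i:x_j=x_i\}$. $\Pi$ is the set of all permutations of $[N]$; for $\pi\in\Pi$, $b_\pi=(b_{\pi(1)},\ldots,b_{\pi(N)})$; for $x\in\mathbb{R}^N$, $\mathfrak{P}(x)=\{\pi\in\Pi: x_i<x_j \text{ implies } \pi(i)<\pi(j)\text{ for all }i,j\in[N]\}$. $\mathrm{conv}(A)$ is the convex hull of $A$. The systems (for $t\ge0$, $i\in[N]$), driven by an $N$-dimensional Brownian motion $B$, are: (SDE): $X_i(t)=X_{0,i}+\sigma_iB_i(t)+m_it+\int_0^tb_{\mathcal{R}_i(s)}ds$, with $\mathcal{R}_i(t)=\mathrm{rank}(i;X(t))$.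 (SDER): $X_i(t)=X_{0,i}+\sigma_iB_i(t)+m_it+\int_0^tb_{\mathcal{R}_i(s)}ds+L_i(t)\ge0$, with $\mathcal{R}_i(t)=\mathrm{rank}(i;X(t))$ and $\int_0^\infty X_i(t)\,dL_i(t)=0$. (SDI): $X_i(t)=X_{0,i}+\sigma_iB_i(t)+m_it+\int_0^t\beta_i(s)ds$, with $\beta(t)=(\beta_1(t),\ldots,\beta_N(t))\in\mathrm{conv}\{b_\pi:\pi\in\mathfrak{P}(X(t))\}$ for a.e. $t\in\mathbb{R}_+$. (SDIR), on the state space $\mathbb{R}_+^N$: $X_i(t)=X_{0,i}+\sigma_iB_i(t)+m_it+\int_0^t\beta_i(s)ds+L_i(t)$, with $\beta(t)\in\mathrm{conv}\{b_\pi:\pi\in\mathfrak{P}(X(t))\}$ for a.e. $t$ and $\int_0^\infty X_i(t)\,dL_i(t)=0$. Solutions. Given a stochastic basis $(\Omega,\mathcal{F},\mathbb{F}=\{\mathcal{F}_t\},\mathbb{P})$ satisfying the usual conditions, an $N$-dimensional $\mathbb{F}$-Brownian motion $B$ and an $\mathcal{F}_0$-measurable $X_0$ (with values in $\mathbb{R}^N$ for (SDE), (SDI); in $\mathbb{R}_+^N$ for (SDER), (SDIR)), a strong solution of (SDER) (resp. (SDE)) is an $\mathbb{F}$-adapted process $(X,L)$ with paths in $C(\mathbb{R}_+,\mathbb{R}_+^N)\times C_0^\uparrow(\mathbb{R}_+,\mathbb{R}_+)^N$ (resp. $X$ with paths in $C(\mathbb{R}_+,\mathbb{R}^N)$) satisfying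 the system. For (SDIR) (resp. (SDI)) the definition is the same, requiring in addition that there exist an $\mathbb{F}$-progressively measurable process $\beta$ for which the system holds. Strong existence means that a strong solution exists on any such given basis with given $B$ and $X_0$. A weak solution is a stochastic basis satisfying the usual conditions together with processes $(X,L,B)$ (resp. $(X,B)$) on it, where $B$ is an $\mathbb{F}$-Brownian motion in dimension $N$, $X_0$ is $\mathcal{F}_0$-measurable, $(X,L)$ (resp. $X$) is $\mathbb{F}$-adapted with paths in $C(\mathbb{R}_+,\mathbb{R}_+^N)\times C_0^\uparrow(\mathbb{R}_+,\mathbb{R}_+)^N$ (resp. $C(\mathbb{R}_+,\mathbb{R}^N)$), and the system holds a.s. (with some progressively measurable $\beta$ in the case of inclusions). Pathwise uniqueness means: for any two weak solutions $(X,L,B)$, $(\tilde X,\tilde L,B)$ (resp. $(X,B)$, $(\tilde X,B)$) on the same stochastic basis with the same Brownian motion and common initial value, $X$ and $\tilde X$ are indistinguishable, and so are $L$ and $\tilde L$ (where applicable). *)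

(* Defs.v *)
From HB Require Import structures.
From mathcomp Require Import all_boot all_order all_algebra all_fingroup.
From mathcomp Require Import all_classical all_reals all_analysis.

Set Implicit Arguments.
Unset Strict Implicit.
Unset Printing Implicit Defensive.

Import Order.TTheory GRing.Theory Num.Theory.
Import numFieldNormedType.Exports.

Local Open Scope classical_set_scope.
Local Open Scope ring_scope.

(* Conventions.  Vectors of R^N are row vectors 'rV[R]_N, with coordinates
   indexed by 'I_N = {0, ..., N-1} (the index i of the mathematics is i + 1).
   The time half-line [0, +oo[ is embedded in R: processes are functions
   R -> Omega -> 'rV[R]_N, and nothing is asked of them at negative times.
   Measurability with respect to the Borel sets of R^N is measurability of
   each coordinate. *)

Section rank.
Variables (R : realType) (N : nat).
Implicit Types (x b : 'rV[R]_N) (i j : 'I_N).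

Definition rank i x : nat :=
  (#|[pred j | (x 0 j < x 0 i)%R]| +
   #|[pred j : 'I_N | (j <= i)%N && (x 0 j == x 0 i)%R]|)%N.

Lemma rank_bounds i x : (0 < rank i x <= N)%N.
Proof.
rewrite /rank; apply/andP; split.
  rewrite addn_gt0; apply/orP; right.
  by apply/card_gt0P; exists i; rewrite inE leqnn eqxx.
rewrite -cardUI [X in (_ + X)%N]eq_card0 ?addn0.
  by rewrite -[X in (_ <= X)%N]card_ord max_card.
by move=> j; rewrite !inE; case: ltgtP => //; rewrite ?andbF.
Qed.

Lemma rank_pred_lt i x : ((rank i x).-1 < N)%N.
Proof. by have /andP[r0 rN] := rank_bounds i x; rewrite prednK. Qed.

(* The rank takes its values in {1, ..., N}; as an index in 'I_N it is shifted
   by one. *)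
Definition rank_ord i x : 'I_N := Ordinal (rank_pred_lt i x).

Definition permute_coef b (p : 'S_N) : 'rV[R]_N := \row_i b 0 (p i).

Definition rank_perms x : set 'S_N :=
  [set p : 'S_N | forall i j, x 0 i < x 0 j -> (p i < p j)%N].

Definition convex_hull (A : set 'rV[R]_N) : set 'rV[R]_N :=
  smallest (@convex_set R 'rV[R]_N) A.

Definition drift_set b x : set 'rV[R]_N :=
  convex_hull [set permute_coef b p | p in rank_perms x].

End rank.

Section paths.
Variables (R : realType) (N : nat).

(* C(R_+, R^N) *)
Definition continuous_path (x : R -> 'rV[R]_N) : Prop :=
  {within `[0, +oo[, continuous x}.

(* C(R_+, R_+^N) *)
Definition nonneg_continuous_path (x : R -> 'rV[R]_N) : Prop :=
  continuous_path x /\ forall (t : R) i, 0 <= t -> 0 <= x t 0 i.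

(* C_0^up(R_+, R_+) *)
Definition C0up (l : R -> R) : Prop :=
  [/\ {within `[0, +oo[, continuous l}, l 0 = 0,
      (forall s t : R, 0 <= s -> s <= t -> l s <= l t) &
      (forall t : R, 0 <= t -> 0 <= l t)].

(* The Stieltjes integral of x with respect to l over [0, +oo[ vanishes.  The
   integrator is extended to R by the constant l 0 on negative times; for l in
   C_0^up this extension is indeed a cumulative function. *)
Definition stieltjes_integral_eq0 (x l : R -> R) : Prop :=
  exists2 lbar : cumulative R R,
    (forall t : R, lbar t = l (Num.max 0 t)) &
    (\int[lebesgue_stieltjes_measure lbar]_(t in `[0%R, +oo[) (x t)%:E = 0)%E.

End paths.

(* The four systems, as relations between deterministic paths: x0 is the
   initial value, w the driving path, x the solution, l the reflection term and
   beta the drift selected in the inclusions. *)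
Section systems.
Variables (R : realType) (N : nat) (b m sigma : 'rV[R]_N).
Implicit Types (w x l beta : R -> 'rV[R]_N).
Local Notation leb := (@lebesgue_measure R).

Definition SDE (x0 : 'rV[R]_N) w x : Prop :=
  forall (t : R) i, 0 <= t ->
    x t 0 i = x0 0 i + sigma 0 i * w t 0 i + m 0 i * t
            + \int[leb]_(s in `[0, t]) b 0 (rank_ord i (x s)).

Definition SDER (x0 : 'rV[R]_N) w x l : Prop :=
  (forall (t : R) i, 0 <= t ->
    x t 0 i = x0 0 i + sigma 0 i * w t 0 i + m 0 i * t
            + \int[leb]_(s in `[0, t]) b 0 (rank_ord i (x s)) + l t 0 i
    /\ 0 <= x t 0 i)
  /\ forall i, stieltjes_integral_eq0 (fun t => x t 0 i) (fun t => l t 0 i).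

Definition SDI (x0 : 'rV[R]_N) w beta x : Prop :=
  (forall (t : R) i, 0 <= t ->
    x t 0 i = x0 0 i + sigma 0 i * w t 0 i + m 0 i * t
            + \int[leb]_(s in `[0, t]) beta s 0 i)
  /\ {ae leb, forall t : R, 0 <= t -> drift_set b (x t) (beta t)}.

Definition SDIR (x0 : 'rV[R]_N) w beta x l : Prop :=
  [/\ (forall (t : R) i, 0 <= t ->
        x t 0 i = x0 0 i + sigma 0 i * w t 0 i + m 0 i * t
                + \int[leb]_(s in `[0, t]) beta s 0 i + l t 0 i),
      {ae leb, forall t : R, 0 <= t -> drift_set b (x t) (beta t)} &
      forall i, stieltjes_integral_eq0 (fun t => x t 0 i) (fun t => l t 0 i)].

End systems.

Section stochastic_basis.
Variables (R : realType) (d : measure_display) (T : measurableType d).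
Variables (P : probability T R) (F : R -> set_system T).

(* (T, d.-measurable, F, P) is a stochastic basis satisfying the usual
   conditions.  A negligible set is any subset of a measurable null set, so the
   last field also says that P is complete. *)
Record usual_basis : Prop := UsualBasis {
  filtration_sigma_algebra :
    forall t : R, 0 <= t -> sigma_algebra [set: T] (F t) ;
  filtration_measurable : forall t : R, 0 <= t -> F t `<=` measurable ;
  filtration_nondecreasing :
    forall s t : R, 0 <= s -> s <= t -> F s `<=` F t ;
  filtration_right_continuous :
    forall s : R, 0 <= s -> \bigcap_(t in `]s, +oo[) F t `<=` F s ;
  filtration_null_sets : P.-negligible `<=` F 0 }.

Variable N : nat.
Implicit Types X B beta : R -> T -> 'rV[R]_N.

Definition filtration_measurable_fun (t : R) (Y : T -> 'rV[R]_N) : Prop :=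
  forall i, measurable_fun [set: g_sigma_algebraType (F t)]
    (fun w : g_sigma_algebraType (F t) => Y w 0 i).

Definition adapted X : Prop :=
  forall t : R, 0 <= t -> filtration_measurable_fun t (X t).

Definition progressively_measurable beta : Prop :=
  forall (t : R) i, 0 <= t ->
    measurable_fun (`[0, t] `*` [set: g_sigma_algebraType (F t)])
      (fun sw : R * g_sigma_algebraType (F t) => beta sw.1 sw.2 0 i).

Definition increment_event B (s t : R) (C : 'I_N -> set R) : set T :=
  [set w | forall i, C i (B t w 0 i - B s w 0 i)].

(* N-dimensional standard F-Brownian motion.  The boxes \prod_i C i form a
   pi-system generating the Borel sets of R^N, so the last two fields say that
   B t - B s is N(0, (t - s) I_N)-distributed and independent of F s.  The
   second parameter of normal_prob is the standard deviation. *)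
Record brownian_motion B : Prop := BrownianMotion {
  brownian_adapted : adapted B ;
  brownian_continuous : forall w, continuous_path (B ^~ w) ;
  brownian_start : {ae P, forall w, B 0 w = 0} ;
  brownian_increment_law : forall (s t : R) (C : 'I_N -> set R),
    0 <= s -> s < t -> (forall i, measurable (C i)) ->
    P (increment_event B s t C) =
      (\prod_i normal_prob 0%R (Num.sqrt (t - s)%R) (C i))%E ;
  brownian_increment_indep : forall (s t : R) A (C : 'I_N -> set R),
    0 <= s -> s < t -> F s A -> (forall i, measurable (C i)) ->
    P (A `&` increment_event B s t C) =
      (P A * P (increment_event B s t C))%E }.

Definition indistinguishable X Y : Prop :=
  {ae P, forall w, forall t : R, 0 <= t -> X t w = Y t w}.

End stochastic_basis.

Section solutions.
Variables (R : realType) (N : nat) (b m sigma : 'rV[R]_N).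

Section on_a_basis.
Variables (d : measure_display) (T : measurableType d).
Variables (P : probability T R) (F : R -> set_system T).
Implicit Types (X L B : R -> T -> 'rV[R]_N).

Definition reflected_paths X L : Prop :=
  (forall w, nonneg_continuous_path (X ^~ w)) /\
  (forall w i, C0up (fun t => L t w 0 i)).

(* Strong solutions on a given basis, with given Brownian motion B and initial
   value X0; as in the case of weak solutions, the system holds a.s. *)
Definition strong_solution_SDE (X0 : T -> 'rV[R]_N) B X : Prop :=
  [/\ adapted F X, (forall w, continuous_path (X ^~ w)) &
      {ae P, forall w, SDE b m sigma (X0 w) (B ^~ w) (X ^~ w)}].

Definition strong_solution_SDER (X0 : T -> 'rV[R]_N) B X L : Prop :=
  [/\ adapted F X, adapted F L, reflected_paths X L &
      {ae P, forall w, SDER b m sigma (X0 w) (B ^~ w) (X ^~ w) (L ^~ w)}].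

Definition strong_solution_SDI (X0 : T -> 'rV[R]_N) B X : Prop :=
  [/\ adapted F X, (forall w, continuous_path (X ^~ w)) &
      exists2 beta : R -> T -> 'rV[R]_N, progressively_measurable F beta &
        {ae P, forall w,
          SDI b m sigma (X0 w) (B ^~ w) (beta ^~ w) (X ^~ w)}].

Definition strong_solution_SDIR (X0 : T -> 'rV[R]_N) B X L : Prop :=
  [/\ adapted F X, adapted F L, reflected_paths X L &
      exists2 beta : R -> T -> 'rV[R]_N, progressively_measurable F beta &
        {ae P, forall w,
          SDIR b m sigma (X0 w) (B ^~ w) (beta ^~ w) (X ^~ w) (L ^~ w)}].

(* Weak solutions: the basis and the Brownian motion are part of the solution,
   and the initial value X_0 is the value of X at time 0. *)
Definition weak_setting X B : Prop :=
  [/\ usual_basis P F, brownian_motion P F B &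
      filtration_measurable_fun F 0 (X 0)].

Definition weak_solution_SDE X B : Prop :=
  weak_setting X B /\ strong_solution_SDE (X 0) B X.

Definition weak_solution_SDER X L B : Prop :=
  weak_setting X B /\ strong_solution_SDER (X 0) B X L.

Definition weak_solution_SDI X B : Prop :=
  weak_setting X B /\ strong_solution_SDI (X 0) B X.

Definition weak_solution_SDIR X L B : Prop :=
  weak_setting X B /\ strong_solution_SDIR (X 0) B X L.

End on_a_basis.

Section without_reflection.
Variable weak_solution : forall (d : measure_display) (T : measurableType d),
  probability T R -> (R -> set_system T) ->
  (R -> T -> 'rV[R]_N) -> (R -> T -> 'rV[R]_N) -> Prop.
Variable strong_solution : forall (d : measure_display) (T : measurableType d),
  probability T R -> (R -> set_system T) ->
  (T -> 'rV[R]_N) -> (R -> T -> 'rV[R]_N) -> (R -> T -> 'rV[R]_N) -> Prop.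

Definition pathwise_uniqueness : Prop :=
  forall (d : measure_display) (T : measurableType d) (P : probability T R)
    (F : R -> set_system T) (X X' B : R -> T -> 'rV[R]_N),
    weak_solution P F X B -> weak_solution P F X' B ->
    {ae P, forall w, X 0 w = X' 0 w} ->
    indistinguishable P X X'.

Definition strong_existence : Prop :=
  forall (d : measure_display) (T : measurableType d) (P : probability T R)
    (F : R -> set_system T) (B : R -> T -> 'rV[R]_N) (X0 : T -> 'rV[R]_N),
    usual_basis P F -> brownian_motion P F B ->
    filtration_measurable_fun F 0 X0 ->
    exists X : R -> T -> 'rV[R]_N, strong_solution P F X0 B X.

End without_reflection.

Section with_reflection.
Variable weak_solution : forall (d : measure_display) (T : measurableType d),
  probability T R -> (R -> set_system T) ->
  (R -> T -> 'rV[R]_N) -> (R -> T -> 'rV[R]_N) -> (R -> T -> 'rV[R]_N) ->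
  Prop.
Variable strong_solution : forall (d : measure_display) (T : measurableType d),
  probability T R -> (R -> set_system T) ->
  (T -> 'rV[R]_N) -> (R -> T -> 'rV[R]_N) -> (R -> T -> 'rV[R]_N) ->
  (R -> T -> 'rV[R]_N) -> Prop.

Definition pathwise_uniqueness_reflected : Prop :=
  forall (d : measure_display) (T : measurableType d) (P : probability T R)
    (F : R -> set_system T) (X L X' L' B : R -> T -> 'rV[R]_N),
    weak_solution P F X L B -> weak_solution P F X' L' B ->
    {ae P, forall w, X 0 w = X' 0 w} ->
    indistinguishable P X X' /\ indistinguishable P L L'.

Definition strong_existence_reflected : Prop :=
  forall (d : measure_display) (T : measurableType d) (P : probability T R)
    (F : R -> set_system T) (B : R -> T -> 'rV[R]_N) (X0 : T -> 'rV[R]_N),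
    usual_basis P F -> brownian_motion P F B ->
    filtration_measurable_fun F 0 X0 ->
    (forall w i, 0 <= X0 w 0 i) ->
    exists X L : R -> T -> 'rV[R]_N, strong_solution P F X0 B X L.

End with_reflection.

End solutions.

(* Main.v *)
Require Import Defs.
From HB Require Import structures.
From mathcomp Require Import all_boot all_order all_algebra all_fingroup.
From mathcomp Require Import all_classical all_reals all_analysis.
From mathcomp Require Import measurable_realfun lra ring.

(** Why the theorem holds.

    The drifts are monotone.  By the rearrangement inequality, when b is
    nonincreasing the permutations p compatible with the order of the
    coordinates of x are minimisers of \sum_i b (p i) * x i.  Applied at two
    points, this gives \sum_i (beta i - beta' i) * (x i - x' i) <= 0 for beta
    in the drift set at x and beta' in the drift set at x'
    ([drift_set_monotone]).  The reflection terms are dissipative too: while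
    x i > x' i >= 0 the term l i is constant whereas l' i can only grow
    ([repelling_flat]).  So the squared distance of two solutions driven by the
    same path does not increase.  [stability] is the quantitative form, in
    which the drifts may be evaluated at points within eta of the solutions;
    eta = 0 gives uniqueness of X for the inclusions, path by path
    ([inclusion_path_unique]).

    Everything else needs to know that ties between coordinates occupy a
    Lebesgue null set of times, for then the drift set is almost everywhere the
    single vector given by the ranks ([drift_set_no_ties]).  A difference
    x i - x j is a combination of two independent Brownian motions plus a
    difference of nondecreasing functions, since the drifts are bounded and the
    reflection terms monotone.  Over a short time h the Brownian part moves by
    about the square root of h, hence by more than a = h ^ (3/4) from most
    times ([brownian_rough]), whereas a nondecreasing function moves by more
    than a only from a set of times of measure O(h / a)
    ([monotone_increment_cover]).  If the times of a tie had positive measure,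
    most of them would be followed after a delay h by another one, and at such
    times both parts move by the same amount: [rough_zero_set].  This settles
    the uniqueness of L, as X and the integrated drift determine it.

    Solutions of the equations are limits of a delay scheme: the drift at time
    s is read off the ranks at time s - h, so that the scheme is solved
    explicitly, one interval of length h after the other, the constraint being
    enforced by the Skorokhod map.  By [stability] the schemes form, for every
    driving path, a Cauchy sequence for locally uniform convergence as h tends
    to 0, and adaptedness passes to the limit.  The limit has almost no ties
    either, so the delayed ranks converge to its ranks at almost every time
    ([rank_ord_cvg]), and dominated convergence identifies the drift
    ([delayed_drift_cvg]).  The cases with and without reflection are treated
    together, by means of a boolean refl.

    Finally a solution of an equation solves the corresponding inclusion,
    because the vector of drifts given by the ranks lies in the drift set.
    Uniqueness for the inclusions and existence for the equations therefore
    give all the assertions. *)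

Set Implicit Arguments.
Unset Strict Implicit.
Unset Printing Implicit Defensive.

Import Order.TTheory GRing.Theory Num.Theory.
Import numFieldNormedType.Exports.

Local Open Scope ring_scope.

(** * Drifts compatible with the order of the coordinates *)

Section drift_set.
Context {R : realType} {N : nat}.
Local Open Scope classical_set_scope.
Implicit Types (b x y beta : 'rV[R]_N) (p q r s : 'S_N).

(** Induction on the number m of final positions which s may still move: a
    transposition puts the first of them in its place, and this can only
    decrease the right-hand side. *)
Lemma rearrangement (f y : 'I_N -> R) :
  (forall i j : 'I_N, (i <= j)%N -> f j <= f i) ->
  (forall i j : 'I_N, (i <= j)%N -> y i <= y j) ->
  forall s, \sum_k f k * y k <= \sum_k f (s k) * y k.
Proof.
move=> fd yi s.
suff H m : forall s, (forall k : 'I_N, (k < N - m)%N -> s k = k) ->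
    \sum_k f k * y k <= \sum_k f (s k) * y k.
  by apply: (H N) => k; rewrite subnn.
elim: m => [|m IH] {}s sfix.
  by apply: ler_sum => k _; rewrite sfix ?subn0.
have [mN|Nm] := ltnP m N; last first.
  by apply: IH => k kNm; apply: sfix; move: kNm; rewrite (eqP Nm).
have k0P : (N - m.+1 < N)%N by rewrite ltn_subrL /= (leq_ltn_trans _ mN).
pose k0 := Ordinal k0P.
pose j := (s^-1)%g k0.
have sj : s j = k0 by rewrite permKV.
have jk0 : (k0 <= j)%N.
  rewrite leqNgt; apply/negP => jk0.
  by have := sfix _ jk0; rewrite sj => E; move: jk0; rewrite -E ltnn.
have sk0 : (k0 <= s k0)%N.
  rewrite leqNgt; apply/negP => h.
  by have /perm_inj E := sfix _ h; move: h; rewrite E ltnn.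
(* exchanging the values of s at k0 and at j makes s fix k0 *)
apply: (@le_trans _ _ (\sum_k f ((tperm k0 j * s)%g k) * y k)).
  apply: IH => k kNm; rewrite permM.
  have [->|kk0] := eqVneq k k0; first by rewrite tpermL.
  have kl : (k < N - m.+1)%N.
    rewrite ltn_neqAle; apply/andP; split; last first.
      by rewrite -ltnS -subSn // subSS.
    by apply: contra kk0 => /eqP kE; apply/eqP/val_inj.
  have kj : j != k.
    by apply/eqP => jk; move: (sfix _ kl) kk0; rewrite -jk sj => ->; rewrite eqxx.
  rewrite (tpermD _ kj); first exact: sfix.
  by rewrite eq_sym.
have [jE|jE] := eqVneq j k0.
  by rewrite jE tperm1 mul1g.
rewrite (bigD1 k0)//= (bigD1 j)//= [leRHS](bigD1 k0)//= [in leRHS](bigD1 j)//=.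
rewrite !permM tpermL tpermR sj !addrA.
rewrite [X in _ + X <= _](_ : _ =
  \sum_(i < N | (i != k0) && (i != j)) f (s i) * y i); last first.
  by apply: eq_bigr => i /andP[ik ij]; rewrite permM tpermD// eq_sym.
rewrite lerD2r.
have := fd _ _ sk0; have := yi _ _ jk0; nra.
Qed.

(** Relabelling the coordinates by the inverse of p sorts x, which reduces
    the claim to [rearrangement]. *)
Lemma rank_perms_min b x p r :
  (forall i j : 'I_N, (i <= j)%N -> b 0 j <= b 0 i) -> rank_perms x p ->
  \sum_i b 0 (p i) * x 0 i <= \sum_i b 0 (r i) * x 0 i.
Proof.
move=> bd px.
rewrite (reindex_inj (@perm_inj _ p^-1)%g) /=.
rewrite [leRHS](reindex_inj (@perm_inj _ p^-1)%g) /=.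
under eq_bigr do rewrite permKV.
have := @rearrangement (fun i => b 0 i) (fun k => x 0 ((p^-1)%g k)) bd.
move=> /(_ _ (p^-1 * r)%g) H.
under [leRHS]eq_bigr do rewrite -permM.
apply: H => i j ij; rewrite leNgt; apply/negP => /px; rewrite !permKV.
by rewrite ltnNge ij.
Qed.

Lemma convex_hull_sub (A C : set 'rV[R]_N) :
  (forall u v (t : R), C u -> C v -> 0 <= t <= 1 -> C (t *: u + (1 - t) *: v)) ->
  A `<=` C -> convex_hull A `<=` C.
Proof.
move=> Ccv AC; apply: smallest_sub => // u v t.
rewrite !inE => Cu Cv.
apply: (Ccv u v t%:num) => //.
by rewrite ge0 le1.
Qed.

Lemma drift_set_perm b x p : rank_perms x p -> drift_set b x (permute_coef b p).
Proof. by move=> px; apply: sub_gen_smallest; exists p. Qed.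

(** A linear functional which is at most C at the vertices is at most C on
    the convex hull. This is the only way in which convexity of the drift sets
    enters the estimates. *)
Lemma drift_set_le (C : R) (v : 'I_N -> R) b x beta :
  (forall p, rank_perms x p -> \sum_i b 0 (p i) * v i <= C) ->
  drift_set b x beta -> \sum_i beta 0 i * v i <= C.
Proof.
move=> bC; apply: (convex_hull_sub (C := [set beta | \sum_i beta 0 i * v i <= C])).
  move=> u w t /= uC wC /andP[t0 t1].
  rewrite (_ : \sum_i _ = t * \sum_i u 0 i * v i + (1 - t) * \sum_i w 0 i * v i).
    nra.
  rewrite !mulr_sumr -big_split/=; apply: eq_bigr => i _; rewrite !mxE; ring.
move=> _ [p px <-] /=; under eq_bigr do rewrite mxE; exact: bC.
Qed.

Definition coef_bound b : R := \sum_i `|b 0 i|.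

Lemma coef_bound_ge0 b : 0 <= coef_bound b.
Proof. exact: sumr_ge0. Qed.

Lemma coef_le_bound b i : `|b 0 i| <= coef_bound b.
Proof. by rewrite /coef_bound (bigD1 i)//= lerDl sumr_ge0. Qed.

(** Test [drift_set_le] with the i-th basis vector and its opposite. *)
Lemma drift_set_bound b x beta i : drift_set b x beta ->
  `|beta 0 i| <= coef_bound b.
Proof.
have sumE (c : R) (f : 'I_N -> R) : \sum_j f j * (c * (j == i)%:R) = c * f i.
  rewrite (bigD1 i)//= eqxx mulr1 mulrC big1 ?addr0// => j /negPf ->.
  by rewrite !mulr0.
move=> bx; rewrite ler_norml; apply/andP; split.
  rewrite lerNl.
  have := @drift_set_le (coef_bound b) (fun j => -1 * (j == i)%:R) b x beta.
  rewrite sumE mulN1r; apply => // p _; rewrite (sumE (-1) (fun j => b 0 (p j))).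
  by rewrite mulN1r (le_trans (ler_norm _))// normrN coef_le_bound.
have := @drift_set_le (coef_bound b) (fun j => 1 * (j == i)%:R) b x beta.
rewrite sumE mul1r; apply => // p _; rewrite (sumE 1 (fun j => b 0 (p j))).
by rewrite mul1r (le_trans _ (coef_le_bound b (p i)))// ler_norm.
Qed.

(** By [rank_perms_min], every drift at x has a smaller pairing with x than
    any vector of the hull of all the permuted b, in particular than any drift
    at the other point. Add the two inequalities obtained by exchanging the
    roles of the points. *)
Lemma drift_set_monotone b x x' beta beta' :
  (forall i j : 'I_N, (i <= j)%N -> b 0 j <= b 0 i) ->
  drift_set b x beta -> drift_set b x' beta' ->
  \sum_i (beta 0 i - beta' 0 i) * (x 0 i - x' 0 i) <= 0.
Proof.
move=> bd.
have key y y' g g' : drift_set b y g -> drift_set b y' g' ->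
    \sum_i g 0 i * y 0 i <= \sum_i g' 0 i * y 0 i.
  move=> gy gy'; apply: drift_set_le gy => p py.
  rewrite -lerN2 -!sumrN; under eq_bigr do rewrite -mulrN.
  apply: drift_set_le gy' => q qy.
  under eq_bigr do rewrite mulrN; rewrite !sumrN lerN2.
  exact: rank_perms_min.
move=> bx bx'; have h1 := key _ _ _ _ bx bx'; have h2 := key _ _ _ _ bx' bx.
rewrite (_ : \sum_i _ = (\sum_i beta 0 i * x 0 i - \sum_i beta' 0 i * x 0 i) +
  (\sum_i beta' 0 i * x' 0 i - \sum_i beta 0 i * x' 0 i)); first lra.
by rewrite -!sumrB -big_split/=; apply: eq_bigr => i _; ring.
Qed.

(** The rank of i counts the indices which do not exceed i in the total order
    comparing first the values of x and then the indices. *)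
Lemma rank_ltn x (i j : 'I_N) : x 0 i < x 0 j \/ (x 0 i = x 0 j /\ (i < j)%N) ->
  (rank i x < rank j x)%N.
Proof.
pose le (i j : 'I_N) := (x 0 i < x 0 j) || ((i <= j)%N && (x 0 i == x 0 j)).
have rankE k : rank k x = #|[pred l | le l k]|.
  rewrite /rank -cardUI [X in (_ + X)%N]eq_card0 ?addn0; last first.
    by move=> l; rewrite !inE; case: ltgtP => //; rewrite ?andbF.
  by apply: eq_card => l; rewrite !inE.
rewrite !rankE => ij; apply: proper_card; apply/properP; split.
  apply/fintype.subsetP => k; rewrite !inE /le => /orP[ki|/andP[ki /eqP xki]].
    by case: ij => [ij|[xij ij]]; rewrite ?(lt_trans ki ij)// -xij ki.
  case: ij => [ij|[xij ij]]; first by rewrite xki ij.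
  by rewrite xki xij eqxx (leq_trans ki (ltnW ij)) orbT.
exists j; rewrite !inE /le ?leqnn ?eqxx ?orbT//.
case: ij => [ij|[-> ij]]; first by rewrite negb_or -leNgt (ltW ij) gt_eqF// andbF.
by rewrite ltxx eqxx leqNgt ij.
Qed.

Lemma rank_ord_inj x : injective (fun i => rank_ord i x).
Proof.
move=> i j ij; have {}ij : rank i x = rank j x.
  case: ij => e; have /andP[i0 _] := rank_bounds i x.
  by have /andP[j0 _] := rank_bounds j x; rewrite -(prednK i0) -(prednK j0) e.
apply/eqP; apply: contraT => nij.
have [xij|xij|xij] := ltgtP (x 0 i) (x 0 j).
- by have := @rank_ltn x i j (or_introl xij); rewrite ij ltnn.
- by have := @rank_ltn x j i (or_introl xij); rewrite ij ltnn.
have [h|h] := ltnP i j.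
  by have := @rank_ltn x i j (or_intror (conj xij h)); rewrite ij ltnn.
have {}h : (j < i)%N by rewrite ltn_neqAle h andbT; apply: contra nij => /eqP/val_inj ->.
by have := @rank_ltn x j i (or_intror (conj (esym xij) h)); rewrite ij ltnn.
Qed.

Definition rank_perm x : 'S_N := perm (@rank_ord_inj x).

Lemma rank_permP x : rank_perms x (rank_perm x).
Proof.
move=> i j xij; rewrite !permE /=; have := @rank_ltn x i j (or_introl xij).
have /andP[i0 _] := rank_bounds i x; have /andP[j0 _] := rank_bounds j x.
by rewrite -{1}(prednK i0) -{1}(prednK j0) ltnS.
Qed.

Definition rank_drift b x : 'rV[R]_N := \row_i b 0 (rank_ord i x).

Lemma rank_drift_set b x : drift_set b x (rank_drift b x).
Proof.
have := @drift_set_perm b _ _ (@rank_permP x); congr (drift_set b x _).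
by apply/rowP => i; rewrite !mxE permE.
Qed.

Definition no_ties x := forall i j : 'I_N, i != j -> x 0 i != x 0 j.

(** Without ties p i must be the number of coordinates strictly below x i,
    whichever compatible p is chosen. *)
Lemma rank_perms_no_ties x p : no_ties x -> rank_perms x p ->
  p = rank_perm x.
Proof.
move=> nt px.
have pk : forall q, rank_perms x q -> forall i, nat_of_ord (q i) = #|[pred j | x 0 j < x 0 i]|.
  move=> q qx i.
  have qlt j : (x 0 j < x 0 i) = (q j < q i)%N.
    have [->|ji] := eqVneq j i; first by rewrite ltxx ltnn.
    have := nt _ _ ji; case: ltgtP => // xji _; first by rewrite (qx _ _ xji).
    by rewrite ltnNge (ltnW (qx _ _ xji)).
  rewrite (eq_card (B := [pred j | (q j < q i)%N])); last by move=> j; rewrite !inE qlt.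
  rewrite -sum1_card (reindex_inj (@perm_inj _ q^-1)%g) /=.
  under eq_bigl do rewrite inE permKV.
  rewrite (big_ord_narrow (F := fun=> 1%N) (ltnW (ltn_ord (q i)))).
  by rewrite sum1_card card_ord.
apply/permP => i; apply/val_inj => /=.
by rewrite (pk _ px) (pk _ (@rank_permP x)).
Qed.

Lemma drift_set_no_ties b x beta : no_ties x -> drift_set b x beta ->
  beta = rank_drift b x.
Proof.
move=> nt; apply: (convex_hull_sub (C := [set rank_drift b x])).
  by move=> u v t /= -> -> _; rewrite -scalerDl addrC subrK scale1r.
move=> _ [p /(rank_perms_no_ties nt) -> <-] /=.
by apply/rowP => i; rewrite !mxE permE.
Qed.

End drift_set.

(** * Continuous paths and integrals of bounded drifts *)

Section almost_everywhere.
Context {d : measure_display} {T : measurableType d} {R : realType}.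
Variable mu : {measure set T -> \bar R}.
Implicit Types P Q S : T -> Prop.

Lemma ae_imply P Q : (forall x, P x -> Q x) ->
  {ae mu, forall x, P x} -> {ae mu, forall x, Q x}.
Proof. by move=> PQ; exact: (@filterS _ _ (ae_filter_ringOfSetsType mu)). Qed.

Lemma ae_imply2 P Q S : (forall x, P x -> Q x -> S x) ->
  {ae mu, forall x, P x} -> {ae mu, forall x, Q x} -> {ae mu, forall x, S x}.
Proof. by move=> PQ; exact: (@filterS2 _ _ (ae_filter_ringOfSetsType mu)). Qed.

End almost_everywhere.

Section path_calculus.
Context {R : realType}.
Local Open Scope classical_set_scope.
Local Notation leb := (@lebesgue_measure R).
Implicit Types (f g : R -> R) (s t T : R).

Lemma within_continuous_comp (U : topologicalType) (f : R -> U) (g : R -> R)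
    (A : set R) :
  {within A, continuous f} -> continuous g -> (forall t, A (g t)) ->
  continuous (f \o g).
Proof.
move=> cf cg gA t; have := cf (g t); rewrite /continuous_at.
have [_|//] := nbhs_subspaceP A (g t) => fgt V /fgt/= AV.
have {}AV : nbhs t (fun u => A (g u) -> V (f (g u))) := cg t _ AV.
by apply: (@filterS _ (nbhs t)) AV => u; apply; exact: gA.
Qed.

Lemma maxr0_ge0 t : 0 <= Num.max 0 t.
Proof. by rewrite le_max lexx. Qed.

Lemma maxr0_id t : 0 <= t -> Num.max 0 t = t.
Proof. by move=> t0; apply/max_idPr. Qed.

Lemma continuous_maxr0 : continuous (Num.max 0 : R -> R).
Proof.
move=> t; rewrite /continuous_at; apply: (@continuous_max _ _ (cst 0) id t) => //.
exact: cvg_cst.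
Qed.

(** Freezing a path at its initial value for negative times turns continuity
    on the half-line into continuity on the whole line, for which limits and
    extreme values are easier to handle. *)
Lemma continuous_pathP (U : topologicalType) (f : R -> U) :
  {within `[0, +oo[, continuous f} <-> continuous (fun t => f (Num.max 0 t)).
Proof.
split=> cf.
  apply: (within_continuous_comp cf) continuous_maxr0 _ => t /=.
  by rewrite in_itv/= andbT maxr0_ge0.
apply: (@subspace_eq_continuous _ _ _ (fun t => f (Num.max 0 t))).
  by move=> t; rewrite inE/= in_itv/= andbT => t0; rewrite maxr0_id.
exact: continuous_subspaceT.
Qed.

(** A mean value inequality which asks for a good increment only from some
    earlier time s up to c. If it failed, f minus a line slightly steeper than C
    would attain its maximum over [0, T] at some c > 0, and the increment ending
    at c would contradict maximality. *)
Lemma growth_le f T (C : R) : 0 <= T -> continuous f ->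
  (forall c e, 0 < c -> c <= T -> 0 < e ->
     exists s, [/\ 0 <= s, s < c & f c - f s <= (C + e) * (c - s)]) ->
  f T <= f 0 + C * T.
Proof.
move=> T0 cf H; rewrite leNgt; apply/negP => fT.
have T_gt0 : 0 < T.
  by rewrite lt_neqAle T0 andbT; apply: contraTneq fT => <-; rewrite mulr0 addr0 ltxx.
(* a quarter of the excess slope: tilting by C + 2 * e leaves g T > g 0 *)
pose e := (f T - f 0 - C * T) / (4 * T).
have e0 : 0 < e by rewrite /e divr_gt0 ?mulr_gt0//; lra.
have eT : e * (4 * T) = f T - f 0 - C * T.
  by rewrite /e -mulrA mulVf ?mulr1// mulf_neq0 ?gt_eqF.
pose g t := f t - (C + 2 * e) * t.
have cg : continuous g.
  move=> t; apply: cvgB; first exact: cf.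
  by apply: cvgM; [exact: cvg_cst|exact: cvg_id].
have [c c0T gmax] := @EVT_max R g 0 T T0 (continuous_subspaceT cg).
move: c0T; rewrite in_itv/= => /andP[c0 cT].
have gT : g T <= g c by apply: gmax; rewrite in_itv/= T0 lexx.
have c_gt0 : 0 < c.
  rewrite lt_neqAle c0 andbT; apply/negP => /eqP c0E.
  by move: gT; rewrite -c0E /g; nra.
have [s [s0 sc]] := H c e c_gt0 cT e0.
have : g s <= g c.
  by apply: gmax; rewrite in_itv/= s0 (le_trans (ltW sc) cT).
rewrite /g; nra.
Qed.

Section integrals.
Variable D : set (measurableTypeR R).
Hypothesis mD : measurable D.
Hypothesis finD : (leb D < +oo)%E.

Lemma integrable_ae_bounded f (M : R) : measurable_fun D f ->
  {ae leb, forall u, D u -> `|f u| <= M} -> leb.-integrable D (EFin \o f).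
Proof.
move=> mf fM; apply/integrableP; split; first exact/measurable_EFinP.
rewrite (@ge0_ae_eq_integral _ _ _ leb D _ (fun u => (Num.min `|f u| `|M|)%:E))//.
- apply: (@le_lt_trans _ _ (\int[leb]_(u in D) (`|M|)%:E)%E).
    apply: ge0_le_integral => //.
    + apply/measurable_EFinP; apply: measurable_minr => //.
      exact: measurableT_comp.
    + by move=> u _; rewrite lee_fin ge_min lexx orbT.
  by rewrite integral_cst// lte_mul_pinfty ?lee_fin.
- by apply: measurableT_comp => //; exact/measurable_EFinP.
- apply/measurable_EFinP; apply: measurable_minr => //.
  exact: measurableT_comp.
- apply: ae_imply fM => u fM /fM fuM; congr EFin.
  by apply/esym/min_idPl; rewrite (le_trans fuM)// ler_norm.
Qed.

Lemma Rintegral_ae_eq f g : measurable_fun D f -> measurable_fun D g ->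
  {ae leb, forall u, D u -> f u = g u} ->
  \int[leb]_(u in D) f u = \int[leb]_(u in D) g u.
Proof.
move=> mf mg fg; rewrite /Rintegral; congr fine; apply: ae_eq_integral => //.
- exact/measurable_EFinP.
- exact/measurable_EFinP.
- by apply: ae_imply fg => u fg /fg ->.
Qed.

Lemma Rintegral_ae_le f (M : R) : leb.-integrable D (EFin \o f) ->
  {ae leb, forall u, D u -> f u <= M} ->
  \int[leb]_(u in D) f u <= M * fine (leb D).
Proof.
move=> intf fM.
have mf : measurable_fun D f by apply/measurable_EFinP; case/integrableP: intf.
have intM : leb.-integrable D (EFin \o cst M).
  by apply: (@integrable_ae_bounded _ `|M|) => //; apply: aeW => u _ /=.
rewrite -subr_ge0 -(Rintegral_cst leb mD) -RintegralB//.
rewrite (@Rintegral_ae_eq _ (fun u => Num.max 0 (M - f u))).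
- by apply: Rintegral_ge0 => u _; exact: maxr0_ge0.
- exact: measurable_funB.
- by apply: measurable_maxr => //; exact: measurable_funB.
- by apply: ae_imply fM => u fM /fM fuM; rewrite maxr0_id// subr_ge0.
Qed.

Lemma Rintegral_lincomb (I : finType) (a : I -> R) (f : I -> R -> R) :
  (forall i, leb.-integrable D (EFin \o f i)) ->
  leb.-integrable D (EFin \o (fun u => \sum_i a i * f i u)) /\
  \sum_i a i * \int[leb]_(u in D) f i u = \int[leb]_(u in D) (\sum_i a i * f i u).
Proof.
move=> intf; elim: (index_enum I) => [|i r [IH1 IH2]].
  split; last first.
    rewrite big_nil (_ : (fun u => _) = cst 0) ?Rintegral_cst ?mul0r//.
    by apply/funext => u; rewrite big_nil.
  apply: (@integrable_ae_bounded _ 0).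
    by rewrite (_ : (fun u => _) = cst 0)//; apply/funext => u; rewrite big_nil.
  by apply: aeW => u _; rewrite big_nil normr0.
have ifi : leb.-integrable D (EFin \o (fun u => a i * f i u)).
  have := integrableZl mD (a i) (intf i).
  by apply: eq_integrable => // u _; rewrite /= EFinM.
split.
  have := integrableD mD ifi IH1.
  by apply: eq_integrable => // u _; rewrite /= big_cons EFinD.
rewrite big_cons IH2 -RintegralZl// -RintegralD//.
by apply: eq_Rintegral => u _; rewrite big_cons.
Qed.

End integrals.

Lemma leb_itv_oc_lty s t : (leb `]s, t] < +oo)%E.
Proof. by rewrite lebesgue_measure_itv/=; case: ifP => // _; exact: ltry. Qed.

Lemma leb_itv_cc_lty s t : (leb `[s, t] < +oo)%E.
Proof. by rewrite lebesgue_measure_itv/=; case: ifP => // _; exact: ltry. Qed.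

Lemma Rintegral_increment f s t T : 0 <= s -> s <= t -> t <= T ->
  leb.-integrable `[0, T] (EFin \o f) ->
  \int[leb]_(u in `[0, t]) f u - \int[leb]_(u in `[0, s]) f u =
  \int[leb]_(u in `]s, t]) f u.
Proof.
move=> s0 st tT intf; apply: Rintegral_itvB; rewrite ?bnd_simp//.
apply: integrableS intf => //.
by move=> u /=; rewrite !in_itv/= => /andP[-> ut]; exact: le_trans ut tT.
Qed.

End path_calculus.

Section path_coordinates.
Context {R : realType} {N : nat}.
Local Open Scope classical_set_scope.

Lemma continuous_path_coord (x : R -> 'rV[R]_N) i :
  continuous_path x -> continuous (fun t : R => x (Num.max 0 t) 0 i).
Proof.
move=> /continuous_pathP cx t.
apply: (@cvg_comp _ _ _ (fun t : R => x (Num.max 0 t)) (fun M : 'rV[R]_N => M 0 i)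
  _ _ _ (cx t)).
exact: coord_continuous.
Qed.

Lemma continuous_pathW (x : R -> 'rV[R]_N) :
  (forall i, continuous (fun t : R => x (Num.max 0 t) 0 i)) -> continuous_path x.
Proof.
move=> cx; apply/continuous_pathP => t; apply/cvg_ballP => e e0.
have H i : \forall s \near t, ball (x (Num.max 0 t) 0 i) e (x (Num.max 0 s) 0 i).
  by have /cvg_ballP := cx i t; apply.
have {}H := @filter_forall _ _ (fun i s => ball (x (Num.max 0 t) 0 i) e
  (x (Num.max 0 s) 0 i)) (nbhs t) (nbhs_filter t) H.
change (nbhs t (fun s : R => ball (x (Num.max 0 t)) e (x (Num.max 0 s)))).
apply: (@filterS _ (nbhs t) _ _ _ _ H) => s Hs; split=> // i j; rewrite ord1; exact: Hs.
Qed.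

End path_coordinates.

(** * Stability of monotone drifts *)

Section stability.
Context {R : realType} {N : nat}.
Local Open Scope classical_set_scope.
Local Notation leb := (@lebesgue_measure R).
Implicit Types (b : 'rV[R]_N) (x y l beta : R -> 'rV[R]_N) (T : R).

(** The point y at which the drift set is taken need not be the solution
    itself: for the delay scheme it is the solution at an earlier time. *)
Definition drift_selection b y beta T : Prop :=
  (forall i, measurable_fun `[0, T] (fun u => beta u 0 i)) /\
  {ae leb, forall u, `[0, T] u -> drift_set b (y u) (beta u)}.

Lemma drift_selection_bound b y beta T i : drift_selection b y beta T ->
  {ae leb, forall u, `[0, T] u -> `|beta u 0 i| <= coef_bound b}.
Proof. by move=> [_]; apply: ae_imply => u /[apply]; exact: drift_set_bound. Qed.

Lemma drift_selection_integrable b y beta T i : drift_selection b y beta T ->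
  leb.-integrable `[0, T] (EFin \o (fun u => beta u 0 i)).
Proof.
move=> sel; have [mb _] := sel.
apply: (integrable_ae_bounded _ (leb_itv_cc_lty _ _) (mb i)
  (drift_selection_bound i sel)).
exact: measurable_itv.
Qed.

(** One half of the statement that the reflection terms never push two
    solutions apart. *)
Definition repelling T x x' l l' : Prop :=
  forall i s t, 0 <= s -> s <= t -> t <= T ->
    (forall u, s <= u <= t -> x' u 0 i < x u 0 i) ->
    l t 0 i - l s 0 i <= l' t 0 i - l' s 0 i.

(** The squared distance f of x and x' satisfies the hypothesis of [growth_le].
    Going back from c by a short step, the coordinates which differ at c keep
    their sign, so that there the reflection terms only help, while the
    coordinates which agree at c contribute a nonpositive increment of f. What
    is left is the pairing of x - x' with the difference of the drifts, which
    would be nonpositive by [drift_set_monotone] if x - x' were replaced by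
    y - y'; this replacement costs the error term in eta. *)
Lemma stability b T (eta : R) x x' y y' beta beta' l l' :
  (forall i j : 'I_N, (i <= j)%N -> b 0 j <= b 0 i) ->
  0 <= T -> 0 <= eta ->
  (forall i, continuous (fun t => x t 0 i - x' t 0 i)) ->
  (forall t i, 0 <= t <= T -> x t 0 i - x' t 0 i =
     \int[leb]_(u in `[0, t]) beta u 0 i - \int[leb]_(u in `[0, t]) beta' u 0 i
     + (l t 0 i - l' t 0 i)) ->
  (forall i, l 0 0 i = l' 0 0 i) ->
  drift_selection b y beta T -> drift_selection b y' beta' T ->
  (forall t i, 0 <= t <= T -> `|x t 0 i - y t 0 i| <= eta) ->
  (forall t i, 0 <= t <= T -> `|x' t 0 i - y' t 0 i| <= eta) ->
  repelling T x x' l l' -> repelling T x' x l' l ->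
  \sum_i (x T 0 i - x' T 0 i) ^+ 2 <= 8 * N%:R * coef_bound b * eta * T.
Proof.
move=> bd T0 eta0 cz zE l0 sel sel' xy xy' rep rep'.
set K := coef_bound b; have K0 : 0 <= K := coef_bound_ge0 b.
pose z t i := x t 0 i - x' t 0 i.
pose f t := \sum_i z t i ^+ 2.
have z0 i : z 0 i = 0.
  rewrite /z zE ?lexx// l0 subrr addr0 /Rintegral.
  by rewrite set_itv1 !integral_set1 subrr.
have f0 : f 0 = 0 by rewrite /f big1// => i _; rewrite z0 expr0n.
suff : f T <= f 0 + 8 * N%:R * K * eta * T by rewrite f0 add0r.
apply: growth_le => //.
  move=> t; rewrite /continuous_at /f; apply: cvg_big => [|i _].
    exact: add_continuous.
  by apply: cvgM; exact: cz.
move=> c e c0 cT e0.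
(* e' bounds the oscillation of z on the step, at a cost of 4 N K e' <= e *)
pose e' := e / (4 * N%:R * K + 1).
have den0 : 0 < 4 * N%:R * K + 1 by have := @mulr_ge0 _ _ _ (ler0n R N) K0; lra.
have e'0 : 0 < e' by rewrite divr_gt0.
have e'E : 4 * N%:R * K * e' <= e.
  rewrite /e' mulrCA ger_pMr// ler_pdivrMr//; lra.
pose V i : set R := fun u => `|z u i - z c i| <= e' /\
    (0 < z c i -> 0 < z u i) /\ (z c i < 0 -> z u i < 0).
have near_c : \forall u \near c, forall i, V i u.
  apply: (@filter_forall _ _ V (nbhs c) _) => i; have cz_i := cz i c.
  have n1 : \forall u \near c, `|z c i - z u i| <= e'.
    by move/cvgrPdist_le : cz_i; exact.
  have n2 : \forall u \near c, 0 < z c i -> 0 < z u i.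
    have [zc0|zc0] := ltP 0 (z c i); last by exact: (@nearW _ (nbhs c)).
    by apply: (@filterS _ (nbhs c) _ _ _ _ (cvgr_gt _ cz_i _ zc0)).
  have n3 : \forall u \near c, z c i < 0 -> z u i < 0.
    have [zc0|zc0] := ltP (z c i) 0; last by exact: (@nearW _ (nbhs c)).
    by apply: (@filterS _ (nbhs c) _ _ _ _ (cvgr_lt _ cz_i _ zc0)).
  by apply: (@filterS3 _ (nbhs c) _ _ _ _ _ _ n1 n2 n3) => u; rewrite /V distrC.
have [/= d d0 dP] : exists2 d : R, 0 < d & forall u, `|c - u| < d ->
    forall i, V i u.
  by have [d d0 dP] := near_c; exists d.
pose s := Num.max 0 (c - d / 2).
have s0 : 0 <= s by exact: maxr0_ge0.
have sc : s < c by rewrite gt_max c0; lra.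
have sP u : s <= u <= c -> `|c - u| < d.
  move=> /andP[su uc]; rewrite ger0_norm ?subr_ge0//.
  have : c - d / 2 <= s by rewrite le_max lexx orbT.
  lra.
exists s; split => //.
have cI u : s < u <= c -> 0 <= u <= T.
  by move=> /andP[su uc]; rewrite (le_trans s0 (ltW su)) (le_trans uc cT).
pose D : set (measurableTypeR R) := `]s, c].
have Dsub : D `<=` `[0, T].
  by move=> u /=; rewrite /D/= !in_itv/=; exact: cI.
have mD : measurable D by exact: measurable_itv.
have m0T : measurable (`[0, T] : set (measurableTypeR R)) by exact: measurable_itv.
pose gam i u := beta u 0 i - beta' u 0 i.
have ib i : leb.-integrable D (EFin \o (fun u => beta u 0 i)).
  exact: (integrableS m0T mD Dsub (drift_selection_integrable i sel)).
have ib' i : leb.-integrable D (EFin \o (fun u => beta' u 0 i)).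
  exact: (integrableS m0T mD Dsub (drift_selection_integrable i sel')).
have igam i : leb.-integrable D (EFin \o gam i).
  have := integrableB mD (ib i) (ib' i).
  by apply: eq_integrable.
have zinc i : z c i - z s i = \int[leb]_(u in D) gam i u +
    ((l c 0 i - l s 0 i) - (l' c 0 i - l' s 0 i)).
  rewrite /z !zE ?s0 ?(ltW c0) ?cT ?(le_trans (ltW sc) cT)//.
  rewrite /gam RintegralB//.
  rewrite -(Rintegral_increment s0 (ltW sc) cT (drift_selection_integrable i sel)).
  rewrite -(Rintegral_increment s0 (ltW sc) cT (drift_selection_integrable i sel')).
  ring.
(* a ^ 2 - a' ^ 2 <= 2 a (a - a'), and then a - a' may be replaced by the drift
   increment g because the rest of a - a' has the sign opposite to a *)
have sqr_step (a a' g : R) : 0 <= a * (g - (a - a')) -> a ^+ 2 - a' ^+ 2 <= 2 * a * g.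
  by have := sqr_ge0 (a - a'); nra.
have fstep : f c - f s <= \sum_i (2 * z c i) * \int[leb]_(u in D) gam i u.
  rewrite /f -sumrB; apply: ler_sum => i _.
  have [zc|zc|->] := ltgtP (z c i) 0.
  - have zu u : s <= u <= c -> x u 0 i < x' u 0 i.
      by move=> /sP/dP/(_ i)[_ [_ /(_ zc)]]; rewrite subr_lt0.
    apply: sqr_step; apply: mulr_le0; first exact: ltW.
    by rewrite zinc; have := rep' i s c s0 (ltW sc) cT zu; lra.
  - have zu u : s <= u <= c -> x' u 0 i < x u 0 i.
      by move=> /sP/dP/(_ i)[_ [/(_ zc) + _]]; rewrite subr_gt0.
    apply: sqr_step; apply: mulr_ge0; first exact: ltW.
    by rewrite zinc; have := rep i s c s0 (ltW sc) cT zu; lra.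
  - by rewrite expr0n/= mulr0 mul0r sub0r oppr_le0 sqr_ge0.
apply: (le_trans fstep).
have finD : (leb D < +oo)%E by exact: leb_itv_oc_lty.
have [isum ->] := Rintegral_lincomb mD finD (fun i => 2 * z c i) igam.
have -> : c - s = fine (leb D).
  by rewrite /D lebesgue_measure_itv/= lte_fin sc.
apply: Rintegral_ae_le => //.
case: sel => _ sel; case: sel' => _ sel'.
apply: ae_imply2 sel sel' => u su su' Du.
have uT : 0 <= u <= T by apply: cI; move: Du; rewrite /D/= in_itv.
have {}su := su (Dsub _ Du); have {}su' := su' (Dsub _ Du).
have mono := drift_set_monotone bd su su'.
apply: (@le_trans _ _ (\sum_i (2 * (gam i u * (y u 0 i - y' u 0 i)) +
     (8 * K * eta + 4 * K * e')))).
  apply: ler_sum => i _.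
  have h1 : `|gam i u| <= 2 * K.
    rewrite (le_trans (ler_normB _ _))//.
    have := drift_set_bound i su; have := drift_set_bound i su'; rewrite -/K; lra.
  have h2 : `|z c i - (y u 0 i - y' u 0 i)| <= 2 * eta + e'.
    have uc : s <= u <= c.
      by move: Du; rewrite /D/= in_itv/= => /andP[/ltW -> ->].
    have [] := dP u (sP u uc) i; rewrite distrC => h _.
    rewrite (_ : _ - _ = (z c i - z u i) +
      ((x u 0 i - y u 0 i) - (x' u 0 i - y' u 0 i))); last by rewrite /z; ring.
    rewrite (le_trans (ler_normD _ _))// addrC lerD//.
    rewrite (le_trans (ler_normB _ _))//.
    by have := xy u i uT; have := xy' u i uT; lra.
  have : gam i u * (z c i - (y u 0 i - y' u 0 i)) <= 2 * K * (2 * eta + e').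
    by rewrite (le_trans (ler_norm _))// normrM ler_pM.
  nra.
rewrite big_split/= -mulr_sumr sumr_const card_ord.
apply: (@le_trans _ _ (0 + (8 * K * eta + 4 * K * e') *+ N)).
  by rewrite lerD2r; rewrite /gam; lra.
rewrite add0r -mulr_natr; nra.
Qed.

End stability.

(** * Zeros of a rough function plus a function of bounded variation *)

Section zero_set.
Context {R : realType}.
Local Open Scope classical_set_scope.
Local Notation leb := (@lebesgue_measure R).

(** Lebesgue measure is characterised by its values on half-open intervals. *)
Lemma lebesgue_measure_shift (h : R) (A : set (measurableTypeR R)) :
  measurable A -> leb [set t | A (t + h)] = leb A.
Proof.
move=> mA.
have mf : measurable_fun [set: measurableTypeR R]
    (fun t => t + h : measurableTypeR R).
  exact: measurable_funD.
have /= muP := @lebesgue_measure_unique R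
  [the measure _ _ of pushforward leb
    (fun t : measurableTypeR R => t + h : measurableTypeR R)].
apply/esym; apply: (muP mf) => // X [[x y] _ <-] /=; rewrite /pushforward.
rewrite (_ : _ @^-1` _ = `]x - h, y - h]%classic); last first.
  apply/seteqP; split => t /=; rewrite !in_itv/= => /andP[];
  by rewrite ?ltrBlDr ?lerBrDr => -> ->.
rewrite !lebesgue_measure_itv/= !lte_fin ltrD2r; case: ifP => // _.
by rewrite -!EFinD; congr EFin; ring.
Qed.

(** If A moves by more than a between t and t + h, it does so over the two
    consecutive cells of the grid of mesh h which contain [t, t + h]. The
    increments of A over all such pairs of cells add up to at most twice its
    total increment, and each pair which counts contributes at least a. *)
Lemma monotone_increment_cover (A : R -> R) (h a : R) (M : nat) :
  0 < h -> 0 < a -> (forall s t, 0 <= s -> s <= t -> A s <= A t) ->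
  exists S : set (measurableTypeR R), [/\ measurable S,
    (leb S <= (2 * (A (M.+1%:R * h) - A 0) * (h / a))%:E)%E &
    forall t, 0 <= t < M%:R * h -> a < A (t + h) - A t -> S t].
Proof.
move=> h0 a0 Amon.
have gh0 (k : nat) : 0 <= k%:R * h by rewrite mulr_ge0// ltW.
pose dA (k : nat) := A (k.+2%:R * h) - A (k%:R * h).
pose J (k : nat) : set (measurableTypeR R) :=
  if a <= dA k then `[k%:R * h, k.+1%:R * h] else set0.
have mJ k : measurable (J k) by rewrite /J; case: ifP => // _; exact: measurable_itv.
have dA0 k : 0 <= dA k.
  by rewrite subr_ge0; apply: Amon => //; rewrite ler_pM2r// ler_nat leqW.
have lJ k : (leb (J k) <= (dA k * (h / a))%:E)%E.
  rewrite /J; case: ifPn => [adA|_]; last first.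
    by rewrite measure0 lee_fin mulr_ge0// ltW// divr_gt0.
  rewrite lebesgue_measure_itv/= lte_fin ltr_pM2r// ltr_nat leqnn -EFinD lee_fin.
  rewrite -mulrBl -natrB// subSnn mul1r mulrCA mulrC ler_peMl ?(ltW h0)//.
  by rewrite ler_pdivlMr ?mul1r.
exists (\big[setU/set0]_(k < M) J k); split.
- by apply: bigsetU_measurable => k _; exact: mJ.
- apply: (le_trans (Boole_inequality leb (fun i _ => mJ i))).
  apply: (@le_trans _ _ (\sum_(k < M) (dA k * (h / a))%:E)%E).
    by apply: lee_sum => k _; exact: lJ.
  rewrite sumEFin lee_fin -mulr_suml.
  apply: ler_wpM2r; first by rewrite ltW// divr_gt0.
  (* dA k spans the cells k and k + 1, so the sum telescopes through the sums of
     values of A at two consecutive points of the grid *)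
  pose B (k : nat) := A (k%:R * h) + A (k.+1%:R * h).
  rewrite -(big_mkord predT dA).
  rewrite (_ : \sum_(_ <= _ < _ | _) _ = \sum_(0 <= k < M) (B k.+1 - B k)).
    rewrite telescope_sumr// /B mul0r.
    have h1 : A (M%:R * h) <= A (M.+1%:R * h).
      by apply: Amon => //; rewrite ler_pM2r// ler_nat.
    have h2 : A 0 <= A (1 * h) by apply: Amon => //; rewrite mul1r ltW.
    lra.
  by apply: eq_bigr => k _; rewrite /B /dA; ring.
move=> t /andP[t0 tM] atA.
have th0 : 0 <= t / h by rewrite divr_ge0// ltW.
have /andP[kt tk] := truncn_itv th0; set k := Num.truncn (t / h) in kt tk.
have {}kt : k%:R * h <= t by rewrite -ler_pdivlMr.
have {}tk : t < k.+1%:R * h by rewrite -ltr_pdivrMr.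
have kM : (k < M)%N.
  by rewrite -(ltr_nat R) -(ltr_pM2r h0); exact: le_lt_trans tM.
have adA : a <= dA k.
  have h1 : A (k%:R * h) <= A t by exact: Amon.
  have h2 : A (t + h) <= A (k.+2%:R * h).
    apply: Amon; first by rewrite addr_ge0// ltW.
    by move: tk; rewrite -!natr1 !mulrDl mul1r => tk; lra.
  by rewrite /dA; lra.
have Jt : J k t by rewrite /J adA /= in_itv/= kt ltW.
by rewrite -bigcup_mkord; exists k.
Qed.

Definition slow_times (v : R -> R) (T h a : R) : set (measurableTypeR R) :=
  [set t | `[0, T] t /\ `|v (t + h) - v t| <= a].

(** At suitable arbitrarily small scales h, the increment of v over h exceeds
    the threshold a from most times of [0, T]. A function of bounded variation does
    so only from a set of times of measure O(h / a), and h / a is small. *)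
Definition rough (v : R -> R) (T : R) : Prop :=
  forall e, 0 < e -> exists h a, [/\ 0 < h < e, 0 < a, h / a < e &
    (leb (slow_times v T h a) < e%:E)%E].

(** Continuity from above of the measure along the open neighbourhoods of
    radius 1 / (n + 1), which decrease to the compact set Z. *)
Lemma closed_neighbourhood_small (Z : set (measurableTypeR R)) (T e : R) :
  closed (Z : set R) -> Z `<=` `[0%R, T] -> 0 < e ->
  exists d : R, exists V : set (measurableTypeR R), [/\ 0 < d, measurable V,
    (leb V <= leb Z + e%:E)%E &
    forall t z, Z z -> `|z - t| < d -> V t].
Proof.
move=> cZ ZT e0.
pose V (n : nat) : set R := \bigcup_(z in Z) ball z n.+1%:R^-1.
have oV n : open (V n) by apply: bigcup_open => z _; exact: ball_open.
have mV n : measurable (V n : set (measurableTypeR R)) by exact: open_measurable.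
have mZ : measurable Z by exact: closed_measurable.
have VZ : \bigcap_n V n = Z.
  apply/seteqP; split => t.
    move=> Vt; apply: cZ => U /nbhs_ballP[d /= d0 dU].
    have [n nd] : exists n : nat, n.+1%:R^-1 < d.
      have d'0 : 0 <= d^-1 by rewrite invr_ge0 ltW.
      exists (Num.truncn (d^-1)); rewrite invf_plt ?posrE//.
      by have /andP[] := truncn_itv d'0.
    have [z Zz zt] := Vt n I.
    exists z; split=> //; apply: dU; apply: ball_sym; apply: le_ball zt.
    exact: ltW.
  by move=> Zt n _; exists t => //; apply: ballxx; rewrite invr_gt0.
have V0fin : (leb (V 0%N) < +oo)%E.
  apply: (@le_lt_trans _ _ (leb `[-1, T + 1])); last exact: leb_itv_cc_lty.
  apply: le_measure; rewrite ?inE//.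
  move=> t [z /ZT]; rewrite /= !in_itv/= /ball/= invr1 ltr_distl => /andP[z0 zT].
  by move=> /andP[h1 h2]; apply/andP; split; lra.
have := @nonincreasing_cvg_mu _ _ _ leb V V0fin mV.
rewrite VZ => /(_ mZ) cvgV.
have ndV : nonincreasing_seq V.
  move=> n m nm; apply/subsetPset => t [z Zz zt]; exists z => //.
  by apply: le_ball zt; rewrite lef_pV2 ?posrE// ler_nat ltnS.
have Zfin : leb Z \is a fin_num.
  rewrite ge0_fin_numE//; apply: le_lt_trans V0fin; apply: le_measure; rewrite ?inE//.
  by rewrite -[X in X `<=` _]VZ; exact: bigcap_inf.
have {cvgV}/(_ ndV) := cvgV.
move=> cvgV.
have [n Vn] : exists n, (leb (V n) <= leb Z + e%:E)%E.
  apply: contrapT => noV.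
  have : (leb Z + e%:E <= limn (leb \o V))%E.
    apply: lime_ge; first by apply/cvg_ex; eexists; exact: cvgV.
    apply: nearW => n /=; rewrite leNgt; apply/negP => /ltW Vn.
    by apply: noV; exists n.
  rewrite (cvg_lim _ cvgV)// -[X in (X + _)%E](fineK Zfin).
  rewrite -[X in (_ <= X)%E](fineK Zfin) -EFinD lee_fin; lra.
exists n.+1%:R^-1, (V n); split; rewrite ?invr_gt0//.
by move=> t z Zz zt; exists z.
Qed.

(** Suppose that the set Z of zeros has measure q > 0. For small h both Z and
    its translate by - h lie in a neighbourhood of Z of measure at most
    q + q / 4, hence they overlap in measure at least 3 q / 4. At a time t of
    the overlap the sum vanishes at t and at t + h, so that either the
    increment of v is at most a, which is rare by roughness, or the monotone
    parts move by more than a, which is rare by [monotone_increment_cover];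
    together this covers at most q / 2. *)
Lemma rough_zero_set (v A1 A2 : R -> R) (T : R) : rough v T ->
  (forall s t, 0 <= s -> s <= t -> A1 s <= A1 t) ->
  (forall s t, 0 <= s -> s <= t -> A2 s <= A2 t) ->
  continuous v -> continuous (fun t => v t + (A1 t - A2 t)) ->
  leb [set t | `[0%R, T] t /\ v t + (A1 t - A2 t) = 0] = 0%E.
Proof.
move=> rv A1mon A2mon cv cy.
have [T0|T0] := ltP T 0.
  rewrite (_ : [set t | _] = set0) ?measure0//.
  by apply/seteqP; split => // t []/=; rewrite in_itv/= => /andP[t0 tT]; lra.
set Z := [set t | _].
have cZ : closed (Z : set R).
  have -> : Z = `[0%R, T] `&` (fun t => v t + (A1 t - A2 t)) @^-1` [set 0] by [].
  apply: closedI; first exact: itv_closed.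
  by apply: closed_comp; [move=> x _; exact: cy|exact: closed_eq].
have mZ : measurable (Z : set (measurableTypeR R)) by exact: closed_measurable.
have ZT : Z `<=` `[0%R, T] by move=> t [].
have Zfin : leb Z \is a fin_num.
  rewrite ge0_fin_numE//; apply: le_lt_trans (leb_itv_cc_lty 0 T).
  by apply: le_measure; rewrite ?inE//; exact: measurable_itv.
apply/eqP; rewrite eq_le measure_ge0 andbT leNgt; apply/negP => Zpos.
pose q := fine (leb Z).
have q0 : 0 < q by rewrite fine_gt0// Zpos ltey_eq Zfin.
have [d [V [d0 mV lV VP]]] := @closed_neighbourhood_small Z T (q / 4) cZ ZT
  (divr_gt0 q0 (ltr0Sn _ 3)).
pose A t := A1 t + A2 t.
have Amon s t : 0 <= s -> s <= t -> A s <= A t.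
  by move=> s0 st; apply: lerD; [exact: A1mon|exact: A2mon].
(* h / a < q / c makes the cover by monotone increments smaller than q / 4; the
   grid of mesh h < 1 covering [0, T] ends before T + 3 *)
pose c := 8 * (A (T + 3) - A 0) + 1.
have Adiff : 0 <= A (T + 3) - A 0 by rewrite subr_ge0; apply: Amon => //; lra.
have c0 : 0 < c by rewrite /c; lra.
pose e := Num.min (Num.min d 1) (Num.min (q / 4) (q / c)).
have e0 : 0 < e by rewrite !lt_min d0 ltr01 !divr_gt0.
have [h [a [/andP[h0]]]] := rv e e0.
rewrite !lt_min => /andP[/andP[hd h1] _] a0.
move=> /andP[_ /andP[_ hac]].
set G := slow_times v T h a.
move=> Ge.
have {}Ge : (leb G <= (q / 4)%:E)%E.
  by apply: le_trans (ltW Ge) _; rewrite lee_fin /e !ge_min lexx orbT.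
pose M := (Num.truncn (T / h)).+1.
have Th : T < M%:R * h.
  rewrite -ltr_pdivrMr//.
  by have /andP[] := truncn_itv (divr_ge0 T0 (ltW h0)).
have Mh : M.+1%:R * h <= T + 3.
  have /andP[+ _] := truncn_itv (divr_ge0 T0 (ltW h0)).
  rewrite ler_pdivlMr// => hh; rewrite /M -!natr1 !mulrDl !mul1r; lra.
have [S [mS lS SP]] := monotone_increment_cover M h0 a0 Amon.
have {}lS : (leb S <= (q / 4)%:E)%E.
  apply: le_trans lS _; rewrite lee_fin.
  have h2 : A (M.+1%:R * h) <= A (T + 3).
    by apply: Amon => //; rewrite mulr_ge0// ltW.
  have h3 : h / a * c <= q by rewrite ltW// -ltr_pdivlMr.
  have h4 : 0 <= h / a by rewrite ltW// divr_gt0.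
  have : h / a * (A (M.+1%:R * h) - A 0) <= h / a * (A (T + 3) - A 0).
    by rewrite ler_wpM2l//; lra.
  by move: h3; rewrite /c; nra.
have mG : measurable (G : set (measurableTypeR R)).
  have -> : G = `[0%R, T] `&` (fun t => `|v (t + h) - v t|) @^-1` `]-oo, a].
    by apply/seteqP; split => t /=; rewrite /G/= in_itv.
  apply: measurableI; first exact: measurable_itv.
  rewrite -[X in measurable X]setTI.
  suff : measurable_fun setT (fun t : R => `|v (t + h) - v t|).
    by apply => //; exact: measurable_itv.
  apply: continuous_measurable_fun => t.
  apply: cvg_norm; apply: cvgB; last exact: cv.
  by apply: (@cvg_comp _ _ _ (fun t => t + h) v); [exact: cvgD (cvg_id) (cvg_cst _)|exact: cv].
pose Z' : set (measurableTypeR R) := [set t | Z (t + h)].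
have mZ' : measurable Z'.
  rewrite /Z' -[X in measurable X]setTI.
  by have : measurable_fun setT (fun t : measurableTypeR R => t + h : measurableTypeR R);
    [exact: measurable_funD|move=> /(_ measurableT _ mZ)].
have lZ' : leb Z' = leb Z by exact: lebesgue_measure_shift.
have sub1 : Z `|` Z' `<=` V.
  move=> t [Zt|Z't]; first by apply: (VP t t Zt); rewrite subrr normr0.
  by apply: (VP t (t + h) Z't); rewrite addrAC subrr add0r gtr0_norm.
have sub2 : Z `&` Z' `<=` G `|` S.
  move=> t [[t0T zt] [th0T zth]].
  have [small|big] := lerP `|v (t + h) - v t| a; first by left; split.
  right; apply: SP.
    by move: t0T; rewrite /= in_itv/= => /andP[-> tT]; exact: le_lt_trans Th.
  apply: (lt_le_trans big).
  have t0 : 0 <= t by move: t0T; rewrite /= in_itv/= => /andP[].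
  have tth : t <= t + h by rewrite lerDl ltW.
  have := A1mon t (t + h) t0 tth; have := A2mon t (t + h) t0 tth.
  rewrite ler_norml /A => b1 b2; apply/andP; split; lra.
have fZ' : (leb Z' < +oo)%E by rewrite lZ' -ge0_fin_numE.
have lU : (leb (Z `|` Z') = leb Z + leb Z' - leb (Z `&` Z'))%E.
  exact: (measureUfinr mZ mZ' fZ').
have lV' : (leb (Z `|` Z') <= leb Z + (q / 4)%:E)%E.
  apply: le_trans lV; apply: le_measure => //; rewrite inE//.
  exact: measurableU.
have lI : (leb (Z `&` Z') <= (q / 2)%:E)%E.
  apply: (@le_trans _ _ (leb (G `|` S))).
    by apply: le_measure => //; rewrite inE; [exact: measurableI|exact: measurableU].
  apply: le_trans (measureU2 _ _ _) _ => //.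
  apply: le_trans (leeD Ge lS) _; rewrite -EFinD lee_fin; lra.
have fI : leb (Z `&` Z') \is a fin_num.
  by rewrite ge0_fin_numE//; apply: le_lt_trans lI _; exact: ltry.
move: lV'; rewrite lU lZ' -(fineK Zfin) -(fineK fI) -/q -EFinN -!EFinD lee_fin.
move: lI; rewrite -(fineK fI) lee_fin; lra.
Qed.

End zero_set.

(** * Roughness of Brownian paths *)

Section joint_measurability.
Context {R : realType} {d : measure_display} {S : measurableType d}.
Local Open Scope classical_set_scope.

(** Approximate the time by the points of the grid of mesh 1 / (n + 1) just
    before it: the approximations are countable combinations of measurable
    rectangles and converge by continuity of the paths. *)
Lemma joint_measurable (f : R -> S -> R) :
  (forall w, continuous (fun t : R => f (Num.max 0 t) w)) ->
  (forall t : R, 0 <= t -> measurable_fun setT (f t)) ->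
  measurable_fun setT (fun p : R * S => f (Num.max 0 p.1) p.2).
Proof.
move=> cf mf.
pose k (n : nat) (t : R) := Num.truncn (Num.max 0 t * n.+1%:R).
pose g (n : nat) (p : R * S) := f ((k n p.1)%:R / n.+1%:R) p.2.
have kP n t : (k n t)%:R <= Num.max 0 t * n.+1%:R < (k n t).+1%:R.
  by apply: truncn_itv; rewrite mulr_ge0// maxr0_ge0.
apply: (@measurable_fun_cvg _ _ _ _ g).
  move=> n _ Y mY; rewrite setTI.
  pose K j : set R := [set t | j%:R <= Num.max 0 t * n.+1%:R < j.+1%:R].
  rewrite (_ : _ @^-1` _ = \bigcup_j (K j `*` (f (j%:R / n.+1%:R) @^-1` Y))).
    apply: bigcupT_measurable => j; apply: measurableX.
      have mmax : measurable_fun setT (fun t : R => Num.max 0 t * n.+1%:R).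
        by apply: measurable_funM => //; exact: measurable_maxr.
      have := mmax measurableT `[j%:R, j.+1%:R[ (measurable_itv _).
      rewrite setTI; congr measurable; apply/seteqP; split => t;
      by rewrite /K/= in_itv.
    have := mf (j%:R / n.+1%:R) (divr_ge0 (ler0n _ _) (ler0n _ _)) measurableT Y mY.
    by rewrite setTI.
  apply/seteqP; split => -[t w] /=.
    by move=> Ytw; exists (k n t) => //; split => //=; exact: kP.
  move=> [j _ [/= jt Yw]]; rewrite /g/=.
  by rewrite /k (truncn_def jt).
move=> [t w] _ /=; rewrite /g /=.
have lim_t : (k n t)%:R / n.+1%:R @[n --> \oo] --> Num.max 0 t.
  apply/cvgrPdist_le => e e0.
  have /cvgrPdist_le/(_ e e0) := @cvg_harmonic R; apply: filterS => n.
  rewrite sub0r normrN ger0_norm ?invr_ge0//; apply: le_trans.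
  have /andP[k1 k2] := kP n t.
  have n0 : 0 < n.+1%:R :> R by [].
  have k1' : (k n t)%:R / n.+1%:R <= Num.max 0 t by rewrite ler_pdivrMr.
  rewrite ger0_norm ?subr_ge0// lerBlDr /harmonic/= -[X in X + _]mul1r -mulrDl.
  by rewrite ler_pdivlMr// nat1r ltW.
have := cf w (Num.max 0 t); rewrite /continuous_at (maxr0_id (maxr0_ge0 t)).
move=> cfw; rewrite (_ : (fun n => _) =
    (fun n => f (Num.max 0 ((k n t)%:R / n.+1%:R)) w)).
  exact: (cvg_comp _ _ lim_t cfw).
by apply/funext => n; rewrite maxr0_id// divr_ge0.
Qed.

End joint_measurability.

Section basis_and_normal_law.
Context {R : realType} {d : measure_display} {Om : measurableType d}.
Context (P : probability Om R) (F : R -> set_system Om) {N : nat}.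
Hypothesis basis : usual_basis P F.
Local Open Scope classical_set_scope.
Local Notation leb := (@lebesgue_measure R).

Lemma filtration_measurable_funW (t : R) (Y : Om -> 'rV[R]_N) i : 0 <= t ->
  filtration_measurable_fun F t Y -> measurable_fun setT (fun w => Y w 0 i).
Proof.
move=> t0 /(_ i) mY _ A mA; have := mY measurableT A mA; rewrite !setTI => mYA.
apply: (filtration_measurable basis t0).
by rewrite -(sigma_algebra_id (filtration_sigma_algebra basis t0)).
Qed.

(** The density of the normal law is at most its peak 1 / (s sqrt (2 pi)),
    which is at most 1 / s. *)
Lemma normal_prob_itv (s x y : R) : 0 < s -> x <= y ->
  (normal_prob 0 s `[x, y] <= ((y - x) / s)%:E)%E.
Proof.
move=> s0 xy.
have peak : normal_peak s <= s^-1.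
  rewrite /normal_peak lef_pV2 ?posrE ?sqrtr_gt0 ?mulrn_wgt0 ?mulr_gt0 ?exprn_gt0 ?pi_gt0//.
  rewrite -[leLHS](ger0_norm (ltW s0)) -sqrtr_sqr ler_wsqrtr//.
  have s20 : 0 <= s ^+ 2 by exact: sqr_ge0.
  have := pi_ge2 R; nra.
apply: (@le_trans _ _ (\int[leb]_(u in `[x, y]) (s^-1)%:E)%E).
  apply: ge0_le_integral => //=.
  - by move=> u _; rewrite lee_fin normal_pdf_ge0.
  - by apply/measurable_EFinP; apply: measurable_funTS; exact: measurable_normal_pdf.
  - by move=> u _; rewrite lee_fin; apply: le_trans peak; rewrite normal_pdf_ub// gt_eqF.
rewrite integral_cst/=; last exact: measurable_itv.
rewrite lebesgue_measure_itv/= lte_fin; case: ltgtP xy => // [xy _|-> _].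
  by rewrite -EFinD -EFinM lee_fin mulrC.
by rewrite mule0 subrr mul0r.
Qed.

End basis_and_normal_law.

Section brownian_paths_rough.
Context {R : realType} {d : measure_display} {Om : measurableType d}.
Context (P : probability Om R) (F : R -> set_system Om) {N : nat}.
Context (B : R -> Om -> 'rV[R]_N).
Hypothesis basis : usual_basis P F.
Hypothesis BM : brownian_motion P F B.
Local Open Scope classical_set_scope.
Local Notation leb := (@lebesgue_measure R).
Variables (c c' : R) (i j : 'I_N).
Hypotheses (c0 : 0 < c) (c'0 : 0 < c') (ij : i != j).

Let V (t : R) (w : Om) : R := c * B t w 0 i - c' * B t w 0 j.

Lemma measurable_brownian t k : 0 <= t -> measurable_fun setT (fun w => B t w 0 k).
Proof.
move=> t0; apply: (filtration_measurable_funW basis _ t0).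
exact: (brownian_adapted BM).
Qed.

Let measurable_V t : 0 <= t -> measurable_fun setT (V t).
Proof.
move=> t0; apply: measurable_funB; apply: measurable_funM => //;
exact: measurable_brownian.
Qed.

(** Cut the values of the i-th increment into intervals of length a / c. Once
    the i-th increment is known to lie in one of them, the event confines the
    j-th increment to an interval of length 3 a / c'. The increments of the two
    coordinates are independent, and the density of the j-th is at most
    1 / sqrt (t - s); summing over the intervals gives the bound. *)
Lemma brownian_small_increment (s t a : R) : 0 <= s -> s < t -> 0 < a ->
  (P [set w | `|V t w - V s w| <= a]%R <=
    (3 * a / (c' * Num.sqrt (t - s)))%:E)%E.
Proof.
move=> s0 st a0.
have t0 : 0 <= t by rewrite (le_trans s0)// ltW.
set sd := Num.sqrt (t - s).
have sd0 : 0 < sd by rewrite sqrtr_gt0 subr_gt0.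
(* the cells for the i-th increment, the enlarged cells for the j-th one, and
   their enumeration by natural numbers *)
pose I1 (z : int) : set R := `[z%:~R * a / c, (z + 1)%:~R * a / c[.
pose I2 (z : int) : set R := `[(z - 1)%:~R * a / c', (z + 2)%:~R * a / c'].
pose C z (k : 'I_N) : set R := if k == i then I1 z else if k == j then I2 z else setT.
have mC z k : measurable (C z k).
  by rewrite /C; case: ifP => _; [exact: measurable_itv|case: ifP => _ //; exact: measurable_itv].
pose E n : set Om := if pickle_inv n is Some z then increment_event B s t (C z) else set0.
pose J n : set R := if @pickle_inv int n is Some z then I1 z else set0.
have mJ n : measurable (J n).
  by rewrite /J; case: pickle_inv => // z; exact: measurable_itv.
have mincr z : measurable (increment_event B s t (C z)).
  have -> : increment_event B s t (C z) =
      \bigcap_(k in [set: 'I_N]) ((fun w => B t w 0 k - B s w 0 k) @^-1` C z k).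
    by apply/seteqP; split => w; [move=> h k _; exact: h|move=> h k; exact: h].
  apply: fin_bigcap_measurable; first exact: finite_finset.
  move=> k _; rewrite -[X in measurable X]setTI.
  have : measurable_fun setT (fun w => B t w 0 k - B s w 0 k).
    by apply: measurable_funB; exact: measurable_brownian.
  by apply.
have mE n : measurable (E n) by rewrite /E; case: pickle_inv.
have PE n : (P (E n) <= normal_prob 0 sd (J n) * (3 * a / (c' * sd))%:E)%E.
  rewrite /E /J; case: pickle_inv => [z|]; last by rewrite !measure0 mul0e.
  rewrite (brownian_increment_law BM s0 st (mC z)).
  rewrite (bigD1 i)//= (bigD1 j)//=; last by rewrite eq_sym.
  rewrite big1 ?mule1; last first.
    move=> k /andP[ki kj]; rewrite /C (negPf ki) (negPf kj).
    exact: (probability_setT (normal_prob 0 sd)).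
  rewrite /C eqxx eq_sym (negPf ij) eqxx.
  apply: lee_pmul => //.
  have -> : 3 * a / (c' * sd) = ((z + 2)%:~R * a / c' - (z - 1)%:~R * a / c') / sd.
    rewrite !intrD mulrN1z invfM; field.
    by rewrite !gt_eqF.
  apply: normal_prob_itv => //.
  by rewrite ler_pM2r ?invr_gt0// ler_pM2r// ler_int lerD2l.
have JP n x : J n x -> exists2 z, pickle z = n & I1 z x.
  rewrite /J; have := @pickle_invK int n.
  by case: (pickle_inv n) => // z /= En Iz; exists z.
have tJ : trivIset setT J.
  move=> n m _ _ [x [/JP[z <- +] /JP[z' <- +]]].
  rewrite /I1/= !in_itv/= => /andP[x1 x2] /andP[y1 y2].
  have lt_int (u v : int) : u%:~R * a / c <= x -> x < (v + 1)%:~R * a / c -> u <= v.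
    move=> h1 h2; have := le_lt_trans h1 h2.
    by rewrite ltr_pM2r ?invr_gt0// ltr_pM2r// ltr_int ltzD1.
  congr pickle; apply/eqP; rewrite eq_le.
  by rewrite (lt_int z z')// (lt_int z' z).
have cover : [set w | `|V t w - V s w| <= a] `<=` \bigcup_n E n.
  move=> w /=; rewrite ler_norml => /andP[h1 h2].
  pose x := B t w 0 i - B s w 0 i; pose y := B t w 0 j - B s w 0 j.
  have /andP[z1 z2] := floor_itv (c * x / a).
  move: (Num.floor _) z1 z2 => z z1 z2.
  rewrite ler_pdivlMr// in z1; rewrite ltr_pdivrMr// in z2.
  exists (pickle z); first exact: I.
  rewrite /E pickleK_inv => k; rewrite /C.
  have VE : V t w - V s w = c * x - c' * y by rewrite /V /x /y; ring.
  case: eqP => [->|_]; [|case: eqP => [->|_ //]]; rewrite /I1 /I2 /= in_itv/=.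
    by rewrite ler_pdivrMr// ltr_pdivlMr// [_ * c]mulrC z1 z2.
  rewrite ler_pdivrMr// ler_pdivlMr// -/y.
  move: z1 z2; rewrite !intrD mulrN1z => z1 z2.
  by apply/andP; split; nra.
have mA : measurable [set w | `|V t w - V s w| <= a].
  have : measurable_fun setT (fun w => `|V t w - V s w|).
    by apply: measurableT_comp => //; apply: measurable_funB; exact: measurable_V.
  move=> /(_ measurableT `]-oo, a] (measurable_itv _)); rewrite setTI.
  by congr measurable; apply/seteqP; split => w /=; rewrite in_itv.
apply: le_trans (measure_sigma_subadditive P mE mA cover) _.
apply: (@le_trans _ _ (\sum_(n <oo) normal_prob 0 sd (J n) *
    (3 * a / (c' * sd))%:E)%E).
  by apply: lee_nneseries => // n _; exact: PE.
under eq_eseriesr do rewrite muleC.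
rewrite nneseriesZl//.
rewrite -[X in (X <= _)%E]muleC -[X in (_ <= X)%E]mul1e.
apply: lee_pmul => //.
- by apply: nneseries_ge0.
- by rewrite lee_fin divr_ge0 ?mulr_ge0 ?ltW.
have <- : normal_prob 0 sd (\bigcup_n J n) = (\sum_(n <oo) normal_prob 0 sd (J n))%E.
  rewrite measure_bigcup//; last by move=> n _; exact: mJ.
  by apply: eq_eseriesl => n; rewrite in_setT.
apply: (@le_trans _ _ (normal_prob 0 sd setT)); last first.
  by rewrite (probability_setT (normal_prob 0 sd)).
by apply: le_measure; rewrite ?inE//; exact: bigcupT_measurable.
Qed.

Let Vp (t : R) (w : Om) : R := V (Num.max 0 t) w.

Let cVp w : continuous (Vp ^~ w).
Proof.
have cB : continuous_path (B ^~ w) by exact: (@brownian_continuous _ _ _ _ _ _ _ BM w).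
have cBk k : continuous (fun t : R => B (Num.max 0 t) w 0 k).
  by apply: continuous_path_coord cB.
move=> t; apply: cvgB; apply: cvgM; [exact: cvg_cst|exact: cBk|exact: cvg_cst|].
exact: cBk.
Qed.

Let mVp : measurable_fun setT
  (fun p : measurableTypeR R * Om => Vp p.1 p.2).
Proof. exact: (joint_measurable cVp measurable_V). Qed.

Let mslow (T h a : R) : measurable
  [set p : measurableTypeR R * Om | slow_times (Vp ^~ p.2) T h a p.1].
Proof.
have -> : [set p : measurableTypeR R * Om | slow_times (Vp ^~ p.2) T h a p.1] =
    (fst @^-1` (`[0, T] : set (measurableTypeR R))) `&`
    ((fun p => `|Vp (p.1 + h) p.2 - Vp p.1 p.2|) @^-1` `]-oo, a]).
  by apply/seteqP; split => -[t w]/=; rewrite /slow_times/= in_itv/=.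
apply: measurableI.
  have m0T : measurable (`[0, T] : set (measurableTypeR R)) by exact: measurable_itv.
  by have := @measurable_fst _ _ (measurableTypeR R) Om measurableT _ m0T; rewrite setTI.
have mshift : measurable_fun setT
    (fun p : measurableTypeR R * Om => (p.1 + h : measurableTypeR R, p.2)).
  apply: measurable_fun_pair; last exact: measurable_snd.
  by apply: measurable_funD => //; exact: measurable_fst.
have : measurable_fun setT
    (fun p : measurableTypeR R * Om => `|Vp (p.1 + h) p.2 - Vp p.1 p.2|).
  apply: measurableT_comp => //; apply: measurable_funB => //.
  exact: (measurableT_comp mVp mshift).
by move=> /(_ measurableT `]-oo, a] (measurable_itv _)); rewrite setTI.
Qed.

(** Tonelli exchanges the expectation and the integral over time. *)
Lemma expected_slow_times (T h a : R) : 0 <= T -> 0 < h -> 0 < a ->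
  (\int[P]_w leb (slow_times (Vp ^~ w) T h a) <=
    (3 * a / (c' * Num.sqrt h) * T)%:E)%E.
Proof.
move=> T0 h0 a0.
pose E : set (measurableTypeR R * Om) := [set p | slow_times (Vp ^~ p.2) T h a p.1].
have mE : measurable E := mslow T h a.
pose K : R := 3 * a / (c' * Num.sqrt h).
pose D : set (measurableTypeR R) := `[0, T].
have mD : measurable D by exact: measurable_itv.
have K0 : 0 <= K by rewrite divr_ge0 ?mulr_ge0 ?sqrtr_ge0 ?ltW.
have mEw w : measurable ([set t | E (t, w)] : set (measurableTypeR R)).
  by have := measurable_ysection w mE; rewrite ysectionE.
have mEt t : measurable ([set w | E (t, w)] : set Om).
  by have := measurable_xsection t mE; rewrite xsectionE.
have /= fub := @fubini_tonelli _ _ (measurableTypeR R) Om R leb P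
  (fun p => (\1_E p)%:E).
have mf : measurable_fun setT (fun p => (\1_E p : R)%:E).
  by apply/measurable_EFinP; exact: measurable_indic.
have f0 p : (0 <= (\1_E p : R)%:E)%E by rewrite lee_fin.
have {}fub := fub mf f0.
rewrite (_ : (\int[P]_w _)%E = (\int[P]_w \int[leb]_t (\1_E (t, w))%:E)%E); last first.
  apply: eq_integral => w _.
  rewrite -[LHS](congr1 leb (setIT [set t | E (t, w)])).
  by rewrite -(integral_indic leb measurableT (mEw w)).
rewrite -fub.
apply: (@le_trans _ _ (\int[leb]_t ((cst K%:E) \_ D) t)%E); last first.
  rewrite -integral_mkcond integral_cst//=.
  rewrite lebesgue_measure_itv/= lte_fin; case: ltgtP T0 => // [T0 _|<- _].
    by rewrite -EFinD -EFinM subr0.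
  by rewrite mule0 mulr0.
apply: ge0_le_integral => //.
- by move=> t _; apply: integral_ge0 => w _; rewrite lee_fin.
- exact: (measurable_fun_fubini_tonelli_F (m2 := P) _ mf f0).
- by apply/(measurable_restrict _ mD measurableT); exact: measurable_cst.
move=> t _.
rewrite (_ : (\int[P]_w _)%E = P [set w | E (t, w)]); last first.
  rewrite -[RHS](congr1 P (setIT [set w | E (t, w)])).
  by rewrite -(integral_indic P measurableT (mEt t)).
rewrite patchE; case: ifPn => [|tT].
  rewrite inE /D/= in_itv/= => /andP[t0 tT].
  have tth : t < t + h by rewrite ltrDl.
  have th : 0 <= t + h by rewrite addr_ge0// ltW.
  apply: (@le_trans _ _ (P [set w | `|V (t + h) w - V t w| <= a]%R)); last first.
    apply: le_trans (brownian_small_increment t0 tth a0) _.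
    by rewrite /K addrAC subrr add0r.
  apply: le_measure; rewrite ?inE//.
    have : measurable_fun setT (fun w => `|V (t + h) w - V t w|).
      by apply: measurableT_comp => //; apply: measurable_funB; exact: measurable_V.
    move=> /(_ measurableT `]-oo, a] (measurable_itv _)); rewrite setTI.
    by congr measurable; apply/seteqP; split => w /=; rewrite in_itv.
  by move=> w [_]; rewrite /Vp /= !maxr0_id.
rewrite (_ : [set w | _] = set0) ?measure0//.
by apply/seteqP; split => // w [tT' _]; move: tT; rewrite notin_setE; apply.
Qed.

(** Along h = 16 ^ (- n) and a = 8 ^ (- n), both h / a and a / sqrt h equal
    2 ^ (- n). So the expected measure of the slow times tends to 0, and by
    Fatou its inferior limit vanishes almost surely. *)
Lemma brownian_rough (T : R) : 0 <= T -> {ae P, forall w, rough (Vp ^~ w) T}.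
Proof.
move=> T0.
pose h (n : nat) : R := 16^-1 ^+ n; pose a (n : nat) : R := 8^-1 ^+ n.
pose f n w := leb (slow_times (Vp ^~ w) T (h n) (a n)).
have h0 n : 0 < h n by rewrite exprn_gt0// invr_gt0.
have a0 n : 0 < a n by rewrite exprn_gt0// invr_gt0.
have f0 n w : (0 <= f n w)%E by exact: measure_ge0.
have mf n : measurable_fun setT (f n).
  have := measurable_fun_ysection leb (mslow T (h n) (a n)).
  by congr measurable_fun; apply/funext => w; rewrite /= ysectionE.
pose K : R := 3 / c' * T.
have Ef n : (\int[P]_w f n w <= (K * 2^-1 ^+ n)%:E)%E.
  apply: le_trans (expected_slow_times T0 (h0 n) (a0 n)) _.
  have -> : Num.sqrt (h n) = 4^-1 ^+ n.
    have -> : h n = (4^-1 ^+ n) ^+ 2.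
      by rewrite /h -exprM mulnC exprM; congr (_ ^+ n); field.
    by rewrite sqrtr_sqr ger0_norm// exprn_ge0.
  rewrite lee_fin /K /a le_eqVlt; apply/orP; left; apply/eqP.
  have -> : 8^-1 ^+ n = 4^-1 ^+ n * 2^-1 ^+ n :> R.
    by rewrite -exprMn; congr (_ ^+ n); field.
  have : (4^-1 : R) ^+ n != 0 by rewrite expf_neq0.
  by move: (4^-1 ^+ n) (2^-1 ^+ n) => x y x0; field; rewrite x0 gt_eqF.
have geo : (K * 2^-1 ^+ n)%:E @[n --> \oo] --> 0%E.
  apply: cvg_EFin; first exact: nearW.
  rewrite /= (_ : fine \o _ = fun n => K * 2^-1 ^+ n)//.
  rewrite -[X in _ --> X](mulr0 K); apply: cvgM; first exact: cvg_cst.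
  by apply: cvg_expr; rewrite ger0_norm ?invr_ge0// invf_lt1// ltr1n.
have := @fatou _ _ _ P setT measurableT f mf (fun n w _ => f0 n w).
have lim0 : limn_einf (fun n => (\int[P]_w f n w)%E) = 0%E.
  have cvg0 : (\int[P]_w f n w)%E @[n --> \oo] --> 0%E.
    apply: (@squeeze_cvge _ _ _ _ (cst 0%E) _ (fun n => (K * 2^-1 ^+ n)%:E)) => //.
      by apply: nearW => n; rewrite Ef integral_ge0.
    exact: cvg_cst.
  by rewrite (cvg_limn_einf_sup cvg0).
rewrite lim0 => fat.
pose g w := limn_einf (f ^~ w).
have g0 w : (0 <= g w)%E.
  rewrite /g limn_einf_lim; apply: lime_ge; first exact: is_cvg_einfs.
  by apply: nearW => n; apply/ereal_infP => _ [k _ <-].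
have cvg_g w : einfs (f ^~ w) n @[n --> \oo] --> g w.
  by rewrite /g limn_einf_lim; exact: is_cvg_einfs.
have mg : measurable_fun setT g.
  apply: (emeasurable_fun_cvg (fun n w => einfs (f ^~ w) n)) => // n.
  exact: measurable_fun_einfs.
have : ae_eq P setT g (cst 0%E).
  apply/ae_eq_integral_abs => //.
  apply/eqP; rewrite eq_le integral_ge0 ?andbT//.
  by under eq_integral do rewrite gee0_abs//.
apply: ae_imply => w /(_ I) gw e e0.
have [m em] : exists m, forall n, (m <= n)%N -> 2^-1 ^+ n < e.
  have : (2^-1 ^+ n : R) @[n --> \oo] --> (0 : R).
    by apply: cvg_expr; rewrite ger0_norm ?invr_ge0// invf_lt1// ltr1n.
  move=> /cvgrPdist_lt /(_ e e0)[m _ mP]; exists m => n mn.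
  by have := mP n mn; rewrite /= sub0r normrN ger0_norm ?exprn_ge0.
have : (einfs (f ^~ w) m < e%:E)%E.
  apply: (@le_lt_trans _ _ 0%E); rewrite ?lte_fin//.
  have <- : g w = 0%E := gw; rewrite -(cvg_lim _ (cvg_g w))//.
  rewrite (cvg_lim _ (@cvg_einfs_sup _ (f ^~ w)))//.
  by apply: ereal_sup_ubound; exists m.
move=> /ereal_inf_lt[_ [n /= mn <-] fn].
exists (h n), (a n); split => //.
- rewrite h0/=; apply: le_lt_trans (em n mn).
  by rewrite lerXn2r ?nnegrE ?invr_ge0// lef_pV2 ?posrE// ler_nat.
- rewrite /h /a -expr_div_n (_ : _ / _ = 2^-1); first exact: em.
  by field.
Qed.

End brownian_paths_rough.

(** * Complementarity and the Skorokhod map *)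

Section stieltjes.
Context {R : realType}.
Local Open Scope classical_set_scope.
Implicit Types (x l : R -> R).

(** The condition that the integral of x with respect to l vanishes, in a
    form which involves no measure and is stable under uniform limits. *)
Definition flat_off_zero x l : Prop :=
  forall s t : R, 0 <= s -> s <= t -> (forall u, s <= u <= t -> 0 < x u) -> l t = l s.

Lemma lebesgue_stieltjes_itvoc (f : cumulative R R) (a b : R) : a <= b ->
  lebesgue_stieltjes_measure f `]a, b] = (f b - f a)%:E.
Proof.
move=> ab; rewrite /lebesgue_stieltjes_measure /measure_extension.
by rewrite measurable_mu_extE/= ?wlength_itv_bnd//; exact: is_ocitv.
Qed.

Lemma measurable_fun_continuous_path x :
  continuous (fun t : R => x (Num.max 0 t)) ->
  measurable_fun (`[0, +oo[ : set (measurableTypeR R)) x.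
Proof.
move=> cx; apply: (@eq_measurable_fun _ _ _ _ _ (fun t : R => x (Num.max 0 t))).
  by move=> t; rewrite inE/= in_itv/= andbT => t0; rewrite maxr0_id.
by apply: measurable_funTS; exact: continuous_measurable_fun.
Qed.

(** On [s, t] the path x is bounded below by a positive minimum, so the mass
    l t - l s of ]s, t] must vanish. *)
Lemma stieltjes_flat x l : continuous (fun t : R => x (Num.max 0 t)) ->
  (forall t, 0 <= t -> 0 <= x t) -> stieltjes_integral_eq0 x l ->
  (forall s t, 0 <= s -> s <= t -> l s <= l t) ->
  flat_off_zero x l.
Proof.
move=> cx x0 [lbar lbarE int0] lmon s t s0 st xpos.
have t0 : 0 <= t := le_trans s0 st.
have [c cst cmin] := @EVT_min R (fun t => x (Num.max 0 t)) s t st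
  (continuous_subspaceT cx).
move: cst; rewrite in_itv/= => /andP[sc ct].
have c0 : 0 <= c := le_trans s0 sc.
have xc : 0 < x c by apply: xpos; rewrite sc.
pose mu := lebesgue_stieltjes_measure lbar.
have muE : mu `]s, t] = (l t - l s)%:E.
  by rewrite /mu lebesgue_stieltjes_itvoc// !lbarE !maxr0_id.
have mx := measurable_fun_continuous_path cx.
have sub : `]s, t] `<=` `[0%R, +oo[.
  by move=> u /=; rewrite !in_itv/= andbT => /andP[/ltW /(le_trans s0)].
have mst : measurable (`]s, t] : set (measurableTypeR R)) by exact: measurable_itv.
have m0y : measurable (`[0, +oo[ : set (measurableTypeR R)) by exact: measurable_itv.
have le0 : ((x c)%:E * mu `]s, t] <= 0)%E.
  rewrite -int0.
  apply: (@le_trans _ _ (\int[mu]_(u in `]s, t]) (x u)%:E)%E); last first.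
    apply: ge0_subset_integral => //.
    + exact/measurable_EFinP.
    + by move=> u; rewrite /= in_itv/= andbT => u0; rewrite lee_fin x0.
  rewrite -integral_cst//.
  apply: ge0_le_integral => //.
  + by move=> u _; rewrite lee_fin ltW.
  + by apply/measurable_EFinP; apply: measurable_funS mx.
  + move=> u; rewrite /= in_itv/= => /andP[su ut]; rewrite lee_fin.
    have u0 : 0 <= u := le_trans s0 (ltW su).
    have := cmin u; rewrite in_itv/= (ltW su) ut => /(_ isT).
    by rewrite !maxr0_id.
move: le0; rewrite muE -EFinM lee_fin.
rewrite pmulr_rle0// subr_le0 => lts; apply/eqP; rewrite eq_le lts lmon//.
Qed.

(** By continuity the set where x > 0 is covered by countably many intervals
    with rational endpoints on which x stays positive; each of them is null for
    the measure associated with l. *)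
Lemma flat_stieltjes x l : continuous (fun t : R => x (Num.max 0 t)) ->
  (forall t, 0 <= t -> 0 <= x t) -> C0up l -> flat_off_zero x l ->
  stieltjes_integral_eq0 x l.
Proof.
move=> cx x0 [cl l00 lmon _] flat.
have {}cl := (continuous_pathP l).1 cl.
have nd : nondecreasing (fun t : R => l (Num.max 0 t)).
  move=> s t st; apply: lmon; first exact: maxr0_ge0.
  by rewrite ge_max maxr0_ge0/= le_max st orbT.
have rc := right_continuousW cl.
pose B := isCumulative.Build R _ R (fun t : R => l (Num.max 0 t)) nd rc.
pose lbar : cumulative R R := HB.pack (fun t : R => l (Num.max 0 t)) B.
exists lbar => //.
pose mu := lebesgue_stieltjes_measure lbar.
have mx := measurable_fun_continuous_path cx.
pose V (n : nat) : set R := if unpickle n is Some (p, q) then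
   if `[< (ratr p : R) <= ratr q /\ forall u, ratr p <= u <= ratr q -> 0 < x (Num.max 0 u) >]
   then `]ratr p, ratr q] else set0 else set0.
have V0 n : mu.-negligible (V n).
  rewrite /V; case: unpickle => [[p q]|]; last exact: negligible_set0.
  case: asboolP => [[pq xpq]|_]; last exact: negligible_set0.
  apply/negligibleP; first exact: measurable_itv.
  rewrite [LHS](lebesgue_stieltjes_itvoc lbar pq) /=; congr EFin.
  apply/eqP; rewrite subr_eq0; apply/eqP; apply: flat.
  - exact: maxr0_ge0.
  - by rewrite ge_max maxr0_ge0/= le_max pq orbT.
  move=> u /andP[pu uq].
  have u0 : 0 <= u := le_trans (maxr0_ge0 _) pu.
  have [pu'|pu'] := leP (ratr p) u; last first.
    by move: pu; rewrite ge_max => /andP[_ /(lt_le_trans pu')]; rewrite ltxx.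
  have [uq'|uq'] := leP u (ratr q).
    by rewrite -(maxr0_id u0); apply: xpq; rewrite pu'.
  have u0' : u <= 0 by move: uq; rewrite le_max => /orP[//|/(lt_le_trans uq')]; rewrite ltxx.
  have -> : u = Num.max 0 (ratr q).
    have -> : u = 0 by apply/eqP; rewrite eq_le u0' u0.
    by apply/esym/max_idPl; rewrite (le_trans (ltW uq')).
  by apply: xpq; rewrite pq lexx.
have negU : mu.-negligible (\bigcup_n V n) by exact: negligible_bigcup.
pose D : set (measurableTypeR R) := `[0, +oo[.
have mD : measurable D by exact: measurable_itv.
have mxE : measurable_fun D (EFin \o x) by exact/measurable_EFinP.
have xge0 u : D u -> (0 <= (EFin \o x) u)%E.
  by rewrite /D /= in_itv/= andbT => u0; rewrite lee_fin x0.
suff ae0 : ae_eq mu D (EFin \o x) (cst 0%E).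
  have := @ge0_ae_eq_integral _ _ _ mu D _ _ mD mxE (measurable_cst _) xge0
    (fun _ _ => lexx _) ae0.
  by move=> ->; rewrite integral_cst// mul0e.
apply: (@negligibleS _ _ _ mu (\bigcup_n V n)) => // t /= Ht.
have {Ht} [t0 xt] : 0 <= t /\ x t != 0.
  apply: contrapT => H; apply: Ht; rewrite /D /= in_itv/= andbT => t0.
  by congr EFin; apply/eqP; apply: contrapT => /negP xt; apply: H.
have {xt} xt : 0 < x (Num.max 0 t) by rewrite maxr0_id// lt_neqAle eq_sym xt x0.
have /= [e /= e0 eP] := cvgr_gt _ (cx t) _ xt.
have [p] := @rat_in_itvoo R (t - e) t ltac:(by rewrite gtrBl).
rewrite in_itv/= => /andP[p1 p2].
have [q] := @rat_in_itvoo R t (t + e) ltac:(by rewrite ltrDl).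
rewrite in_itv/= => /andP[q1 q2].
exists (pickle (p, q)); first exact: I.
rewrite /V pickleK asboolT; first by rewrite /= in_itv/= p2 ltW.
split; first by rewrite ltW// (lt_trans p2).
move=> u /andP[pu uq]; apply: eP => /=; rewrite ltr_distlC.
by rewrite (lt_le_trans p1 pu) (le_lt_trans uq q2).
Qed.

End stieltjes.

Section pushing.
Context {R : realType}.
Local Open Scope classical_set_scope.
Variable refl : bool.
Implicit Types (y : R -> R) (s t : R).

(** The reflection term of the Skorokhod problem on the half-line: the running
    maximum of the negative part of y. It is 0 when refl is false, which lets
    both kinds of equations share their construction. *)
Definition pushing y t : R :=
  if refl then sup [set Num.max 0 (- y s) | s in `[0, t]] else 0.

Section properties.
Variable y : R -> R.
Hypothesis cy : continuous y.
Hypothesis y0 : refl -> 0 <= y 0.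

Lemma pushing_attained t : 0 <= t -> refl ->
  exists s, [/\ 0 <= s, s <= t, pushing y t = Num.max 0 (- y s) &
    forall u, 0 <= u -> u <= t -> Num.max 0 (- y u) <= pushing y t].
Proof.
move=> t0 r; rewrite /pushing r.
have cf : continuous (fun s : R => Num.max 0 (- y s)).
  move=> s; apply: (@continuous_max _ _ (cst 0) (fun s => - y s) s).
    exact: cvg_cst.
  by apply: cvgN; exact: cy.
have [s s0t smax] := @EVT_max R _ 0 t t0 (continuous_subspaceT cf).
move: s0t; rewrite in_itv/= => /andP[s0 st].
have ubs : ubound [set Num.max 0 (- y s) | s in `[0, t]] (Num.max 0 (- y s)).
  by move=> _ [u u0t <-]; exact: smax.
have supE : sup [set Num.max 0 (- y s) | s in `[0, t]] = Num.max 0 (- y s).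
  apply/eqP; rewrite eq_le; apply/andP; split.
    apply: ge_sup => //; exists (Num.max 0 (- y s)).
    by exists s => //=; rewrite in_itv/= s0.
  apply: ub_le_sup; first by exists (Num.max 0 (- y s)).
  by exists s => //=; rewrite in_itv/= s0.
exists s; split; rewrite ?supE// => u u0 ut.
by apply: smax; rewrite in_itv/= u0.
Qed.

Lemma pushing_ge0 t : 0 <= t -> 0 <= pushing y t.
Proof.
move=> t0; have [r|/negPf r] := boolP refl; last by rewrite /pushing r.
by have [s [_ _ -> _]] := pushing_attained t0 r; exact: maxr0_ge0.
Qed.

Lemma pushing0 : pushing y 0 = 0.
Proof.
have [r|/negPf r] := boolP refl; last by rewrite /pushing r.
have [s [s0 s0' -> _]] := pushing_attained (lexx 0) r.
have -> : s = 0 by apply/eqP; rewrite eq_le s0 s0'.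
by apply/max_idPl; rewrite oppr_le0 y0.
Qed.

Lemma pushing_mono s t : 0 <= s -> s <= t -> pushing y s <= pushing y t.
Proof.
move=> s0 st; have [r|/negPf r] := boolP refl; last by rewrite /pushing r.
have [u [u0 us -> _]] := pushing_attained s0 r.
have [v [_ _ _ H]] := pushing_attained (le_trans s0 st) r.
by apply: H => //; exact: le_trans us st.
Qed.

Lemma pushed_ge0 t : refl -> 0 <= t -> 0 <= y t + pushing y t.
Proof.
move=> r t0; have [s [_ _ _ H]] := pushing_attained t0 r.
have := H t t0 (lexx t); rewrite ge_max => /andP[_]; lra.
Qed.

(** If the running maximum increases on [s, t], it is attained at some u there,
    and it grows by at most y s - y u because y s + pushing y s >= 0. *)
Lemma pushing_modulus s t (e : R) : 0 <= s -> s <= t -> 0 <= e ->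
  (forall u, s <= u <= t -> `|y u - y s| <= e) ->
  pushing y t - pushing y s <= e.
Proof.
move=> s0 st e0 ye; have [r|/negPf r] := boolP refl; last by rewrite /pushing r subrr.
have [u [u0 ut -> _]] := pushing_attained (le_trans s0 st) r.
have [v [_ _ _ H]] := pushing_attained s0 r.
have [us|/ltW su] := leP u s; first by have := H u u0 us; lra.
have := ye u; rewrite su ut => /(_ isT); rewrite ler_norml => /andP[yu _].
have := H s s0 (lexx s); rewrite ge_max => /andP[h1 h2].
rewrite lerBlDr ge_max; apply/andP; split; lra.
Qed.

(** If the running maximum increased on [s, t], at the time u where it is
    attained the reflected path would not be positive. *)
Lemma pushing_flat : flat_off_zero (fun t => y t + pushing y t) (pushing y).
Proof.
move=> s t s0 st xpos; have [r|/negPf r] := boolP refl; last by rewrite /pushing r.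
apply/eqP; rewrite eq_le (pushing_mono s0 st) andbT.
have t0 := le_trans s0 st.
have [u [u0 ut tE _]] := pushing_attained t0 r.
have [v [_ _ _ H]] := pushing_attained s0 r.
have [us|/ltW su] := leP u s; first by rewrite tE H.
have := xpos u; rewrite su ut => /(_ isT) yu.
have ps := pushing_ge0 s0.
rewrite tE ge_max ps/=.
have [ule|] := leP (- y u) 0; first exact: le_trans ule ps.
move=> yu0; have := pushing_mono u0 ut.
rewrite tE (max_idPr (ltW yu0)); lra.
Qed.

End properties.

Lemma pushing_local y y' t : (forall s, 0 <= s <= t -> y s = y' s) ->
  pushing y t = pushing y' t.
Proof.
move=> yy'; rewrite /pushing; case: refl => //; congr sup.
apply/seteqP; split => _ [s /= st <-]; exists s => //=;
by rewrite yy'//; move: st; rewrite in_itv.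
Qed.

End pushing.

(** * The delay scheme *)

Section rank_measurability.
Context {R : realType} {N : nat} {d : measure_display} {S : measurableType d}.
Local Open Scope classical_set_scope.

Lemma measurable_fun_natmul_bool (D : set S) (p : S -> bool) :
  measurable_fun D p -> measurable_fun D (fun s => (p s)%:R : R).
Proof.
have mnat : measurable_fun setT (fun c : bool => c%:R : R) by [].
by move=> mp; exact: (measurableT_comp mnat mp).
Qed.

(** As a sum of indicators, the rank is visibly measurable in x, and locally
    constant away from ties. *)
Lemma rank_natE (x : 'rV[R]_N) i :
  rank i x = (\sum_j ((x 0 j < x 0 i)%R + ((j <= i)%N && (x 0 j == x 0 i)%R)))%N.
Proof.
have cardE (p : pred 'I_N) : #|p| = (\sum_j p j)%N.
  by rewrite -sum1_card big_mkcond; apply: eq_bigr => j _; rewrite unfold_in; case: ifP.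
by rewrite big_split/= /rank !cardE.
Qed.

Lemma measurable_rank_coef (D : set S) (b : 'rV[R]_N) (X : S -> 'rV[R]_N) i :
  (forall j, measurable_fun D (fun s => X s 0 j)) ->
  measurable_fun D (fun s => b 0 (rank_ord i (X s))).
Proof.
move=> mX.
have mrank : measurable_fun D (fun s => (rank i (X s))%:R : R).
  under eq_fun do rewrite rank_natE natr_sum.
  apply: measurable_sum => j.
  under eq_fun do rewrite natrD.
  apply: measurable_funD; apply: measurable_fun_natmul_bool.
    exact: measurable_fun_ltr.
  by apply: measurable_and => //; exact: measurable_fun_eqr.
rewrite (_ : (fun s => _) = (fun s => \sum_(k < N) b 0 k *
    (((rank i (X s))%:R == k.+1%:R :> R)%:R))).
  apply: measurable_sum => k; apply: measurable_funM => //.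
  apply: measurable_fun_natmul_bool.
  by apply: measurable_fun_eqr => //; exact: measurable_cst.
apply/funext => s; rewrite (bigD1 (rank_ord i (X s)))//=.
have /andP[r0 _] := rank_bounds i (X s).
rewrite prednK// eqxx mulr1 big1 ?addr0// => k kr.
rewrite eqr_nat; case: eqP => [rk|_]; last by rewrite mulr0.
by case/eqP: kr; apply/val_inj; rewrite /= rk.
Qed.

End rank_measurability.

Section moduli.
Context {R : realType}.
Local Open Scope classical_set_scope.
Local Notation leb := (@lebesgue_measure R).
Implicit Types (x y f : R -> R) (K : R).

(** The regularity which x inherits from y by adding a drift bounded by K and
    applying the Skorokhod map, which at most doubles oscillations. It does not
    depend on the delay, so that it passes to the limit. *)
Definition controlled K y x : Prop := forall s t e : R, 0 <= s -> s <= t -> 0 <= e ->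
  (forall u, s <= u <= t -> `|y u - y s| <= e) ->
  `|x t - x s| <= 2 * (e + K * (t - s)).

Lemma controlled_continuous K y x : 0 <= K -> continuous y -> controlled K y x ->
  continuous (fun t : R => x (Num.max 0 t)).
Proof.
move=> K0 cy xy t; set tau := Num.max 0 t.
apply/cvgrPdist_le => e e0; rewrite -/tau.
have e8 : 0 < e / 8 by rewrite divr_gt0.
have /cvgrPdist_le/(_ _ e8)[d /= d0 dP] := cy tau.
pose d' := Num.min d (e / (4 * K + 1)).
have K1 : 0 < 4 * K + 1 by lra.
have d'0 : 0 < d' by rewrite lt_min d0 divr_gt0.
have key s r : 0 <= s -> s <= r -> `|tau - s| < d' -> `|tau - r| < d' ->
    (s = tau \/ r = tau) -> `|x r - x s| <= e.
  move=> s0 sr; rewrite !lt_min => /andP[sd sd'] /andP[rd rd'] srtau.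
  have yu u : s <= u <= r -> `|y u - y s| <= e / 4.
    move=> /andP[su ur].
    have ud : `|tau - u| < d.
      move: sd rd; rewrite !ltr_distl => /andP[? ?] /andP[? ?]; apply/andP; split; lra.
    have := dP _ ud; have := dP _ sd.
    rewrite !ler_distl => /andP[? ?] /andP[? ?]; apply/andP; split; lra.
  have e4 : 0 <= e / 4 by rewrite divr_ge0// ltW.
  apply: le_trans (xy s r (e / 4) s0 sr e4 yu) _.
  have rsd : r - s <= e / (4 * K + 1).
    move: sd' rd'; rewrite !ltr_distl => /andP[? ?] /andP[? ?].
    by case: srtau => ?; lra.
  have : (4 * K + 1) * (r - s) <= e by rewrite mulrC -ler_pdivlMr.
  have : 0 <= r - s by lra.
  nra.
exists d' => //= s sd.
have sd2 : `|tau - Num.max 0 s| < d'.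
  apply: le_lt_trans sd; rewrite /tau.
  have [t0|t0] := leP 0 t; have [s0|s0] := leP 0 s; rewrite ?ler_norm//.
  - rewrite subr0 ger0_norm// ger0_norm; lra.
  - rewrite sub0r normrN ger0_norm// ler0_norm; lra.
  - by rewrite subrr normr0.
have tt : `|tau - tau| < d' by rewrite subrr normr0.
have [st|/ltW st] := leP (Num.max 0 s) tau.
  by apply: key => //; [exact: maxr0_ge0|right].
by rewrite distrC; apply: key => //; [exact: maxr0_ge0|left].
Qed.

Lemma uniformly_continuous_segment y (T e : R) : continuous y -> 0 < e ->
  exists2 d, 0 < d & forall s t, 0 <= s -> s <= T -> `|t - s| < d -> `|y t - y s| <= e.
Proof.
move=> cy e0.
have := (compact_near_coveringP `[0, T]).1 (@segment_compact R 0 T).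
move=> /(_ R (0^'+) (fun d s => forall t, `|t - s| < d -> `|y t - y s| <= e) _).
case=> [s _|d /= d0 dP].
- have e2 : 0 < e / 2 by rewrite divr_gt0.
  have /cvgrPdist_le/(_ _ e2)[d /= d0 dP] := cy s.
  exists (ball s (d / 2), [set d' | d' < d / 2]) => /=.
    split; first by apply: nbhsx_ballx; rewrite divr_gt0.
    by apply: nbhs_right_lt; rewrite divr_gt0.
  move=> [s' d'] /= [ss' d'd] t ts'.
  have h1 : `|s - s'| < d by apply: lt_trans ss' _; rewrite ltr_pdivrMr//; lra.
  have h2 : `|s - t| < d.
    move: ss' ts'; rewrite /ball/= !ltr_distl => /andP[? ?] /andP[? ?].
    by apply/andP; split; lra.
  have := dP _ h1; have := dP _ h2; rewrite !ler_distl => /andP[? ?] /andP[? ?].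
  by apply/andP; split; lra.
exists (d / 2); first by rewrite divr_gt0.
move=> s t s0 sT std.
apply: (dP (d / 2)) => //=.
- by rewrite sub0r normrN gtr0_norm ?divr_gt0// ltr_pdivrMr//; lra.
- by rewrite divr_gt0.
- by rewrite in_itv/= s0.
Qed.

Lemma integral_lipschitz f K : measurable_fun setT f -> (forall u, `|f u| <= K) ->
  forall s t : R, s <= t ->
  `|\int[leb]_(u in `[0, t]) f u - \int[leb]_(u in `[0, s]) f u| <= K * (t - s).
Proof.
move=> mf fK.
have K0 : 0 <= K by apply: le_trans (fK 0); exact: normr_ge0.
have intf (D : set (measurableTypeR R)) : measurable D -> (leb D < +oo)%E ->
    leb.-integrable D (EFin \o f).
  move=> mD finD; apply: (integrable_ae_bounded mD finD (M := K)).
    exact: measurable_funTS.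
  by apply: aeW.
have absint (D : set (measurableTypeR R)) : measurable D -> (leb D < +oo)%E ->
    `|\int[leb]_(u in D) f u| <= K * fine (leb D).
  move=> mD finD; apply: le_trans (le_normr_Rintegral mD (intf D mD finD)) _.
  apply: Rintegral_ae_le => //; last by apply: aeW.
  apply: (integrable_ae_bounded mD finD (M := K)).
    by apply: measurableT_comp => //; exact: measurable_funTS.
  by apply: aeW => u _; rewrite normr_id.
have neg (r : R) : r < 0 -> \int[leb]_(u in `[0, r]) f u = 0.
  by move=> r0; rewrite set_itv_ge ?Rintegral_set0// bnd_simp -ltNge.
move=> s t st.
have [t0|t0] := ltP t 0.
  by rewrite !neg ?(le_lt_trans st)// subrr normr0 mulr_ge0// subr_ge0.
have [s0|s0] := ltP s 0.
  rewrite (neg s)// subr0; apply: le_trans (absint _ _ _) _ => //.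
    exact: leb_itv_cc_lty.
  rewrite lebesgue_measure_itv/= lte_fin; case: ifP => _ /=; last first.
    by rewrite mulr0 mulr_ge0// subr_ge0.
  by rewrite ler_wpM2l//; lra.
rewrite (Rintegral_increment s0 st (lexx t)); last first.
  by apply: intf; [exact: measurable_itv|exact: leb_itv_cc_lty].
apply: le_trans (absint _ _ _) _ => //; first exact: leb_itv_oc_lty.
rewrite lebesgue_measure_itv/= lte_fin; case: ifP => _ //=.
by rewrite mulr0 mulr_ge0// subr_ge0.
Qed.

Lemma lipschitz_continuous f K : 0 <= K ->
  (forall s t : R, s <= t -> `|f t - f s| <= K * (t - s)) -> continuous f.
Proof.
move=> K0 fK t; apply/cvgrPdist_le => e e0.
exists (e / (K + 1)) => /=; first by rewrite divr_gt0//; lra.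
move=> s sd.
have H : `|f t - f s| <= K * `|t - s|.
  have [st|/ltW st] := leP s t.
    by rewrite [X in _ <= _ * X]ger0_norm ?subr_ge0// fK.
  by rewrite distrC [X in _ <= _ * X]distrC [X in _ <= _ * X]ger0_norm ?subr_ge0// fK.
apply: (le_trans H).
have : `|t - s| * (K + 1) <= e by rewrite -ler_pdivlMr ?ltW//; lra.
have := normr_ge0 (t - s); nra.
Qed.

End moduli.

Section delay_scheme.
Context {R : realType} {N : nat}.
Local Open Scope classical_set_scope.
Local Notation leb := (@lebesgue_measure R).
Variables (b : 'rV[R]_N) (refl : bool).
Implicit Types (w x : R -> 'rV[R]_N) (h t : R).
Local Notation K := (coef_bound b).

Definition delay h (t : R) : R := Num.max 0 (t - h).

(** For h = 0 this is the drift term of the equations themselves, the delayed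
    time then being s for every s in [0, t]. *)
Definition delayed_drift x h i t : R :=
  \int[leb]_(s in `[0, t]) b 0 (rank_ord i (x (delay h s))).

Lemma delayed_driftE x h i t :
  \int[leb]_(s in `[0, t]) b 0 (rank_ord i (x (delay h s))) = delayed_drift x h i t.
Proof. by []. Qed.

Definition pushed (y : R -> R) (t : R) : R := y t + pushing refl y t.

Definition delay_step w h x : R -> 'rV[R]_N := fun t =>
  \row_i pushed (fun t => w t 0 i + delayed_drift x h i t) t.

Definition delay_iter w h n : R -> 'rV[R]_N :=
  iter n (delay_step w h) (fun=> w 0).

(** One step of the iteration reads its argument with a delay h, so the n-th
    iterate is final on [0, n h] and at time t it suffices to take the first
    n with t < n h. *)
Definition delay_solution w h : R -> 'rV[R]_N := fun t =>
  delay_iter w h (Num.truncn (t / h)).+1 t.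

Definition continuous_coords x : Prop :=
  forall i, continuous (fun t : R => x (Num.max 0 t) 0 i).

Lemma continuous_coords_measurable_coef x h i : continuous_coords x ->
  measurable_fun setT (fun s => b 0 (rank_ord i (x (delay h s)))).
Proof.
move=> cx; apply: (@measurable_rank_coef _ _ _ R) => j.
apply: continuous_measurable_fun => s.
apply: (@cvg_comp _ _ _ (fun s : R => s - h) (fun u => x (Num.max 0 u) 0 j)).
  by apply: cvgB; [exact: cvg_id|exact: cvg_cst].
exact: cx.
Qed.

Lemma delayed_drift_lipschitz x h i : continuous_coords x ->
  forall s t, s <= t -> `|delayed_drift x h i t - delayed_drift x h i s| <= K * (t - s).
Proof.
move=> cx; apply: integral_lipschitz; first exact: continuous_coords_measurable_coef.
by move=> u; exact: coef_le_bound.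
Qed.

Lemma delayed_drift0 x h i : delayed_drift x h i 0 = 0.
Proof. by rewrite /delayed_drift set_itv1 Rintegral_set1. Qed.

Section fixed_driver.
Variable w : R -> 'rV[R]_N.
Hypothesis cw : forall i, continuous (fun t => w t 0 i).
Hypothesis w0 : refl -> forall i, 0 <= w 0 0 i.

Lemma delayed_driver_continuous x h i : continuous_coords x ->
  continuous (fun t => w t 0 i + delayed_drift x h i t).
Proof.
move=> cx t; apply: cvgD; first exact: cw.
exact: (lipschitz_continuous (coef_bound_ge0 b) (delayed_drift_lipschitz h i cx)).
Qed.

Lemma delayed_driver0 x h i : refl -> 0 <= w 0 0 i + delayed_drift x h i 0.
Proof. by move=> r; rewrite delayed_drift0 addr0 w0. Qed.

(** Both the driver and the drift bound the oscillation of the unreflected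
    path, and the Skorokhod map adds at most as much again. *)
Lemma delay_step_controlled x h i : continuous_coords x ->
  controlled K (fun t => w t 0 i) (fun t => delay_step w h x t 0 i).
Proof.
move=> cx s t e s0 st e0 we; rewrite !mxE /pushed.
set y := fun t => _ + _.
have cy : continuous y := @delayed_driver_continuous x h i cx.
have K0 : 0 <= K := coef_bound_ge0 b.
have yu u : s <= u <= t -> `|y u - y s| <= e + K * (t - s).
  move=> /andP[su ut]; rewrite /y opprD addrACA.
  rewrite (le_trans (ler_normD _ _))// lerD//; first by apply: we; rewrite su.
  apply: (le_trans (delayed_drift_lipschitz h i cx su)).
  by rewrite ler_wpM2l// lerB.
have e'0 : 0 <= e + K * (t - s) by rewrite addr_ge0// mulr_ge0// subr_ge0.
have pm := pushing_modulus refl cy s0 st e'0 yu.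
have pmono := pushing_mono refl cy s0 st.
rewrite -/(y t) -/(y s).
have := yu t; rewrite st lexx => /(_ isT).
rewrite !ler_norml => /andP[? ?]; apply/andP; split; lra.
Qed.

Lemma delay_step_continuous x h : continuous_coords x ->
  continuous_coords (delay_step w h x).
Proof.
move=> cx i; apply: controlled_continuous (@delay_step_controlled x h i cx).
  exact: coef_bound_ge0.
exact: cw.
Qed.

Lemma delay_iter_continuous h n : continuous_coords (delay_iter w h n).
Proof.
elim: n => [|n IH]; last exact: delay_step_continuous.
by move=> i t; exact: cvg_cst.
Qed.

(** The value at t depends on the argument only up to time t - h; this makes
    the iteration stationary. *)
Lemma delay_step_local h x x' t : 0 < h ->
  (forall s, 0 <= s <= t -> x (delay h s) = x' (delay h s)) ->
  0 <= t -> delay_step w h x t = delay_step w h x' t.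
Proof.
move=> h0 xx' t0; apply/rowP => i; rewrite !mxE /pushed.
have yE s : 0 <= s <= t -> w s 0 i + delayed_drift x h i s =
    w s 0 i + delayed_drift x' h i s.
  move=> /andP[s0 st]; congr (_ + _); apply: eq_Rintegral => u.
  by rewrite inE/= in_itv/= => /andP[u0 us]; rewrite xx'// u0 (le_trans us).
by rewrite yE ?t0 ?lexx//; congr (_ + _); exact: pushing_local.
Qed.

Lemma delay_iter_stable h n t : 0 < h -> 0 <= t -> t <= n%:R * h ->
  delay_iter w h n.+1 t = delay_iter w h n t.
Proof.
move=> h0; elim: n t => [|n IH] t t0 tn.
  have -> : t = 0 by apply/eqP; rewrite eq_le t0 andbT -[0](mul0r h).
  apply/rowP => i; rewrite !mxE /pushed pushing0 ?delayed_drift0 ?addr0//.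
    by apply: delayed_driver_continuous => j u; exact: cvg_cst.
  by move=> r; rewrite w0.
apply: delay_step_local => // s /andP[s0 st].
apply: IH; first exact: maxr0_ge0.
rewrite /delay ge_max mulr_ge0 ?(ltW h0)//=.
by move: tn; rewrite -natr1 mulrDl mul1r => tn; lra.
Qed.

Lemma delay_iter_stableW h n m t : 0 < h -> 0 <= t -> t <= n%:R * h -> (n <= m)%N ->
  delay_iter w h m t = delay_iter w h n t.
Proof.
move=> h0 t0 tn; elim: m => [|m IH]; first by rewrite leqn0 => /eqP ->.
rewrite leq_eqVlt => /orP[/eqP ->//|]; rewrite ltnS => nm.
rewrite delay_iter_stable ?IH//; apply: (le_trans tn).
by rewrite ler_pM2r// ler_nat.
Qed.

Lemma delay_solutionE h n t : 0 < h -> 0 <= t -> t <= n%:R * h ->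
  delay_solution w h t = delay_iter w h n t.
Proof.
move=> h0 t0 tn; rewrite /delay_solution; set k := (Num.truncn _).+1.
have tk : t <= k%:R * h.
  rewrite -ler_pdivrMr// ltW//.
  by have /andP[] := truncn_itv (divr_ge0 t0 (ltW h0)).
rewrite -(delay_iter_stableW h0 t0 tk (leq_maxl k n)).
by rewrite -(delay_iter_stableW h0 t0 tn (leq_maxr k n)).
Qed.

Lemma delay_solution_fixpoint h t : 0 < h -> 0 <= t ->
  delay_solution w h t = delay_step w h (delay_solution w h) t.
Proof.
move=> h0 t0; pose k := (Num.truncn (t / h)).+1.
have tk : t <= k%:R * h.
  rewrite -ler_pdivrMr// ltW//.
  by have /andP[] := truncn_itv (divr_ge0 t0 (ltW h0)).
move: k tk => k tk.
rewrite (delay_solutionE h0 t0 tk) -(delay_iter_stable h0 t0 tk).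
apply: delay_step_local => // s /andP[s0 st].
apply/esym; apply: delay_solutionE => //; first exact: maxr0_ge0.
rewrite /delay ge_max mulr_ge0 ?(ltW h0)//=; lra.
Qed.

Lemma delay_solution_controlled h i : 0 < h ->
  controlled K (fun t => w t 0 i) (fun t => delay_solution w h t 0 i).
Proof.
move=> h0 s t e s0 st e0 we.
have t0 := le_trans s0 st.
pose k := (Num.truncn (t / h)).+1.
have tk : t <= k%:R * h.
  rewrite -ler_pdivrMr// ltW//.
  by have /andP[] := truncn_itv (divr_ge0 t0 (ltW h0)).
have tk1 : t <= k.+1%:R * h by apply: (le_trans tk); rewrite ler_pM2r// ler_nat.
rewrite (delay_solutionE h0 t0 tk1) (delay_solutionE h0 s0 (le_trans st tk1)).
exact: (@delay_step_controlled _ h i (@delay_iter_continuous h k)).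
Qed.

Lemma delay_solution_continuous h : 0 < h -> continuous_coords (delay_solution w h).
Proof.
move=> h0 i; apply: controlled_continuous (@delay_solution_controlled h i h0).
  exact: coef_bound_ge0.
exact: cw.
Qed.

Lemma delay_solution_ge0 h t i : refl -> 0 < h -> 0 <= t ->
  0 <= delay_solution w h t 0 i.
Proof.
move=> r h0 t0; rewrite delay_solution_fixpoint// mxE; apply: pushed_ge0 => //.
by apply: delayed_driver_continuous; exact: delay_solution_continuous.
Qed.

Definition delay_driver h i t : R := w t 0 i + delayed_drift (delay_solution w h) h i t.

Definition delay_push h t : 'rV[R]_N := \row_i pushing refl (delay_driver h i) t.

Lemma delay_solution_split h t i : 0 < h -> 0 <= t ->
  delay_solution w h t 0 i = w t 0 i + delayed_drift (delay_solution w h) h i t +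
    delay_push h t 0 i.
Proof. by move=> h0 t0; rewrite delay_solution_fixpoint// !mxE. Qed.

Lemma delay_driver_continuous h i : 0 < h -> continuous (delay_driver h i).
Proof.
by move=> h0; apply: delayed_driver_continuous; exact: delay_solution_continuous.
Qed.

Lemma delay_driver0 h i : refl -> 0 <= delay_driver h i 0.
Proof. exact: delayed_driver0. Qed.

Lemma delay_push_flat h i : 0 < h ->
  flat_off_zero (fun t => delay_solution w h t 0 i) (fun t => delay_push h t 0 i).
Proof.
move=> h0 s t s0 st xpos; rewrite !mxE.
apply: (@pushing_flat _ refl _ (delay_driver_continuous (i:=i) h0)) => // u sut.
have := xpos u sut; rewrite delay_solution_split//; first by rewrite mxE.
by case/andP: sut => su _; exact: le_trans su.
Qed.

Lemma delay_push_mono h i s t : 0 < h -> 0 <= s -> s <= t ->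
  delay_push h s 0 i <= delay_push h t 0 i.
Proof.
by move=> h0 s0 st; rewrite !mxE; apply: pushing_mono => //; exact: delay_driver_continuous.
Qed.

Lemma delay_push0 h i : 0 < h -> delay_push h 0 0 i = 0.
Proof.
move=> h0; rewrite mxE pushing0//; first exact: delay_driver_continuous.
exact: delay_driver0.
Qed.

Lemma delay_push_norefl h t i : ~~ refl -> delay_push h t 0 i = 0.
Proof. by move=> /negPf r; rewrite mxE /pushing r. Qed.

End fixed_driver.

(** What the passage to the limit needs to know about a solution of the
    scheme, independently of its construction. *)
Record delay_reflected w h x (l : R -> 'rV[R]_N) : Prop := DelayReflected {
  delay_reflected_controlled : forall i,
    controlled K (fun t => w t 0 i) (fun t => x t 0 i) ;
  delay_reflected_eq : forall t i, 0 <= t ->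
    x t 0 i = w t 0 i + delayed_drift x h i t + l t 0 i ;
  delay_reflected_ge0 : forall t i, refl -> 0 <= t -> 0 <= x t 0 i ;
  delay_reflected_start : forall i, l 0 0 i = 0 ;
  delay_reflected_mono : forall i s t, 0 <= s -> s <= t -> l s 0 i <= l t 0 i ;
  delay_reflected_flat : forall i,
    flat_off_zero (fun t => x t 0 i) (fun t => l t 0 i) ;
  delay_reflected_off : forall t i, ~~ refl -> 0 <= t -> l t 0 i = 0 }.

Lemma delay_solution_reflected w h :
  (forall i, continuous (fun t => w t 0 i)) -> (refl -> forall i, 0 <= w 0 0 i) ->
  0 < h -> delay_reflected w h (delay_solution w h) (delay_push w h).
Proof.
move=> cw w0 h0; split.
- by move=> i; exact: delay_solution_controlled.
- by move=> t i t0; exact: delay_solution_split.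
- by move=> t i r t0; exact: delay_solution_ge0.
- by move=> i; exact: delay_push0.
- by move=> i s t s0 st; exact: delay_push_mono.
- by move=> i; exact: delay_push_flat.
- by move=> t i r t0; exact: delay_push_norefl.
Qed.

(** While x i > x' i >= 0, complementarity keeps l i constant, whereas l' i is
    nondecreasing. Without reflection l i is 0. *)
Lemma repelling_flat (T : R) x x' (l l' : R -> 'rV[R]_N) :
  (forall t i, refl -> 0 <= t -> 0 <= x' t 0 i) ->
  (forall i, flat_off_zero (fun t => x t 0 i) (fun t => l t 0 i)) ->
  (forall t i, ~~ refl -> 0 <= t -> l t 0 i = 0) ->
  (forall i s t, 0 <= s -> s <= t -> l' s 0 i <= l' t 0 i) ->
  repelling T x x' l l'.
Proof.
move=> x'0 flat l0 mon i s t s0 st tT xx'.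
have -> : l t 0 i = l s 0 i.
  have [r|r] := boolP refl; last by rewrite !l0// (le_trans s0).
  apply: (flat i) => // u sut; apply: le_lt_trans (xx' u sut).
  by apply: x'0 => //; case/andP: sut => su _; exact: le_trans su.
by rewrite subrr subr_ge0 mon.
Qed.

End delay_scheme.

Section stability_on_paths.
Context {R : realType} {N : nat}.
Local Open Scope classical_set_scope.
Local Notation leb := (@lebesgue_measure R).
Variable b : 'rV[R]_N.
Hypothesis bd : forall i j : 'I_N, (i <= j)%N -> b 0 j <= b 0 i.
Implicit Types (x y l beta : R -> 'rV[R]_N) (T : R).

(** [stability] for paths which are continuous on the half-line only: extend
    them by their initial values. *)
Lemma stability_path T (eta : R) x x' y y' beta beta' l l' :
  0 <= T -> 0 <= eta -> continuous_coords x -> continuous_coords x' ->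
  (forall t i, 0 <= t <= T -> x t 0 i - x' t 0 i =
     \int[leb]_(u in `[0, t]) beta u 0 i - \int[leb]_(u in `[0, t]) beta' u 0 i
     + (l t 0 i - l' t 0 i)) ->
  (forall i, l 0 0 i = l' 0 0 i) ->
  drift_selection b y beta T -> drift_selection b y' beta' T ->
  (forall t i, 0 <= t <= T -> `|x t 0 i - y t 0 i| <= eta) ->
  (forall t i, 0 <= t <= T -> `|x' t 0 i - y' t 0 i| <= eta) ->
  repelling T x x' l l' -> repelling T x' x l' l ->
  \sum_i (x T 0 i - x' T 0 i) ^+ 2 <= 8 * N%:R * coef_bound b * eta * T.
Proof.
move=> T0 eta0 cx cx' zE l0 sel sel' xy xy' rep rep'.
have H (z : R -> 'rV[R]_N) (t : R) : 0 <= t -> z (Num.max 0 t) = z t by move=> t0; rewrite maxr0_id.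
have repW (z z' m m' : R -> 'rV[R]_N) : repelling T z z' m m' ->
    repelling T (fun t => z (Num.max 0 t)) (fun t => z' (Num.max 0 t)) m m'.
  move=> r i s t s0 st tT zz'; apply: r => // u sut.
  have u0 : 0 <= u by case/andP: sut => su _; exact: le_trans su.
  by have := zz' u sut; rewrite !H.
have := @stability R N b T eta (fun t => x (Num.max 0 t))
  (fun t => x' (Num.max 0 t)) y y' beta beta' l l' bd T0 eta0.
rewrite !H//; apply => //.
- by move=> i t; apply: cvgB; [exact: cx|exact: cx'].
- by move=> t i /andP[t0 tT]; rewrite !H// zE// t0.
- by move=> t i /andP[t0 tT]; rewrite !H// xy// t0.
- by move=> t i /andP[t0 tT]; rewrite !H// xy'// t0.
- exact: repW.
- exact: repW.
Qed.

End stability_on_paths.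

(** * The limit of the delay scheme *)

Section rank_convergence.
Context {R : realType} {N : nat}.
Local Open Scope classical_set_scope.

(** Away from ties all the comparisons of different coordinates are between
    distinct numbers, so they are eventually the same for u n as for x. *)
Lemma rank_ord_cvg (u : nat -> 'rV[R]_N) (x : 'rV[R]_N) i : no_ties x ->
  (forall j, u n 0 j @[n --> \oo] --> x 0 j) ->
  \forall n \near \oo, rank_ord i (u n) = rank_ord i x.
Proof.
move=> nt ux.
pose V j : set nat := [set n |
  ((u n 0 j < u n 0 i) = (x 0 j < x 0 i)) /\ ((u n 0 j == u n 0 i) = (x 0 j == x 0 i))].
have nV : \forall n \near \oo, forall j, V j n.
  apply: (@filter_forall _ _ V \oo _) => j.
  have [->|ji] := eqVneq j i.
    by apply: nearW => n; rewrite /V/= !ltxx !eqxx.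
  have ud : (u n 0 i - u n 0 j) @[n --> \oo] --> x 0 i - x 0 j by exact: cvgB.
  have xji := nt _ _ ji.
  have [xij|xij] := ltP (x 0 j) (x 0 i).
    have p : 0 < x 0 i - x 0 j by rewrite subr_gt0.
    apply: filterS (cvgr_gt _ ud _ p) => n.
    by rewrite subr_gt0 /V/= => un; rewrite xij un (negPf xji) lt_eqF.
  have {}xij : x 0 i < x 0 j by rewrite lt_neqAle eq_sym xji.
  have p : x 0 i - x 0 j < 0 by rewrite subr_lt0.
  apply: filterS (cvgr_lt _ ud _ p) => n.
  by rewrite subr_lt0 /V/= => un; rewrite !ltNge (ltW un) (ltW xij) (negPf xji) gt_eqF.
apply: filterS nV => n Vn; apply/val_inj => /=; congr _.-1.
by rewrite !rank_natE; apply: eq_bigr => j _; have [-> ->] := Vn j.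
Qed.

End rank_convergence.

Section delay_limit.
Context {R : realType} {N : nat}.
Local Open Scope classical_set_scope.
Local Notation leb := (@lebesgue_measure R).
Variables (b : 'rV[R]_N) (refl : bool).
Hypothesis bd : forall i j : 'I_N, (i <= j)%N -> b 0 j <= b 0 i.
Local Notation K := (coef_bound b).
Variables (w : R -> 'rV[R]_N) (h : nat -> R) (x l : nat -> R -> 'rV[R]_N).
Hypothesis cw : forall i, continuous (fun t => w t 0 i).
Hypothesis h_gt0 : forall n, 0 < h n.
Hypothesis cvg_h : h n @[n --> \oo] --> (0 : R).
Hypothesis xl : forall n, delay_reflected b refl w (h n) (x n) (l n).

Definition limit_path (t : R) : 'rV[R]_N := \row_i limn (fun n => x n t 0 i).

Let K0 : 0 <= K. Proof. exact: coef_bound_ge0. Qed.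

Let cx n : continuous_coords (x n).
Proof. move=> i; exact: (@controlled_continuous _ _ _ (fun t => x n t 0 i) K0 (@cw i)
  (@delay_reflected_controlled _ _ _ _ _ _ _ _ (xl n) i)). Qed.

(** The solutions of the schemes share a modulus of continuity, and the
    delays tend to 0. *)
Lemma delay_gap T (eta : R) : 0 < eta ->
  \forall n \near \oo, forall i t, 0 <= t <= T ->
    `|x n t 0 i - x n (delay (h n) t) 0 i| <= eta.
Proof.
move=> eta0; apply: (@filter_forall _ _ (fun i n => forall t, 0 <= t <= T ->
    `|x n t 0 i - x n (delay (h n) t) 0 i| <= eta) \oo _) => i.
have eta4 : 0 < eta / 4 by rewrite divr_gt0.
have [d d0 dP] := uniformly_continuous_segment T (cw (i:=i)) eta4.
have K1 : 0 < 4 * K + 1 by have := K0; lra.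
pose d' := Num.min d (eta / (4 * K + 1)).
have d'0 : 0 < d' by rewrite lt_min d0 divr_gt0.
apply: filterS (cvgr_lt _ cvg_h _ d'0) => n.
rewrite lt_min => /andP[nd nd'] t /andP[t0 tT].
have hn0 := h_gt0 n.
set s := delay (h n) t.
have s0 : 0 <= s by exact: maxr0_ge0.
have st : s <= t by rewrite /s /delay ge_max t0 gerBl ltW.
have tsh : t - s <= h n.
  have : t - h n <= s by rewrite /s /delay le_max lexx orbT.
  lra.
apply: le_trans (delay_reflected_controlled (xl n) s0 st (ltW eta4) _) _.
  move=> u /andP[su ut]; apply: dP => //; first exact: le_trans tT.
  rewrite ger0_norm ?subr_ge0//; lra.
have : h n * (4 * K + 1) < eta by rewrite -ltr_pdivlMr.
have : K * (t - s) <= K * h n by rewrite ler_wpM2l.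
lra.
Qed.

Lemma delay_selection n T :
  drift_selection b (fun s => x n (delay (h n) s))
    (fun s => rank_drift b (x n (delay (h n) s))) T.
Proof.
split; last by apply: aeW => u _; exact: rank_drift_set.
move=> i; apply: measurable_funTS.
under eq_fun do rewrite mxE.
exact: continuous_coords_measurable_coef.
Qed.

Lemma delay_reflected_gap n n' (t eta : R) : 0 <= t -> 0 <= eta ->
  (forall s i, 0 <= s <= t -> `|x n s 0 i - x n (delay (h n) s) 0 i| <= eta) ->
  (forall s i, 0 <= s <= t -> `|x n' s 0 i - x n' (delay (h n') s) 0 i| <= eta) ->
  \sum_i (x n t 0 i - x n' t 0 i) ^+ 2 <= 8 * N%:R * K * eta * t.
Proof.
move=> t0 eta0 gap gap'.
have driftE k s j : \int[leb]_(u in `[0, s]) rank_drift b (x k (delay (h k) u)) 0 j =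
    delayed_drift b (x k) (h k) j s.
  by rewrite -delayed_driftE; apply: eq_Rintegral => u _; rewrite mxE.
have rep k k' : repelling t (x k) (x k') (l k) (l k').
  apply: (@repelling_flat _ _ refl).
  - exact: delay_reflected_ge0 (xl k').
  - exact: delay_reflected_flat (xl k).
  - exact: delay_reflected_off (xl k).
  - exact: delay_reflected_mono (xl k').
have zE s i : 0 <= s <= t -> x n s 0 i - x n' s 0 i =
    \int[leb]_(u in `[0, s]) rank_drift b (x n (delay (h n) u)) 0 i
    - \int[leb]_(u in `[0, s]) rank_drift b (x n' (delay (h n') u)) 0 i
    + (l n s 0 i - l n' s 0 i).
  move=> /andP[s0 st]; rewrite !driftE.
  by rewrite !(delay_reflected_eq (xl _))//; ring.
have start i : l n 0 0 i = l n' 0 0 i by rewrite !(delay_reflected_start (xl _)).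
exact: (stability_path bd t0 eta0 (@cx n) (@cx n') zE start (delay_selection n t)
  (delay_selection n' t) gap gap' (rep n n') (rep n' n)).
Qed.

(** [stability] with eta the distance between the solutions and their delayed
    values, which is small by [delay_gap]. *)
Lemma delay_reflected_cauchy T (e : R) : 0 <= T -> 0 < e ->
  exists m, forall n n', (m <= n)%N -> (m <= n')%N -> forall i t, 0 <= t <= T ->
    `|x n t 0 i - x n' t 0 i| <= e.
Proof.
move=> T0 e0.
have c0 : 0 <= 8 * N%:R * K * T by rewrite !mulr_ge0.
pose eta := e ^+ 2 / (8 * N%:R * K * T + 1).
have eta0 : 0 < eta by rewrite divr_gt0 ?exprn_gt0//; lra.
have [m _ mP] := delay_gap T eta0.
exists m => n n' mn mn' i t /andP[t0 tT].
have gap k : (m <= k)%N -> forall s j, 0 <= s <= t ->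
    `|x k s 0 j - x k (delay (h k) s) 0 j| <= eta.
  by move=> mk s j /andP[s0 st]; apply: (mP k mk j); rewrite s0 (le_trans st tT).
have H := delay_reflected_gap t0 (ltW eta0) (gap n mn) (gap n' mn').
have H2 : (x n t 0 i - x n' t 0 i) ^+ 2 <= e ^+ 2.
  apply: (@le_trans _ _ (\sum_j (x n t 0 j - x n' t 0 j) ^+ 2)).
    by rewrite (bigD1 i)//= lerDl sumr_ge0// => j _; exact: sqr_ge0.
  apply: (le_trans H).
  apply: (@le_trans _ _ ((8 * N%:R * K * T) * eta)).
    rewrite [leRHS]mulrAC; apply: ler_wpM2l => //.
    by apply: mulr_ge0; [rewrite !mulr_ge0|exact: ltW].
  have etaE : eta * (8 * N%:R * K * T + 1) = e ^+ 2.
    by rewrite /eta divfK// gt_eqF//; lra.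
  have := eta0; lra.
by rewrite -(ger0_norm (ltW e0)) -ler_sqr ?nnegrE// !real_normK ?num_real.
Qed.

Lemma limit_path_cvg t i : 0 <= t -> x n t 0 i @[n --> \oo] --> limit_path t 0 i.
Proof.
move=> t0; rewrite mxE.
suff : cvgn (fun n => x n t 0 i) by [].
apply: cauchy_cvg; apply: cauchy_exP => e e0.
have e2 : 0 < e / 2 by rewrite divr_gt0.
have [m mP] := delay_reflected_cauchy t0 e2.
exists (x m t 0 i); exists m => // n mn; rewrite /ball/=.
apply: le_lt_trans (mP m n (leqnn m) mn i t _) _; first by rewrite t0 lexx.
by rewrite ltr_pdivrMr//; lra.
Qed.

Lemma limit_path_uniform T (e : R) : 0 <= T -> 0 < e ->
  exists m, forall n, (m <= n)%N -> forall (i : 'I_N) t, 0 <= t <= T ->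
    `|x n t 0 i - limit_path t 0 i| <= e.
Proof.
move=> T0 e0; have e2 : 0 < e / 2 by rewrite divr_gt0.
have [m mP] := delay_reflected_cauchy T0 e2.
exists m => n mn i t tT; have t0 : 0 <= t by case/andP: tT.
have /cvgrPdist_le/(_ _ e2)[k _ kP] := @limit_path_cvg t i t0.
have h1 : `|limit_path t 0 i - x (maxn m k) t 0 i| <= e / 2 := kP _ (leq_maxr m k).
have h2 := mP n (maxn m k) mn (leq_maxl m k) i t tT.
rewrite (le_trans (ler_distD (x (maxn m k) t 0 i) _ _))//.
by rewrite [X in _ + X]distrC; lra.
Qed.

Lemma limit_path_controlled i :
  controlled K (fun t => w t 0 i) (fun t => limit_path t 0 i).
Proof.
move=> s t e s0 st e0 we.
have t0 := le_trans s0 st.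
have lim_d : `|x n t 0 i - x n s 0 i| @[n --> \oo] -->
    `|limit_path t 0 i - limit_path s 0 i|.
  by apply: cvg_norm; apply: cvgB; exact: limit_path_cvg.
apply: (ler_cvg_to lim_d (cvg_cst _)); apply: nearW => n.
exact: (delay_reflected_controlled (xl n)).
Qed.

Lemma limit_path_continuous : continuous_coords limit_path.
Proof. move=> i; exact: (@controlled_continuous _ _ _ (fun t => limit_path t 0 i) K0 (@cw i)
  (@limit_path_controlled i)). Qed.

Lemma limit_path_ge0 t i : refl -> 0 <= t -> 0 <= limit_path t 0 i.
Proof.
move=> r t0; apply: (ler_cvg_to (cvg_cst _) (@limit_path_cvg t i t0)).
by apply: nearW => n; exact: (delay_reflected_ge0 (xl n)).
Qed.

(** The drift is at least - K and the reflection term is nondecreasing. This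
    passes to the limit before the limit drift is known, and it is all that
    [rough_path_no_ties] requires. *)
Lemma limit_path_growth i s t : 0 <= s -> s <= t ->
  limit_path s 0 i - w s 0 i + K * s <= limit_path t 0 i - w t 0 i + K * t.
Proof.
move=> s0 st; have t0 := le_trans s0 st.
have lim r : 0 <= r -> x n r 0 i - w r 0 i + K * r @[n --> \oo] -->
    limit_path r 0 i - w r 0 i + K * r.
  move=> r0; apply: cvgD; last exact: cvg_cst.
  by apply: cvgB; [exact: limit_path_cvg|exact: cvg_cst].
apply: (ler_cvg_to (lim s s0) (lim t t0)); apply: nearW => n.
rewrite (delay_reflected_eq (xl n) i s0) (delay_reflected_eq (xl n) i t0).
have := delay_reflected_mono (xl n) i s0 st.
have := delayed_drift_lipschitz b (h n) i (@cx n) st.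
rewrite ler_norml mulrBr => /andP[hn _] ln; lra.
Qed.

End delay_limit.

Section limit_drift.
Context {R : realType} {N : nat}.
Local Open Scope classical_set_scope.
Local Notation leb := (@lebesgue_measure R).
Variables (b : 'rV[R]_N) (refl : bool).
Hypothesis bd : forall i j : 'I_N, (i <= j)%N -> b 0 j <= b 0 i.
Local Notation K := (coef_bound b).
Variables (w : R -> 'rV[R]_N) (h : nat -> R) (x l : nat -> R -> 'rV[R]_N).
Hypothesis cw : forall i, continuous (fun t => w t 0 i).
Hypothesis h_gt0 : forall n, 0 < h n.
Hypothesis cvg_h : h n @[n --> \oo] --> (0 : R).
Hypothesis xl : forall n, delay_reflected b refl w (h n) (x n) (l n).
Local Notation xlim := (limit_path x).
Hypothesis nt : {ae leb, forall s : R, 0 <= s -> no_ties (xlim s)}.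

Let cx n : continuous_coords (x n).
Proof.
move=> i; exact: (@controlled_continuous _ _ _ (fun t => x n t 0 i)
  (coef_bound_ge0 b) (@cw i)
  (@delay_reflected_controlled _ _ _ _ _ _ _ _ (xl n) i)).
Qed.

Let cxlim : continuous_coords xlim.
Proof. exact: (@limit_path_continuous _ _ b refl bd w h x l cw h_gt0 cvg_h xl). Qed.

Let xlim_cvg t i : 0 <= t -> x n t 0 i @[n --> \oo] --> xlim t 0 i.
Proof. exact: (@limit_path_cvg _ _ b refl bd w h x l cw h_gt0 cvg_h xl). Qed.

Lemma delayed_limit_path_cvg s j : 0 <= s ->
  x n (delay (h n) s) 0 j @[n --> \oo] --> xlim s 0 j.
Proof.
move=> s0; apply/cvgrPdist_le => e e0.
have e2 : 0 < e / 2 by rewrite divr_gt0.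
have gap := @delay_gap _ _ b refl w h x l cw h_gt0 cvg_h xl s _ e2.
have /cvgrPdist_le/(_ _ e2) lim := @xlim_cvg s j s0.
apply: filterS2 gap lim => n gap lim.
have := gap j s; rewrite s0 lexx => /(_ isT) g.
rewrite (le_trans (ler_distD (x n s 0 j) _ _))//; lra.
Qed.

(** Dominated convergence: at every time without ties the delayed ranks are
    eventually those of the limit. *)
Lemma delayed_drift_cvg i t : 0 <= t ->
  delayed_drift b (x n) (h n) i t @[n --> \oo] --> delayed_drift b xlim 0 i t.
Proof.
move=> t0; pose D : set (measurableTypeR R) := `[0, t].
have mD : measurable D by exact: measurable_itv.
have finD : (leb D < +oo)%E by exact: leb_itv_cc_lty.
pose f_ n (s : measurableTypeR R) := (b 0 (rank_ord i (x n (delay (h n) s))))%:E.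
pose f (s : measurableTypeR R) := (b 0 (rank_ord i (xlim (delay 0 s))))%:E.
have mf_ n : measurable_fun D (f_ n).
  apply/measurable_EFinP; apply: measurable_funTS.
  exact: (continuous_coords_measurable_coef b (h n) i (@cx n)).
have mf : measurable_fun D f.
  apply/measurable_EFinP; apply: measurable_funTS.
  exact: (continuous_coords_measurable_coef b 0 i cxlim).
have cvgf : {ae leb, forall s, D s -> f_ ^~ s @ \oo --> f s}.
  apply: ae_imply nt => s nts; rewrite /D/= in_itv/= => /andP[s0 _].
  apply: cvg_near_cst; rewrite /f_ /f /delay subr0 maxr0_id//.
  have := @rank_ord_cvg _ _ (fun n => x n (delay (h n) s)) (xlim s) i (nts s0)
    (fun j => @delayed_limit_path_cvg s j s0).
  by apply: filterS => n; rewrite /delay => ->.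
have ig : leb.-integrable D (EFin \o cst K).
  apply: (integrable_ae_bounded mD finD (M := K)) => //.
  by apply: aeW => u _; rewrite ger0_norm// coef_bound_ge0.
have fK : {ae leb, forall s n, D s -> (`|f_ n s| <= (EFin \o cst K) s)%E}.
  by apply: aeW => s n _; rewrite /f_ /= lee_fin coef_le_bound.
have [intf _ lim] := @dominated_convergence _ _ _ leb D mD f_ f _ mf_ mf cvgf ig fK.
have fin : (\int[leb]_(s in D) f s)%E \is a fin_num by exact: integrable_fin_num.
rewrite -(fineK fin) in lim.
exact: (fine_cvg lim).
Qed.

(** The reflection term is defined by the equation which it has to satisfy; it
    is then identified as the limit of those of the schemes. *)
Definition limit_push (t : R) : 'rV[R]_N :=
  \row_i (xlim t 0 i - w t 0 i - delayed_drift b xlim 0 i t).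

Lemma limit_push_cvg t i : 0 <= t -> l n t 0 i @[n --> \oo] --> limit_push t 0 i.
Proof.
move=> t0; rewrite mxE.
have -> : (fun n => l n t 0 i) =
    (fun n => x n t 0 i - w t 0 i - delayed_drift b (x n) (h n) i t).
  by apply/funext => n; rewrite (delay_reflected_eq (xl n) i t0); ring.
apply: cvgB; last exact: delayed_drift_cvg.
by apply: cvgB; [exact: xlim_cvg|exact: cvg_cst].
Qed.

Lemma limit_push_mono i s t : 0 <= s -> s <= t ->
  limit_push s 0 i <= limit_push t 0 i.
Proof.
move=> s0 st; have t0 := le_trans s0 st.
apply: (ler_cvg_to (@limit_push_cvg s i s0) (@limit_push_cvg t i t0)).
by apply: nearW => n; exact: (delay_reflected_mono (xl n)).
Qed.

Lemma limit_push_cst t i c : 0 <= t -> (exists m, forall n, (m <= n)%N -> l n t 0 i = c n) ->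
  c n @[n --> \oo] --> limit_push t 0 i.
Proof.
move=> t0 [m mP]; apply: cvg_trans (@limit_push_cvg t i t0).
by apply: near_eq_cvg; exists m => // n /= mn; rewrite mP.
Qed.

Lemma limit_push0 i : limit_push 0 0 i = 0.
Proof.
have := @limit_push_cst 0 i (cst 0) (lexx 0).
have ex : exists m, forall n, (m <= n)%N -> l n 0 0 i = cst 0 n.
  by exists 0%N => n _; rewrite (delay_reflected_start (xl n)).
move=> /(_ ex) H; rewrite -(cvg_lim _ H)//; apply/cvg_lim => //; exact: cvg_cst.
Qed.

Lemma limit_push_off t i : ~~ refl -> 0 <= t -> limit_push t 0 i = 0.
Proof.
move=> r t0; have := @limit_push_cst t i (cst 0) t0.
have ex : exists m, forall n, (m <= n)%N -> l n t 0 i = cst 0 n.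
  by exists 0%N => n _; rewrite (delay_reflected_off (xl n)).
move=> /(_ ex) H; rewrite -(cvg_lim _ H)//; apply/cvg_lim => //; exact: cvg_cst.
Qed.

(** On [s, t] the limit stays above a positive constant, so do the solutions
    of the schemes by uniform convergence, and their reflection terms are
    constant there. *)
Lemma limit_push_flat i :
  flat_off_zero (fun t => xlim t 0 i) (fun t => limit_push t 0 i).
Proof.
move=> s t s0 st xpos; have t0 := le_trans s0 st.
have [c cst cmin] := @EVT_min R (fun t => xlim (Num.max 0 t) 0 i) s t st
  (continuous_subspaceT (cxlim (i:=i))).
move: cst; rewrite in_itv/= => /andP[sc ct].
pose e := xlim (Num.max 0 c) 0 i.
have e0 : 0 < e by rewrite /e maxr0_id ?(le_trans s0)//; apply: xpos; rewrite sc.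
have e2 : 0 < e / 2 by rewrite divr_gt0.
have [m mP] := @limit_path_uniform _ _ b refl bd w h x l cw h_gt0 cvg_h xl t _ t0 e2.
have lE n : (m <= n)%N -> l n t 0 i = l n s 0 i.
  move=> mn; apply: (delay_reflected_flat (xl n)) => // u /andP[su ut].
  have u0 := le_trans s0 su.
  have := cmin u; rewrite in_itv/= su ut => /(_ isT); rewrite (maxr0_id u0) -/e => eu.
  have := mP n mn i u; rewrite u0 ut => /(_ isT).
  rewrite ler_distl => /andP[? _]; lra.
have H : l n s 0 i @[n --> \oo] --> limit_push t 0 i.
  by apply: limit_push_cst => //; exists m => n mn; exact: lE.
by rewrite -(cvg_lim _ H)//; apply/cvg_lim => //; exact: limit_push_cvg.
Qed.

Lemma limit_push_continuous : continuous_coords limit_push.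
Proof.
move=> i t; rewrite /continuous_at mxE.
under eq_fun do rewrite mxE.
apply: cvgB; first apply: cvgB.
- exact: cxlim.
- apply: (@cvg_comp _ _ _ (Num.max 0) (fun t : R => w t 0 i)); last exact: cw.
  exact: continuous_maxr0.
apply: (@cvg_comp _ _ _ (Num.max 0) (fun t : R => delayed_drift b xlim 0 i t)).
  exact: continuous_maxr0.
exact: (lipschitz_continuous (coef_bound_ge0 b) (delayed_drift_lipschitz b 0 i cxlim)).
Qed.

End limit_drift.

Section ties.
Context {R : realType} {N : nat}.
Local Open Scope classical_set_scope.
Local Notation leb := (@lebesgue_measure R).
Variable sigma : 'rV[R]_N.

(** Integer horizons suffice, and keep the conditions countable in number. *)
Definition rough_path (w : R -> 'rV[R]_N) : Prop := forall (i j : 'I_N) (n : nat), i != j ->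
  rough (fun t => sigma 0 i * w (Num.max 0 t) 0 i - sigma 0 j * w (Num.max 0 t) 0 j) n%:R.

(** The linear term - C t is common to all coordinates and cancels in
    differences: x i - x j is rough up to a difference of nondecreasing
    functions, and [rough_zero_set] applies to each of the countably many pairs
    of indices and horizons. *)
Lemma rough_path_no_ties (w x : R -> 'rV[R]_N) (A : 'I_N -> R -> R) (C : R) :
  rough_path w -> continuous_coords w -> continuous_coords x ->
  (forall k s t, 0 <= s -> s <= t -> A k s <= A k t) ->
  (forall k t, 0 <= t -> x t 0 k = sigma 0 k * w t 0 k + A k t - C * t) ->
  {ae leb, forall s : R, 0 <= s -> no_ties (x s)}.
Proof.
move=> rw cw cx Amon xE.
pose V (n : nat) : set R := if @unpickle ('I_N * 'I_N * nat)%type n is Some (i, j, k) then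
  if i != j then [set t | `[0%R, k%:R] t /\ x (Num.max 0 t) 0 i - x (Num.max 0 t) 0 j = 0]
  else set0 else set0.
have V0 n : leb.-negligible (V n).
  rewrite /V; case: unpickle => [[[i j] k]|]; last exact: negligible_set0.
  case: ifPn => [ij|_]; last exact: negligible_set0.
  have cv q : continuous (fun t : R => sigma 0 q * w (Num.max 0 t) 0 q).
    by move=> t; apply: cvgM; [exact: cvg_cst|exact: cw].
  have Am q s t : 0 <= s -> s <= t -> A q (Num.max 0 s) <= A q (Num.max 0 t).
    by move=> s0 st; rewrite !maxr0_id ?(le_trans s0)//; exact: Amon.
  have E t : sigma 0 i * w (Num.max 0 t) 0 i - sigma 0 j * w (Num.max 0 t) 0 j +
      (A i (Num.max 0 t) - A j (Num.max 0 t)) =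
      x (Num.max 0 t) 0 i - x (Num.max 0 t) 0 j.
    by rewrite !xE ?maxr0_ge0//; ring.
  have cy : continuous (fun t : R => sigma 0 i * w (Num.max 0 t) 0 i -
      sigma 0 j * w (Num.max 0 t) 0 j + (A i (Num.max 0 t) - A j (Num.max 0 t))).
    by under eq_fun do rewrite E; move=> t; apply: cvgB; exact: cx.
  have zero := @rough_zero_set _ _ _ _ _ (rw i j k ij) (Am i) (Am j)
    (fun t => cvgB (cv i t) (cv j t)) cy.
  have setE : [set t | `[0%R, k%:R] t /\ x (Num.max 0 t) 0 i - x (Num.max 0 t) 0 j = 0] =
    [set t | `[0%R, k%:R] t /\ sigma 0 i * w (Num.max 0 t) 0 i -
      sigma 0 j * w (Num.max 0 t) 0 j + (A i (Num.max 0 t) - A j (Num.max 0 t)) = 0].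
    by apply/seteqP; split => t /=; rewrite E.
  have mZ : measurable ([set t | `[0%R, k%:R] t /\
      x (Num.max 0 t) 0 i - x (Num.max 0 t) 0 j = 0] : set (measurableTypeR R)).
    apply: closed_measurable; apply: closedI; first exact: itv_closed.
    apply: (@closed_comp _ _ (fun t : R => x (Num.max 0 t) 0 i - x (Num.max 0 t) 0 j) [set 0]).
      by move=> t _; apply: cvgB; exact: cx.
    exact: closed_eq.
  by eexists; split; [exact: mZ|rewrite setE; exact: zero|].
have negV : leb.-negligible (\bigcup_n V n) by exact: (negligible_bigcup V0).
apply: negligibleS negV => s /= Hs; apply: contrapT => nV.
apply: Hs => s0 i j ij; apply/eqP => xij; apply: nV.
exists (pickle (i, j, (Num.truncn s).+1)); first exact: I.
rewrite /V pickleK ij /= in_itv/= s0 !(maxr0_id s0) xij subrr; split=> //.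
by have /andP[_ /ltW] := truncn_itv s0.
Qed.

End ties.

(** * Adaptedness of the delay scheme *)

Section measurable_functionals.
Context {R : realType} {d : measure_display} {S : measurableType d}.
Local Open Scope classical_set_scope.
Local Notation leb := (@lebesgue_measure R).

(** Adding K makes the integrand nonnegative, so that Tonelli applies. *)
Lemma measurable_time_integral (f : R * S -> R) (K t : R) :
  measurable_fun setT f -> (forall p, `|f p| <= K) ->
  measurable_fun setT (fun w => \int[leb]_(s in `[0, t]) f (s, w)).
Proof.
move=> mf fK; pose D : set (measurableTypeR R) := `[0, t].
have mD : measurable D by exact: measurable_itv.
have finD : (leb D < +oo)%E by exact: leb_itv_cc_lty.
have mf' : measurable_fun setT (f : measurableTypeR R * S -> R) by exact: mf.
pose phi (p : measurableTypeR R * S) := ((f p + K) * \1_D p.1)%:E.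
have phi0 p : (0 <= phi p)%E.
  rewrite lee_fin mulr_ge0//; have := fK p; rewrite ler_norml => /andP[]; lra.
have mphi : measurable_fun setT phi.
  apply/measurable_EFinP; apply: measurable_funM; first exact: measurable_funD.
  have m1 : measurable_fun setT (\1_D : measurableTypeR R -> R) by exact: measurable_indic.
  exact: (measurableT_comp m1 measurable_fst).
have mG : measurable_fun setT (fun w => (\int[leb]_s phi (s, w))%E).
  exact: (measurable_fun_fubini_tonelli_G (m1 := leb) phi mphi phi0).
have mfine : measurable_fun setT (fun w => fine (\int[leb]_s phi (s, w))%E - K * fine (leb D)).
  by apply: measurable_funB => //; apply: measurableT_comp.
apply: (eq_measurable_fun _ _ mfine) => w _.
have -> : (\int[leb]_s phi (s, w))%E = (\int[leb]_(s in D) (f (s, w) + K)%:E)%E.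
  rewrite [RHS]integral_mkcond; apply: eq_integral => s _.
  rewrite /phi patchE indicE; case: ifPn => /= _; first by rewrite mulr1.
  by rewrite mulr0.
have mfw : measurable_fun D (fun s => f (s, w)).
  by apply: measurable_funTS; exact: (measurableT_comp mf' (pair2_measurable w)).
have intf : leb.-integrable D (EFin \o (fun s => f (s, w))).
  by apply: (integrable_ae_bounded mD finD (M := K)) => //; apply: aeW.
have intK : leb.-integrable D (EFin \o cst K).
  by apply: (integrable_ae_bounded mD finD (M := `|K|)) => //; apply: aeW => u _ /=.
have := RintegralD mD intf intK; rewrite (Rintegral_cst leb mD) /Rintegral => ->.
by rewrite addrK.
Qed.

(** By continuity the supremum over [0, t] is one over the countably many
    rational times, clipped to [0, t]. *)
Lemma measurable_pushing (refl : bool) (y : R -> S -> R) (t : R) : 0 <= t ->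
  (forall w, continuous (y ^~ w)) ->
  (forall s, 0 <= s -> s <= t -> measurable_fun setT (y s)) ->
  measurable_fun setT (fun w => pushing refl (y ^~ w) t).
Proof.
move=> t0 cy my; case: refl; last by rewrite /pushing; exact: measurable_cst.
pose u (k : nat) : R := Num.min (Num.max 0 (ratr (odflt 0 (unpickle k)))) t.
have u0 k : 0 <= u k by rewrite le_min maxr0_ge0.
have ut k : u k <= t by rewrite ge_min lexx orbT.
pose g k w := Num.max 0 (- y (u k) w).
have gle w k : g k w <= pushing true (y ^~ w) t.
  by have [s [_ _ _ H]] := pushing_attained (cy w) t0 isT; exact: H.
have ub w : has_ubound (range (g ^~ w)).
  by exists (pushing true (y ^~ w) t) => _ [k _ <-]; exact: gle.
have msup : measurable_fun setT (fun w => sups (g ^~ w) 0).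
  apply: measurable_fun_sups => // k.
  apply: measurable_maxr => //.
  by apply: measurableT_comp => //; exact: my.
apply: (eq_measurable_fun _ _ msup) => w _.
apply/eqP; rewrite eq_le; apply/andP; split.
  apply: ge_sup; first by exists (g 0%N w); exists 0%N.
  by move=> _ [k _ <-]; exact: gle.
have [s [s0 st -> _]] := pushing_attained (cy w) t0 isT.
rewrite leNgt; apply/negP => lt_sup.
have cg : continuous (fun s : R => Num.max 0 (- y s w)).
  move=> z; apply: (@continuous_max _ _ (cst 0) (fun s => - y s w) z).
    exact: cvg_cst.
  by apply: cvgN; exact: cy.
have /= [e /= e0 eP] := cvgr_gt _ (cg s) _ lt_sup.
have [q] := @rat_in_itvoo R (s - e) (s + e) ltac:(by rewrite ltrD2l; lra).
rewrite in_itv/= => /andP[q1 q2].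
have uk : u (pickle q) = Num.min (Num.max 0 (ratr q)) t by rewrite /u pickleK.
have su : `|s - u (pickle q)| < e.
  rewrite ltr_distlC uk; apply/andP; split.
    by rewrite lt_min lt_max q1 orbT/=; lra.
  by rewrite gt_min gt_max q2 andbT; apply/orP; left; lra.
have := eP _ su; rewrite ltNge; apply/negP; rewrite negbK.
apply: ub_le_sup; first exact: has_ubound_sdrop.
by exists (pickle q).
Qed.

End measurable_functionals.

Section adaptedness.
Context {R : realType} {d : measure_display} {Om : measurableType d}.
Context (P : probability Om R) (F : R -> set_system Om) {N : nat}.
Hypothesis basis : usual_basis P F.
Local Open Scope classical_set_scope.
Local Notation leb := (@lebesgue_measure R).
Implicit Types (X Y W : R -> Om -> 'rV[R]_N).

Lemma filtration_measurable_le (s t : R) (f : Om -> R) : 0 <= s -> s <= t ->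
  measurable_fun [set: g_sigma_algebraType (F s)] (f : g_sigma_algebraType (F s) -> R) ->
  measurable_fun [set: g_sigma_algebraType (F t)] (f : g_sigma_algebraType (F t) -> R).
Proof.
move=> s0 st mf _ A mA; have mfA : <<s F s>> (setT `&` f @^-1` A) := mf measurableT A mA.
have : <<s F t>> (setT `&` f @^-1` A); last by [].
have t0 := le_trans s0 st.
rewrite (sigma_algebra_id (filtration_sigma_algebra basis t0)).
rewrite (sigma_algebra_id (filtration_sigma_algebra basis s0)) in mfA.
exact: (filtration_nondecreasing basis s0 st).
Qed.

Definition continuous_process X : Prop := forall w, continuous_coords (X ^~ w).

(** Stopping the time at t makes all the values of the process measurable at
    time t, and then [joint_measurable] applies. *)
Lemma joint_adapted X t j : 0 <= t -> adapted F X -> continuous_process X ->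
  measurable_fun [set: R * g_sigma_algebraType (F t)]
    (fun p => X (Num.min (Num.max 0 p.1) t) p.2 0 j).
Proof.
move=> t0 aX cX.
apply: (@joint_measurable R _ (g_sigma_algebraType (F t))
  (fun s w => X (Num.min s t) w 0 j)).
  move=> w s.
  have -> : (fun s : R => X (Num.min (Num.max 0 s) t) w 0 j) =
      (fun s : R => X (Num.max 0 (Num.min (Num.max 0 s) t)) w 0 j).
    by apply/funext => z; rewrite [Num.max 0 (Num.min _ _)]maxr0_id// le_min maxr0_ge0.
  have cm : continuous (fun s : R => Num.min (Num.max 0 s) t).
    move=> z; apply: (@continuous_min _ _ (fun s : R => Num.max 0 s) (fun _ : R => t) z).
      exact: continuous_maxr0.
    exact: cvg_cst.
  exact: (@cvg_comp _ _ _ _ (fun s : R => X (Num.max 0 s) w 0 j) _ _ _ (cm s) (@cX w j _)).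
move=> s s0; apply: (@filtration_measurable_le (Num.min s t)).
- by rewrite le_min s0.
- by rewrite ge_min lexx orbT.
- by apply: aX; rewrite le_min s0.
Qed.

Variable b : 'rV[R]_N.

Lemma adapted_delayed_drift X h t i : 0 <= h -> 0 <= t -> adapted F X ->
  continuous_process X ->
  measurable_fun [set: g_sigma_algebraType (F t)]
    (fun w : g_sigma_algebraType (F t) => delayed_drift b (X ^~ w) h i t).
Proof.
move=> h0 t0 aX cX.
pose f (p : R * g_sigma_algebraType (F t)) : R :=
  b 0 (rank_ord i (X (Num.min (delay h p.1) t) p.2)).
have mf : measurable_fun setT f.
  apply: measurable_rank_coef => j.
  have mshift : measurable_fun setT
      (fun p : R * g_sigma_algebraType (F t) => (p.1 - h, p.2)).
    apply: measurable_fun_pair; last exact: measurable_snd.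
    by apply: measurable_funB => //; exact: measurable_fst.
  exact: (measurableT_comp (joint_adapted j t0 aX cX) mshift).
have := @measurable_time_integral _ _ _ f (coef_bound b) t mf
  (fun p => coef_le_bound _ _).
apply: eq_measurable_fun => w _; apply: eq_Rintegral => s.
rewrite inE/= in_itv/= => /andP[s0 st]; rewrite /f /= (min_idPl _)//.
by rewrite /delay ge_max t0/=; lra.
Qed.

Lemma progressive_rank_drift X : adapted F X -> continuous_process X ->
  progressively_measurable F (fun s w => rank_drift b (X s w)).
Proof.
move=> aX cX t i t0.
have mf : measurable_fun [set: R * g_sigma_algebraType (F t)]
    (fun p => b 0 (rank_ord i (X (Num.min (Num.max 0 p.1) t) p.2))).
  by apply: measurable_rank_coef => j; exact: joint_adapted.
apply: (eq_measurable_fun _ _ (measurable_funTS mf)) => -[s w].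
rewrite inE/= in_itv/= => -[/andP[s0 st] _].
by rewrite mxE maxr0_id// (min_idPl _).
Qed.

Variable refl : bool.

Lemma adapted_delay_step W X h : 0 <= h -> adapted F W -> adapted F X ->
  (forall w i, continuous (fun t => W t w 0 i)) -> continuous_process X ->
  adapted F (fun t w => delay_step b refl (W ^~ w) h (X ^~ w) t).
Proof.
move=> h0 aW aX cW cX t t0 i.
under eq_fun do rewrite mxE /pushed.
have my s : 0 <= s -> s <= t -> measurable_fun [set: g_sigma_algebraType (F t)]
    (fun w : g_sigma_algebraType (F t) => W s w 0 i + delayed_drift b (X ^~ w) h i s).
  move=> s0 st; apply: (@filtration_measurable_le s) => //.
  by apply: measurable_funD; [exact: aW|exact: adapted_delayed_drift].
apply: measurable_funD; first exact: my.
apply: (@measurable_pushing _ _ (g_sigma_algebraType (F t)) refl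
  (fun s w => W s w 0 i + delayed_drift b (X ^~ w) h i s)) => // w.
by apply: delayed_driver_continuous => //; exact: cX.
Qed.

Section driver.
Variable W : R -> Om -> 'rV[R]_N.
Hypothesis aW : adapted F W.
Hypothesis cW : forall w i, continuous (fun t => W t w 0 i).

Lemma adapted_delay_iter h n : 0 <= h ->
  adapted F (fun t w => delay_iter b refl (W ^~ w) h n t).
Proof.
move=> h0; elim: n => [|n IH] t t0 i.
  by apply: (@filtration_measurable_le 0) => //; exact: aW.
apply: (adapted_delay_step h0 aW IH cW) => // w.
exact: (@delay_iter_continuous _ _ b refl (W ^~ w) (@cW w) h n).
Qed.

Lemma adapted_delay_solution h : 0 <= h ->
  adapted F (fun t w => delay_solution b refl (W ^~ w) h t).
Proof. by move=> h0 t t0; exact: adapted_delay_iter. Qed.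

End driver.
End adaptedness.

(** * Uniqueness for the inclusions *)

Section inclusion_paths.
Context {R : realType} {N : nat}.
Local Open Scope classical_set_scope.
Local Notation leb := (@lebesgue_measure R).
Variables (b m sigma : 'rV[R]_N) (refl : bool).
Hypothesis bd : forall i j : 'I_N, (i <= j)%N -> b 0 j <= b 0 i.
Local Notation K := (coef_bound b).
Implicit Types (w beta x l : R -> 'rV[R]_N).

(** A common form of the two inclusions for fixed omega, in which the integral
    condition on l is replaced by flatness; without reflection, l = 0. *)
Record inclusion_path (x0 : 'rV[R]_N) w beta x l : Prop := InclusionPath {
  inclusion_path_continuous : continuous_coords x ;
  inclusion_path_selection : forall T, drift_selection b x beta T ;
  inclusion_path_eq : forall t i, 0 <= t -> x t 0 i =
    x0 0 i + sigma 0 i * w t 0 i + m 0 i * t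
    + \int[leb]_(s in `[0, t]) beta s 0 i + l t 0 i ;
  inclusion_path_ge0 : forall t i, refl -> 0 <= t -> 0 <= x t 0 i ;
  inclusion_path_start : forall i, l 0 0 i = 0 ;
  inclusion_path_mono : forall i s t, 0 <= s -> s <= t -> l s 0 i <= l t 0 i ;
  inclusion_path_flat : forall i, flat_off_zero (fun t => x t 0 i) (fun t => l t 0 i) ;
  inclusion_path_off : forall t i, ~~ refl -> 0 <= t -> l t 0 i = 0 }.

(** [stability_path] with eta = 0, the drifts being evaluated at the solutions. *)
Lemma inclusion_path_unique (x0 : 'rV[R]_N) w beta beta' x x' l l' :
  inclusion_path x0 w beta x l -> inclusion_path x0 w beta' x' l' ->
  forall t, 0 <= t -> x t = x' t.
Proof.
move=> sol sol' t t0.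
have rep y y' g g' k k' : inclusion_path x0 w g y k -> inclusion_path x0 w g' y' k' ->
    repelling t y y' k k'.
  move=> s s'; apply: (@repelling_flat _ _ refl).
  - exact: inclusion_path_ge0 s'.
  - exact: inclusion_path_flat s.
  - exact: inclusion_path_off s.
  - exact: inclusion_path_mono s'.
have zE s i : 0 <= s <= t -> x s 0 i - x' s 0 i =
    \int[leb]_(u in `[0, s]) beta u 0 i - \int[leb]_(u in `[0, s]) beta' u 0 i
    + (l s 0 i - l' s 0 i).
  move=> /andP[s0 _].
  by rewrite (inclusion_path_eq sol i s0) (inclusion_path_eq sol' i s0); ring.
have start i : l 0 0 i = l' 0 0 i.
  by rewrite (inclusion_path_start sol) (inclusion_path_start sol').
have self (y : R -> 'rV[R]_N) s i : 0 <= s <= t -> `|y s 0 i - y s 0 i| <= 0.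
  by rewrite subrr normr0.
have := stability_path bd t0 (lexx 0) (inclusion_path_continuous sol)
  (inclusion_path_continuous sol') zE start (inclusion_path_selection sol t)
  (inclusion_path_selection sol' t) (self x) (self x') (rep _ _ _ _ _ _ sol sol')
  (rep _ _ _ _ _ _ sol' sol).
rewrite mulr0 mul0r => z0; apply/rowP => i; apply/eqP; rewrite -subr_eq0.
rewrite -sqrf_eq0 eq_le sqr_ge0 andbT; apply: le_trans z0.
by rewrite (bigD1 i)//= lerDl sumr_ge0// => j _; exact: sqr_ge0.
Qed.

(** The drift and the reflection term become nondecreasing after adding a
    linear term, as [rough_path_no_ties] requires. *)
Lemma inclusion_path_no_ties (x0 : 'rV[R]_N) w beta x l : inclusion_path x0 w beta x l ->
  rough_path sigma w -> continuous_coords w ->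
  {ae leb, forall s : R, 0 <= s -> no_ties (x s)}.
Proof.
move=> sol rw cw.
pose C := K + coef_bound m.
pose A (k : 'I_N) t := x0 0 k + (m 0 k + C) * t
  + \int[leb]_(s in `[0, t]) beta s 0 k + l t 0 k.
apply: (@rough_path_no_ties _ _ sigma w x A C) => //.
- exact: inclusion_path_continuous sol.
- move=> k s t s0 st.
  have sel := inclusion_path_selection sol t.
  have intb := drift_selection_integrable k sel.
  have incr := Rintegral_increment s0 st (lexx t) intb.
  pose D : set (measurableTypeR R) := `]s, t].
  have mD : measurable D by exact: measurable_itv.
  have Dsub : D `<=` `[0, t].
    by move=> u; rewrite /D /= !in_itv/= => /andP[su ->]; rewrite (le_trans s0 (ltW su)).
  have intD : leb.-integrable D (EFin \o (fun u => -1 * beta u 0 k)).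
    have m0t : measurable (`[0, t] : set (measurableTypeR R)) by exact: measurable_itv.
    have := integrableZl mD (-1) (integrableS m0t mD Dsub intb).
    by apply: eq_integrable => // u _; rewrite /= EFinM.
  have intDb : leb.-integrable D (EFin \o (fun u => beta u 0 k)).
    have m0t : measurable (`[0, t] : set (measurableTypeR R)) by exact: measurable_itv.
    exact: (integrableS m0t mD Dsub intb).
  have := @Rintegral_ae_le _ D mD (leb_itv_oc_lty s t) (fun u => -1 * beta u 0 k) K intD.
  have bK : {ae leb, forall u, D u -> -1 * beta u 0 k <= K}.
    apply: ae_imply (drift_selection_bound k sel) => u /[swap] Du.
    by move=> /(_ (Dsub _ Du)); rewrite ler_norml mulN1r => /andP[? _]; lra.
  move=> /(_ bK); rewrite RintegralZl// -incr.
  rewrite /D lebesgue_measure_itv/= lte_fin.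
  have -> : K * fine (if s < t then (t%:E - s%:E)%E else 0%E) = K * (t - s).
    by case: ltgtP st => // ->; rewrite subrr.
  move=> h1; have h2 := inclusion_path_mono sol k s0 st.
  have h3 : 0 <= (m 0 k + coef_bound m) * (t - s).
    rewrite mulr_ge0 ?subr_ge0//.
    by have := coef_le_bound m k; rewrite ler_norml => /andP[? _]; lra.
  have alg (c mk kk cm It Is lt ls : R) : -1 * (It - Is) <= kk * (t - s) -> ls <= lt ->
      0 <= (mk + cm) * (t - s) ->
      c + (mk + (kk + cm)) * s + Is + ls <= c + (mk + (kk + cm)) * t + It + lt.
    clear; move=> ? ? ?; lra.
  exact: (alg _ _ _ _ _ _ _ _ h1 h2 h3).
- by move=> k t t0; rewrite (inclusion_path_eq sol k t0) /A; ring.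
Qed.

(** The solutions agree and are free of ties at almost every time, so the two
    drifts agree there; the reflection terms are what remains of the equation. *)
Lemma inclusion_path_push_unique (x0 : 'rV[R]_N) w beta beta' x x' l l' :
  inclusion_path x0 w beta x l -> inclusion_path x0 w beta' x' l' ->
  rough_path sigma w -> continuous_coords w ->
  forall t, 0 <= t -> l t = l' t.
Proof.
move=> sol sol' rw cw t t0; apply/rowP => i.
have xx' := inclusion_path_unique sol sol'.
have nt := inclusion_path_no_ties sol rw cw.
have [mb ab] := inclusion_path_selection sol t.
have [mb' ab'] := inclusion_path_selection sol' t.
have m0t : measurable (`[0, t] : set (measurableTypeR R)) by exact: measurable_itv.
have same : {ae leb, forall s, `[0, t] s -> beta s 0 i = beta' s 0 i}.
  apply: ae_imply2 (ae_imply2 (fun s h1 h2 => conj h1 h2) ab ab') nt => s [ds ds'] nts s0t.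
  have s0 : 0 <= s by move: s0t; rewrite /= in_itv/= => /andP[].
  rewrite (drift_set_no_ties (nts s0) (ds s0t)).
  have := ds' s0t; rewrite -(xx' s s0) => ds'E.
  by rewrite (drift_set_no_ties (nts s0) ds'E).
have intE := Rintegral_ae_eq m0t (mb i) (mb' i) same.
have := inclusion_path_eq sol i t0; rewrite (xx' t t0) (inclusion_path_eq sol' i t0) intE.
by move=> /addrI.
Qed.

End inclusion_paths.

Section from_processes.
Context {R : realType} {d : measure_display} {Om : measurableType d}.
Context (P : probability Om R) (F : R -> set_system Om) {N : nat}.
Local Open Scope classical_set_scope.
Local Notation leb := (@lebesgue_measure R).
Hypothesis basis : usual_basis P F.
Variables (b m sigma : 'rV[R]_N).
Hypothesis sigma0 : forall i, 0 < sigma 0 i.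
Implicit Types (X L B beta : R -> Om -> 'rV[R]_N) (w : Om).

(** A countable intersection of almost sure events, enumerated by pairs of
    indices and horizons. *)
Lemma brownian_rough_path B : brownian_motion P F B ->
  {ae P, forall w, rough_path sigma (B ^~ w)}.
Proof.
move=> BM.
pose Q (n : nat) (w : Om) : Prop :=
  if @unpickle ('I_N * 'I_N * nat)%type n is Some (i, j, k) then i != j ->
    rough (fun t => sigma 0 i * B (Num.max 0 t) w 0 i - sigma 0 j * B (Num.max 0 t) w 0 j)
      k%:R
  else True.
have QP n : {ae P, forall w, Q n w}.
  rewrite /Q; case: unpickle => [[[i j] k]|]; last by apply: aeW.
  have [ij|ij] := boolP (i != j); last by apply: aeW.
  apply: ae_imply (brownian_rough basis BM (sigma0 i) (sigma0 j) ij (ler0n _ k)) => w rw _.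
  exact: rw.
apply: ae_imply (ae_foralln QP) => w Qw i j k ij.
by have := Qw (pickle (i, j, k)); rewrite /Q pickleK; apply.
Qed.

Lemma continuous_path_coords (x : R -> 'rV[R]_N) :
  continuous_path x -> continuous_coords x.
Proof. by move=> cx i; exact: continuous_path_coord. Qed.

Lemma brownian_continuous_coords B w : brownian_motion P F B -> continuous_coords (B ^~ w).
Proof.
by move=> BM; apply: continuous_path_coords; exact: (@brownian_continuous _ _ _ _ _ _ _ BM w).
Qed.

Lemma progressive_section beta w (T : R) i : progressively_measurable F beta ->
  measurable_fun (`[0, T] : set R) (fun s => beta s w 0 i).
Proof.
move=> pb; have [T0|T0] := leP 0 T; last first.
  rewrite set_itv_ge; first exact: measurable_fun_set0.
  by rewrite bnd_simp -ltNge.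
have mpair : measurable_fun (`[0, T] : set R)
    (fun s : R => (s, w : g_sigma_algebraType (F T))).
  by apply: measurable_funTS; exact: pair2_measurable.
apply: (measurable_comp _ _ (pb T i T0) mpair).
  by apply: measurableX; [exact: measurable_itv|exact: measurableT].
by move=> _ [s st <-]; split.
Qed.

Lemma progressive_selection beta (x : R -> 'rV[R]_N) w (T : R) : progressively_measurable F beta ->
  {ae leb, forall t : R, 0 <= t -> drift_set b (x t) (beta t w)} ->
  drift_selection b x (beta ^~ w) T.
Proof.
move=> pb ae_b; split=> [i|]; first exact: progressive_section.
by apply: ae_imply ae_b => u + ; rewrite /= in_itv/= => + /andP[u0 _]; exact.
Qed.

Lemma SDI_inclusion_path beta X x0 B w : progressively_measurable F beta ->
  continuous_path (X ^~ w) ->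
  SDI b m sigma x0 (B ^~ w) (beta ^~ w) (X ^~ w) ->
  inclusion_path b m sigma false x0 (B ^~ w) (beta ^~ w) (X ^~ w) (fun=> 0).
Proof.
move=> pb cX [eqX ae_b]; split => //.
- exact: continuous_path_coords.
- by move=> T; exact: progressive_selection.
- by move=> t i t0; rewrite mxE addr0 eqX.
- by move=> i; rewrite mxE.
- by move=> t i _ _; rewrite mxE.
Qed.

Lemma SDIR_inclusion_path beta X L x0 B w : progressively_measurable F beta ->
  nonneg_continuous_path (X ^~ w) -> (forall i, C0up (fun t => L t w 0 i)) ->
  SDIR b m sigma x0 (B ^~ w) (beta ^~ w) (X ^~ w) (L ^~ w) ->
  inclusion_path b m sigma true x0 (B ^~ w) (beta ^~ w) (X ^~ w) (L ^~ w).
Proof.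
move=> pb [cX X0] cL [eqX ae_b st]; split => //.
- exact: continuous_path_coords.
- by move=> T; exact: progressive_selection.
- by move=> t i _; exact: X0.
- by move=> i; have [_ ->] := cL i.
- by move=> i s t; have [_ _ + _] := cL i; exact.
- move=> i; have [_ _ mon _] := cL i.
  have cXi := @continuous_path_coord _ _ (X ^~ w) i cX.
  by apply: (stieltjes_flat cXi _ (st i) mon) => t t0; exact: X0.
Qed.

Lemma progressive_rank_solution X : adapted F X ->
  (forall w, continuous_path (X ^~ w)) ->
  progressively_measurable F (fun s w => rank_drift b (X s w)).
Proof.
move=> aX cX; have cX' : continuous_process X by move=> w; exact: continuous_path_coords.
exact: (progressive_rank_drift basis b aX cX').
Qed.

Lemma rank_drift_integral (x : R -> 'rV[R]_N) t i :
  \int[leb]_(s in `[0, t]) rank_drift b (x s) 0 i =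
  \int[leb]_(s in `[0, t]) b 0 (rank_ord i (x s)).
Proof. by apply: eq_Rintegral => s _; rewrite mxE. Qed.

(** The drifts read off the ranks form a progressively measurable selection. *)
Lemma strong_solution_SDE_SDI (X0 : Om -> 'rV[R]_N) B X :
  strong_solution_SDE b m sigma P F X0 B X ->
  strong_solution_SDI b m sigma P F X0 B X.
Proof.
move=> [aX cX eqX]; split => //.
exists (fun s w => rank_drift b (X s w)); first exact: progressive_rank_solution.
apply: ae_imply eqX => w eqX; split.
  by move=> t i t0; rewrite rank_drift_integral eqX.
by apply: aeW => t _; exact: rank_drift_set.
Qed.

Lemma strong_solution_SDER_SDIR (X0 : Om -> 'rV[R]_N) B X L :
  strong_solution_SDER b m sigma P F X0 B X L ->
  strong_solution_SDIR b m sigma P F X0 B X L.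
Proof.
move=> [aX aL rXL eqX]; split => //.
exists (fun s w => rank_drift b (X s w)).
  by apply: progressive_rank_solution => // w; have [+ _] := rXL; move=> /(_ w)[].
apply: ae_imply eqX => w [eqX st]; split => //.
  by move=> t i t0; rewrite rank_drift_integral; have [] := eqX t i t0.
by apply: aeW => t _; exact: rank_drift_set.
Qed.

End from_processes.

Section uniqueness.
Context {R : realType} {N : nat}.
Local Open Scope classical_set_scope.
Variables (b m sigma : 'rV[R]_N).
Hypothesis sigma0 : forall i, 0 < sigma 0 i.
Hypothesis bd : forall i j : 'I_N, (i <= j)%N -> b 0 j <= b 0 i.

Lemma pathwise_uniqueness_SDI : pathwise_uniqueness (weak_solution_SDI b m sigma).
Proof.
move=> d Om P F X X' B [_ [_ cX [beta pb eqX]]] [_ [_ cX' [beta' pb' eqX']]] X0.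
apply: ae_imply2 (ae_imply2 (fun w h1 h2 => conj h1 h2) eqX eqX') X0 => w [eX eX'] X0w.
rewrite -X0w in eX'.
exact: (inclusion_path_unique bd (SDI_inclusion_path pb (cX w) eX)
  (SDI_inclusion_path pb' (cX' w) eX')).
Qed.

Lemma pathwise_uniqueness_SDIR :
  pathwise_uniqueness_reflected (weak_solution_SDIR b m sigma).
Proof.
move=> d Om P F X L X' L' B [[basis BM _] [_ _ [cX cL] [beta pb eqX]]].
move=> [_ [_ _ [cX' cL'] [beta' pb' eqX']]] X0.
have rB := brownian_rough_path basis sigma0 BM.
have both : {ae P, forall w, (forall t, 0 <= t -> X t w = X' t w) /\
    (forall t, 0 <= t -> L t w = L' t w)}.
  apply: ae_imply2 (ae_imply2 (fun w h1 h2 => conj h1 h2) eqX eqX')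
    (ae_imply2 (fun w h1 h2 => conj h1 h2) X0 rB) => w [eX eX'] [X0w rw].
  rewrite -X0w in eX'.
  have sol := SDIR_inclusion_path pb (cX w) (cL w) eX.
  have sol' := SDIR_inclusion_path pb' (cX' w) (cL' w) eX'.
  have cB : continuous_coords (B ^~ w) by exact: brownian_continuous_coords BM.
  split; first exact: (inclusion_path_unique bd sol sol').
  exact: (inclusion_path_push_unique bd sol sol' rw cB).
by split; apply: ae_imply both => w [].
Qed.

End uniqueness.

(** * Existence for the equations *)

Section existence.
Context {R : realType} {d : measure_display} {Om : measurableType d}.
Context (P : probability Om R) (F : R -> set_system Om) {N : nat}.
Local Open Scope classical_set_scope.
Local Notation leb := (@lebesgue_measure R).
Variables (b m sigma : 'rV[R]_N) (refl : bool).
Hypothesis sigma0 : forall i, 0 < sigma 0 i.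
Hypothesis bd : forall i j : 'I_N, (i <= j)%N -> b 0 j <= b 0 i.
Variables (B : R -> Om -> 'rV[R]_N) (X0 : Om -> 'rV[R]_N).
Hypothesis basis : usual_basis P F.
Hypothesis BM : brownian_motion P F B.
Hypothesis mX0 : filtration_measurable_fun F 0 X0.
Hypothesis X0_ge0 : refl -> forall w i, 0 <= X0 w 0 i.
Local Notation K := (coef_bound b).

(** A Brownian motion starts at 0 only almost surely. Its increments from time
    0 are used so that the driver starts at X0 for every omega and the scheme
    can be run, and stays adapted, without exceptional sets. *)
Definition driver (t : R) (w : Om) : 'rV[R]_N := \row_i (X0 w 0 i +
  sigma 0 i * (B (Num.max 0 t) w 0 i - B 0 w 0 i) + m 0 i * Num.max 0 t).

Let W (w : Om) : R -> 'rV[R]_N := driver ^~ w.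

Lemma driver_continuous w i : continuous (fun t => W w t 0 i).
Proof.
have -> : (fun t => W w t 0 i) = (fun t => X0 w 0 i +
    sigma 0 i * (B (Num.max 0 t) w 0 i - B 0 w 0 i) + m 0 i * Num.max 0 t).
  by apply/funext => t; rewrite /W mxE.
move=> t; apply: cvgD; first apply: cvgD; first exact: cvg_cst.
  apply: cvgM; first exact: cvg_cst.
  apply: cvgB; last exact: cvg_cst.
  exact: (brownian_continuous_coords BM).
apply: cvgM; first exact: cvg_cst.
exact: continuous_maxr0.
Qed.

Lemma driver0 w i : W w 0 0 i = X0 w 0 i.
Proof. by rewrite /W mxE maxr0_id// subrr !mulr0 !addr0. Qed.

Lemma driver_adapted : adapted F driver.
Proof.
move=> t t0 i; under eq_fun do rewrite mxE maxr0_id//.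
apply: measurable_funD => //; apply: measurable_funD.
  by apply: (filtration_measurable_le basis (lexx 0) t0); exact: mX0.
apply: measurable_funM => //; apply: measurable_funB.
  exact: (brownian_adapted BM).
apply: (filtration_measurable_le basis (lexx 0) t0).
exact: (brownian_adapted BM).
Qed.

Let h (n : nat) : R := n.+1%:R^-1.
Let h_gt0 n : 0 < h n. Proof. by rewrite invr_gt0. Qed.
Let cvg_h : h n @[n --> \oo] --> (0 : R). Proof. exact: cvg_harmonic. Qed.
Let x (w : Om) (n : nat) : R -> 'rV[R]_N := delay_solution b refl (W w) (h n).
Let l (w : Om) (n : nat) : R -> 'rV[R]_N := delay_push b refl (W w) (h n).
Let cW w i : continuous (fun t => W w t 0 i). Proof. exact: driver_continuous. Qed.

Let xl w n : delay_reflected b refl (W w) (h n) (x w n) (l w n).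
Proof.
by apply: delay_solution_reflected => // r i; rewrite driver0; exact: X0_ge0.
Qed.

Let X (t : R) (w : Om) : 'rV[R]_N := limit_path (x w) t.

Let X_continuous w : continuous_coords (X ^~ w).
Proof.
exact: (@limit_path_continuous _ _ b refl bd (W w) h (x w) (l w) (@cW w) h_gt0 cvg_h (xl w)).
Qed.

Let X_adapted : adapted F X.
Proof.
move=> t t0 i.
apply: (@measurable_fun_cvg _ (g_sigma_algebraType (F t)) R setT
  (fun n (w : g_sigma_algebraType (F t)) => x w n t 0 i)).
  move=> n; apply: (adapted_delay_solution basis b refl driver_adapted driver_continuous) => //.
  exact: ltW.
move=> w _.
exact: (@limit_path_cvg _ _ b refl bd (W w) h (x w) (l w) (@cW w) h_gt0 cvg_h (xl w) t i t0).
Qed.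

Let good (w : Om) : Prop := {ae leb, forall s : R, 0 <= s -> no_ties (X s w)}.

Let good_ae : {ae P, forall w, good w}.
Proof.
apply: ae_imply (brownian_rough_path basis sigma0 BM) => w rw.
pose M := coef_bound m.
pose A (k : 'I_N) t := (X t w 0 k - W w t 0 k + K * t) +
  (X0 w 0 k - sigma 0 k * B 0 w 0 k) + (m 0 k + M) * t.
apply: (@rough_path_no_ties _ _ sigma (B ^~ w) (X ^~ w) A (K + M)) => //.
- exact: brownian_continuous_coords BM.
- move=> k s t s0 st; apply: lerD; first apply: lerD => //.
    exact: (@limit_path_growth _ _ b refl bd (W w) h (x w) (l w) (@cW w) h_gt0 cvg_h (xl w)).
  apply: ler_wpM2l => //.
  by have := coef_le_bound m k; rewrite ler_norml => /andP[? _]; rewrite /M; lra.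
- by move=> k t t0; rewrite /A /W [driver t w 0 k]mxE maxr0_id//; ring.
Qed.

(* the limit reflection term has the required paths only off a null set, which
   belongs to F 0, so that setting L = 0 there keeps it adapted *)
Let L (t : R) (w : Om) : 'rV[R]_N :=
  if `[< good w >] then limit_push b (W w) (x w) t else 0.

Let L_adapted : adapted F L.
Proof.
move=> t t0 i.
have FtE := sigma_algebra_id (filtration_sigma_algebra basis t0).
have mgood : measurable_fun [set: g_sigma_algebraType (F t)]
    (fun w : g_sigma_algebraType (F t) => `[< good w >]).
  apply: (measurable_fun_bool true); rewrite setTI.
  have bad : F t (~` [set w | good w]).
    apply: (filtration_nondecreasing basis (lexx 0) t0).
    exact: (filtration_null_sets basis).
  have -> : (fun w => `[< good w >]) @^-1` [set true] = ~` (~` [set w | good w]).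
    by rewrite setCK; apply/seteqP; split => w /asboolP.
  apply: (@measurableC _ (g_sigma_algebraType (F t))).
  exact: sub_sigma_algebra.
have mdrift := adapted_delayed_drift basis b i (lexx 0) t0 X_adapted X_continuous.
have mL : measurable_fun [set: g_sigma_algebraType (F t)]
    (fun w : g_sigma_algebraType (F t) =>
      (X t w 0 i - driver t w 0 i - delayed_drift b (X ^~ w) 0 i t) *
      (`[< good w >])%:R).
  apply: measurable_funM; last exact: measurable_fun_natmul_bool.
  apply: measurable_funB => //; apply: measurable_funB; first exact: X_adapted.
  exact: driver_adapted.
apply: (eq_measurable_fun _ _ mL) => w _.
by rewrite /L; case: ifP => _; rewrite !mxE ?mulr1 ?mulr0.
Qed.

Let L_C0up w i : C0up (fun t => L t w 0 i).
Proof.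
have [g|g] := pselect (good w); last first.
  have -> : (fun t => L t w 0 i) = cst 0.
    by apply/funext => t; rewrite /L asboolF// mxE.
  by split => // s; exact: cvg_cst.
have -> : (fun t => L t w 0 i) = (fun t => limit_push b (W w) (x w) t 0 i).
  by apply/funext => t; rewrite /L asboolT.
have l0 := @limit_push0 _ _ b refl bd (W w) h (x w) (l w) (@cW w) h_gt0 cvg_h (xl w) g i.
have lmon := @limit_push_mono _ _ b refl bd (W w) h (x w) (l w) (@cW w) h_gt0 cvg_h (xl w) g i.
split => //.
- apply/continuous_pathP.
  exact: (@limit_push_continuous _ _ b refl bd (W w) h (x w) (l w) (@cW w) h_gt0 cvg_h (xl w)).
- by move=> t t0; rewrite -l0; exact: lmon.
Qed.

(** The limit of the delay schemes with delays 1 / (n + 1); for refl = false it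
    solves the equation without reflection. *)
Lemma rank_reflected_existence : exists X L : R -> Om -> 'rV[R]_N,
  [/\ adapted F X, adapted F L,
    (forall w, continuous_path (X ^~ w)) /\
      (forall w t i, refl -> 0 <= t -> 0 <= X t w 0 i),
    (forall w i, C0up (fun t => L t w 0 i)) &
    {ae P, forall w, [/\ forall t i, 0 <= t -> X t w 0 i =
         X0 w 0 i + sigma 0 i * B t w 0 i + m 0 i * t
         + \int[leb]_(s in `[0, t]) b 0 (rank_ord i (X s w)) + L t w 0 i,
       (forall i, flat_off_zero (fun t => X t w 0 i) (fun t => L t w 0 i)) &
       (forall t i, ~~ refl -> 0 <= t -> L t w 0 i = 0)]}].
Proof.
exists X, L; split.
- exact: X_adapted.
- exact: L_adapted.
- split; first by move=> w; apply: continuous_pathW; exact: X_continuous.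
  move=> w t i r t0.
  exact: (@limit_path_ge0 _ _ b refl bd (W w) h (x w) (l w) (@cW w) h_gt0 cvg_h (xl w) t i r t0).
- exact: L_C0up.
apply: ae_imply2 good_ae (brownian_start BM) => w g B0.
have LE t i : L t w 0 i = limit_push b (W w) (x w) t 0 i by rewrite /L asboolT.
split.
- move=> t i t0; rewrite LE.
  have -> : limit_push b (W w) (x w) t 0 i =
      X t w 0 i - driver t w 0 i - delayed_drift b (limit_path (x w)) 0 i t.
    by rewrite [LHS]mxE.
  have -> : driver t w 0 i = X0 w 0 i + sigma 0 i * B t w 0 i + m 0 i * t.
    by rewrite [LHS]mxE maxr0_id// B0 mxE subr0.
  have -> : delayed_drift b (limit_path (x w)) 0 i t =
      \int[leb]_(s in `[0, t]) b 0 (rank_ord i (X s w)).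
    rewrite -delayed_driftE; apply: eq_Rintegral => s.
    by rewrite inE/= in_itv/= => /andP[s0 _]; rewrite /delay subr0 maxr0_id.
  ring.
- move=> i; have -> : (fun t => L t w 0 i) = (fun t => limit_push b (W w) (x w) t 0 i).
    by apply/funext.
  exact: (@limit_push_flat _ _ b refl bd (W w) h (x w) (l w) (@cW w) h_gt0 cvg_h (xl w) g i).
- move=> t i r t0; rewrite LE.
  exact: (@limit_push_off _ _ b refl bd (W w) h (x w) (l w) (@cW w) h_gt0 cvg_h (xl w) g t i r t0).
Qed.

End existence.

Section strong_existence.
Context {R : realType} {N : nat}.
Local Open Scope classical_set_scope.
Variables (b m sigma : 'rV[R]_N).
Hypothesis sigma0 : forall i, 0 < sigma 0 i.
Hypothesis bd : forall i j : 'I_N, (i <= j)%N -> b 0 j <= b 0 i.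

Lemma strong_existence_SDE : strong_existence (strong_solution_SDE b m sigma).
Proof.
move=> d Om P F B X0 basis BM mX0.
have [//|X [L [aX _ [cX _] _ sol]]] :=
  @rank_reflected_existence R d Om P F N b m sigma false sigma0 bd B X0 basis BM mX0.
exists X; split => //; apply: ae_imply sol => w [eqX _ L0] t i t0.
by rewrite eqX// L0// addr0.
Qed.

Lemma strong_existence_SDER :
  strong_existence_reflected (strong_solution_SDER b m sigma).
Proof.
move=> d Om P F B X0 basis BM mX0 X0_ge0.
have [//|X [L [aX aL [cX pX] cL sol]]] :=
  @rank_reflected_existence R d Om P F N b m sigma true sigma0 bd B X0 basis BM mX0.
have nonneg w : nonneg_continuous_path (X ^~ w).
  by split; [exact: cX|move=> t i; exact: pX].
exists X, L; split => //; apply: ae_imply sol => w [eqX flat _]; split.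
  by move=> t i t0; split; [exact: eqX|exact: pX].
move=> i; apply: flat_stieltjes => //.
- exact: (@continuous_path_coord _ _ (X ^~ w) i (cX w)).
- by move=> t; exact: pX.
Qed.

End strong_existence.

Theorem theorem2p2 (R : realType) (N : nat) (b m sigma : 'rV[R]_N)
    (sigma_gt0 : forall i : 'I_N, 0 < sigma 0 i)
    (b_nonincreasing : forall i j : 'I_N, (i <= j)%N -> b 0 j <= b 0 i) :
  (pathwise_uniqueness (weak_solution_SDE b m sigma)
   /\ strong_existence (strong_solution_SDE b m sigma)) /\
  (pathwise_uniqueness_reflected (weak_solution_SDER b m sigma)
   /\ strong_existence_reflected (strong_solution_SDER b m sigma)) /\
  (pathwise_uniqueness (weak_solution_SDI b m sigma)
   /\ strong_existence (strong_solution_SDI b m sigma)) /\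
  (pathwise_uniqueness_reflected (weak_solution_SDIR b m sigma)
   /\ strong_existence_reflected (strong_solution_SDIR b m sigma)).
Proof.
have uSDI := @pathwise_uniqueness_SDI R N b m sigma b_nonincreasing.
have uSDIR := @pathwise_uniqueness_SDIR R N b m sigma sigma_gt0 b_nonincreasing.
have eSDE := @strong_existence_SDE R N b m sigma sigma_gt0 b_nonincreasing.
have eSDER := @strong_existence_SDER R N b m sigma sigma_gt0 b_nonincreasing.
split; first split => //.
  move=> d Om P F X X' B [sX sol] [sX' sol'].
  have [basis _ _] := sX.
  apply: (uSDI _ _ _ F _ _ B); split => //; exact: strong_solution_SDE_SDI.
split; first split => //.
  move=> d Om P F X L X' L' B [sX sol] [sX' sol'].
  have [basis _ _] := sX.
  apply: (uSDIR _ _ _ F _ _ _ _ B); split => //; exact: strong_solution_SDER_SDIR.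
split; split => //.
- move=> d Om P F B X0 basis BM mX0.
  have [X solX] := eSDE _ _ _ _ _ _ basis BM mX0.
  by exists X; exact: strong_solution_SDE_SDI.
- move=> d Om P F B X0 basis BM mX0 X0_ge0.
  have [X [L solXL]] := eSDER _ _ _ _ _ _ basis BM mX0 X0_ge0.
  by exists X, L; exact: strong_solution_SDER_SDIR.
Qed.
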